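(* Let $0<p<\infty$ and let $g\in H(\mathbb{D})$ be such that $T_{g}:\mathcal{D}^{p}_{p-1}\rightarrow F(p,p-1,1)$ is bounded. Then $$\|T_{g}\|_{e,\mathcal{D}^{p}_{p-1}\rightarrow F(p,p-1,1)}\approx\limsup_{|z|\rightarrow1^{-}}(1-|z|^{2})|g'(z)|\approx\operatorname{dist}_{\mathcal{B}}(g,\mathcal{B}_{0}).$$
   Context: $\mathbb{D}$ is the open unit disc of $\mathbb{C}$, $H(\mathbb{D})$ the space of analytic functions on $\mathbb{D}$, and $dA(z)=\frac1\pi\,dx\,dy$ the normalized area measure. Volterra type operator: $T_gf(z)=\int_0^z f(\xi)g'(\xi)\,d\xi$ for $f\in H(\mathbb{D})$, $z\in\mathbb{D}$. Bloch space: $\mathcal{B}$ is the set of $f\in H(\mathbb{D})$ with $\|f\|_{\mathcal{B}}=\sup_{z\in\mathbb{D}}(1-|z|^2)|f'(z)|<\infty$ (a semi-norm). Little Bloch space: $\mathcal{B}_0$ is the set of $f\in\mathcal{B}$ with $\lim_{|z|\to1^-}(1-|z|^2)|f'(z)|=0$. For $g\in\mathcal{B}$, $\operatorname{dist}_{\mathcal{B}}(g,\mathcal{B}_0)=\inf_{h\in\mathcal{B}_0}\|g-h\|_{\mathcal{B}}$. Dirichlet type space: $\mathcal{D}^{p}_{p-1}$ is the set of $f\in H(\mathbb{D})$ with $$\|f\|_{\mathcal{D}^{p}_{p-1}}=\Big(|f(0)|^{p}+\int_{\mathbb{D}}|f'(z)|^{p}(1-|z|^{2})^{p-1}dA(z)\Big)^{1/p}<\infty.$$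 $F(p,q,s)$ space ($0<p<\infty$, $q>-2$, $0<s<\infty$): the set of $f\in H(\mathbb{D})$ with $$\|f\|_{F(p,q,s)}^{p}=|f(0)|^{p}+\sup_{a\in\mathbb{D}}\int_{\mathbb{D}}|f'(z)|^{p}(1-|z|^{2})^{q}(1-|\sigma_{a}(z)|^{2})^{s}dA(z)<\infty,\qquad \sigma_a(z)=\frac{a-z}{1-\overline{a}z}.$$ Essential norm: for a bounded linear operator $T:X\to Y$, $\|T\|_{e,X\to Y}=\inf\{\|T-K\|_{X\to Y}: K:X\to Y \text{ compact linear}\}$, where $\|\cdot\|_{X\to Y}$ is the operator norm $\sup\{\|Tf\|_Y:\|f\|_X\le1\}$; the same formula is used for $0<p<1$, when the spaces are only quasi-normed. $A\approx B$ means $C^{-1}B\le A\le CB$ for a constant $C>0$ depending only on $p$ (not on $g$). *)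

(* Defs.v *)
From HB Require Import structures.
From mathcomp Require Import all_boot all_order all_algebra.
From mathcomp Require Import complex.
From mathcomp Require Import all_classical all_reals all_analysis.

Set Implicit Arguments.
Unset Strict Implicit.
Unset Printing Implicit Defensive.

Import Order.TTheory GRing.Theory Num.Theory.
Import numFieldNormedType.Exports.

Local Open Scope classical_set_scope.
Local Open Scope ring_scope.

(* The regular structure R[i]^o is what carries the norm and the topology of
   the numFieldType R[i]; in particular [derivable] and [derive1] at this type
   are complex differentiability and the complex derivative. *)
Notation Cplx R := (complex R)^o.

Section DiscFunctionSpaces.
Variable R : realType.
Local Notation C := (Cplx R).
Local Notation leb := (@lebesgue_measure R).
Implicit Types (f g h : C -> C) (z a : C) (p q s : R).

(* The norm `|z| of R[i] is itself an element of R[i]; this is the modulus as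
   a real number. *)
Definition cmod z : R := complex.Re `|z|.

Definition disc : set C := [set z | cmod z < 1].

(* Analytic functions on the disc, represented by their extension by 0 to the
   whole plane, so that two elements of H(D) are equal iff they agree on D. *)
Definition hol_disc : set (C -> C) :=
  [set f | (forall z, disc z -> derivable f z 1) /\
           (forall z, ~ disc z -> f z = 0)].

(* The line integral of h along the segment from 0 to z, parametrized by
   xi = t z with 0 <= t <= 1. *)
Definition segment_integral h z : C :=
  z * Complex
        (\int[leb]_(t in `[0, 1]) complex.Re (h ((t%:C)%C * z)))
        (\int[leb]_(t in `[0, 1]) complex.Im (h ((t%:C)%C * z))).

Definition volterra g f : C -> C :=
  (segment_integral (fun xi => f xi * derive1 g xi)) \_ disc.

(* Integral over the disc of a nonnegative function with respect to the
   normalized area measure dx dy / pi. *)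
Definition area_integral (F : C -> R) : \bar R :=
  ((pi^-1)%:E *
   \int[(leb \x leb)%E]_(w in [set w : R * R | disc (Complex w.1 w.2)])
     (F (Complex w.1 w.2))%:E)%E.

Definition dirichlet_norm p f : \bar R :=
  (((cmod (f 0) `^ p)%R%:E +
    area_integral (fun z => cmod (derive1 f z) `^ p *
                            (1 - cmod z ^+ 2) `^ (p - 1))%R) `^ p^-1)%E.

Definition dirichlet_space p : set (C -> C) :=
  [set f | hol_disc f /\ (dirichlet_norm p f < +oo)%E].

Definition mobius a z : C := (a - z) / (1 - (a^*)%C * z).

Definition F_norm p q s f : \bar R :=
  (((cmod (f 0) `^ p)%R%:E +
    ereal_sup [set area_integral (fun z => cmod (derive1 f z) `^ p *
                                           (1 - cmod z ^+ 2) `^ q *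
                                           (1 - cmod (mobius a z) ^+ 2) `^ s)%R
              | a in disc]) `^ p^-1)%E.

Definition F_space p q s : set (C -> C) :=
  [set f | hol_disc f /\ (F_norm p q s f < +oo)%E].

Definition bloch_weight f z : R := (1 - cmod z ^+ 2) * cmod (derive1 f z).

Definition bloch_norm f : \bar R :=
  ereal_sup [set (bloch_weight f z)%:E | z in disc].

Definition bloch : set (C -> C) :=
  [set f | hol_disc f /\ (bloch_norm f < +oo)%E].

(* |z| -> 1^- : the inverse image of the filter 1^'- under the modulus. *)
Definition to_circle : set_system C :=
  [set A | \forall r \near (1 : R)^'-, forall z, cmod z = r -> A z].

Definition little_bloch : set (C -> C) :=
  [set f | bloch f /\ bloch_weight f @ to_circle --> (0 : R)].

Definition dist_little_bloch g : \bar R :=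
  ereal_inf [set bloch_norm (g \- h) | h in little_bloch].

Definition bloch_limsup g : \bar R :=
  limf_esup (fun z => (bloch_weight g z)%:E) to_circle.

End DiscFunctionSpaces.

(* A (quasi-)normed space of functions is given by its underlying set X and its
   quasi-norm NX; an operator from (X, NX) to (Y, NY) is a map on all functions
   of which only the values on X matter.  For elements of H(D), vanishing off
   the disc, the equality in [linear_op] is equality on the disc. *)
Section Operators.
Variable R : realType.
Local Notation C := (Cplx R).
Variables (X Y : set (C -> C)) (NX NY : (C -> C) -> \bar R).
Implicit Types T K : (C -> C) -> (C -> C).

Definition op_norm T : \bar R :=
  ereal_sup [set NY (T f) | f in [set f | X f /\ (NX f <= 1)%E]].

Definition linear_op T : Prop :=
  (forall f, X f -> Y (T f)) /\
  (forall (c : C) f h, X f -> X h ->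
     T (fun z => c * f z + h z) = (fun z => c * T f z + T h z)).

Definition bounded_op T : Prop := linear_op T /\ (op_norm T < +oo)%E.

Definition compact_op K : Prop :=
  linear_op K /\
  forall (M : R) (u : nat -> (C -> C)),
    (forall n, X (u n) /\ (NX (u n) <= M%:E)%E) ->
    exists (k : nat -> nat) (h : C -> C),
      [/\ {homo k : m n / (m < n)%N}, Y h &
          NY (K (u (k n)) \- h) @[n --> \oo] --> 0%E].

Definition ess_norm T : \bar R :=
  ereal_inf [set op_norm (fun f => T f \- K f) | K in compact_op].

End Operators.

Definition comparable_up_to (R : realType) (c : R) (A B : \bar R) : Prop :=
  ((c^-1)%:E * B <= A)%E /\ (A <= c%:E * B)%E.

(* Main.v *)
(* Proof idea.  Write W(z) = 1 - |z|^2 and om_a(z) = (1 - |a|^2) / |1 - conj(a) z|^2,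
   so that 1 - |sigma_a|^2 = W om_a and ||T_g f||_F^p is the supremum over a of
   the integral of |f|^p (W |g'|)^p om_a.
   Upper bound: a Carleson embedding bounds the integral of |f|^p om_a by the
   p-th power of the Dirichlet type norm of f, uniformly in a; it follows from
   chaining f(z) - f(0) through dyadic points of the segment [0, z], the
   sub-mean value property of |f'|^p and Fubini.  Hence
   ||T_g - T_h|| <= C ||g - h||_B, and a normal family argument shows that T_h
   is compact for h in the little Bloch space.  The dilations g(r z) give
   dist(g, B_0) <= 2 limsup.
   Lower bound: f_a(z) = (1 - |a|^2)^(b - 1/p) / (1 - conj(a) z)^b has bounded norm.
   If |a_n| -> 1 and K is compact, K f_(a_n) converges along a subsequence, so
   T_g (f_(a_n) - f_(a_m)) is controlled by T_g - K up to a small error, while the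
   sub-mean value property bounds its norm below by (1 - |a_n|^2) |g'(a_n)|. *)
Require Import Defs.
From HB Require Import structures.
From mathcomp Require Import all_boot all_order all_algebra.
From mathcomp Require Import complex.
From mathcomp Require Import all_classical all_reals all_analysis.
From mathcomp Require Import measurable_realfun.
From mathcomp Require Import ring lra.

Set Implicit Arguments.
Unset Strict Implicit.
Unset Printing Implicit Defensive.

Import Order.TTheory GRing.Theory Num.Theory.
Import numFieldNormedType.Exports.

Local Open Scope classical_set_scope.
Local Open Scope ring_scope.

(** * Complex differentiation and integration along segments *)

Section ComplexBasics.
Variable R : realType.
Local Notation C := (Cplx R).
Implicit Types (z w h l : C) (x y : R).

(** [hol_disc] gives pointwise complex differentiability and nothing more; integral formulas,
    smoothness and normal families are derived from it. Squares take the place of discs: they are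
    products of intervals, so edges of contours become slices of the area measure. Constants need
    not be sharp, and complex values are often bounded through real and imaginary parts at the cost
    of a factor 2.

    For p < 1 the triangle and Hoelder inequalities fail for p-th powers. They are replaced by (x +
    y)^p <= 2^p (x^p + y^p) and by sums with summable weights.

    The obstacle in the Carleson embedding is uniformity in a: |1 - conj(a) z|^(-s) is integrable
    over squares uniformly in a only for s < 2. The weights of the chain are tuned so that only s =
    1, 1/2 and 3/2 occur.

    In the lower bound, subtracting f_(a_m) is harmless because m is fixed: that function is
    bounded, while |f_(a_n)(a_n)| = (1 - |a_n|^2)^(-1/p) tends to infinity. *)

Lemma norm_cmod z : `|z| = ((cmod z)%:C)%C.
Proof. by rewrite /cmod; case: z => a b; rewrite normc_def. Qed.

Lemma cmodE z : cmod z = Num.sqrt (complex.Re z ^+ 2 + complex.Im z ^+ 2).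
Proof. by rewrite /cmod normc_def. Qed.

Lemma cmod_ge0 z : 0 <= cmod z.
Proof. by rewrite cmodE sqrtr_ge0. Qed.

Lemma cmod_sqr z : cmod z ^+ 2 = complex.Re z ^+ 2 + complex.Im z ^+ 2.
Proof. by rewrite cmodE sqr_sqrtr// addr_ge0// sqr_ge0. Qed.

Lemma rc_inj x y : (x%:C)%C = (y%:C)%C :> C -> x = y.
Proof. by case. Qed.

Lemma rcM x y : ((x * y)%:C)%C = (x%:C)%C * (y%:C)%C :> C.
Proof. exact: rmorphM. Qed.
Lemma rcD x y : ((x + y)%:C)%C = (x%:C)%C + (y%:C)%C :> C.
Proof. exact: rmorphD. Qed.
Lemma rcB x y : ((x - y)%:C)%C = (x%:C)%C - (y%:C)%C :> C.
Proof. exact: rmorphB. Qed.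
Lemma rcN x : ((- x)%:C)%C = - (x%:C)%C :> C.
Proof. exact: rmorphN. Qed.
Lemma rcV x : ((x^-1)%:C)%C = ((x%:C)%C)^-1 :> C.
Proof. exact: fmorphV. Qed.
Lemma rc_eq0 x : ((x%:C)%C == 0 :> C) = (x == 0).
Proof. exact: fmorph_eq0. Qed.

Lemma cmodM z w : cmod (z * w) = cmod z * cmod w.
Proof. by apply: rc_inj; rewrite rcM -!norm_cmod normrM. Qed.

Lemma cmodD z w : cmod (z + w) <= cmod z + cmod w.
Proof.
have := ler_normD z w; rewrite !norm_cmod -rcD.
by rewrite lecE /= => /andP[].
Qed.

Lemma cmodN z : cmod (- z) = cmod z.
Proof. by apply: rc_inj; rewrite -!norm_cmod normrN. Qed.

Lemma cmodBC z w : cmod (z - w) = cmod (w - z).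
Proof. by rewrite -cmodN opprB. Qed.

Lemma cmodB z w : cmod (z - w) <= cmod z + cmod w.
Proof. by rewrite -(cmodN w) cmodD. Qed.

Lemma cmodV z : cmod (z^-1) = (cmod z)^-1.
Proof. by apply: rc_inj; rewrite rcV -!norm_cmod normfV. Qed.

Lemma cmod0 : cmod (0 : C) = 0.
Proof. by apply: rc_inj; rewrite -norm_cmod normr0. Qed.

Lemma cmod1 : cmod (1 : C) = 1.
Proof. by apply: rc_inj; rewrite -norm_cmod normr1. Qed.

Lemma cmodX z n : cmod (z ^+ n) = cmod z ^+ n.
Proof. by elim: n => [|n ih]; rewrite ?expr0 ?cmod1// !exprS cmodM ih. Qed.

Lemma cmod_eq0 z : (cmod z == 0) = (z == 0).
Proof. by rewrite -rc_eq0 -norm_cmod normr_eq0. Qed.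

Lemma cmod_gt0 z : (0 < cmod z) = (z != 0).
Proof. by rewrite lt_neqAle cmod_ge0 andbT eq_sym cmod_eq0. Qed.

Lemma cmod_rc x : cmod ((x%:C)%C : C) = `|x|.
Proof. by rewrite cmodE /= expr0n addr0 sqrtr_sqr. Qed.

Lemma cmod_conj z : cmod (z^*)%C = cmod z.
Proof. by apply: rc_inj; rewrite -!norm_cmod normcJ. Qed.

Lemma ler_cmodB z w : cmod z - cmod w <= cmod (z - w).
Proof. by rewrite lerBlDr; apply: le_trans (cmodD _ _); rewrite subrK. Qed.

Lemma Re_le_cmod z : `|complex.Re z| <= cmod z.
Proof.
rewrite -(ler_sqr (_ : _ \is Num.nneg)) ?nnegrE ?cmod_ge0//.
by rewrite cmod_sqr real_normK ?num_real// lerDl sqr_ge0.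
Qed.

Lemma Im_le_cmod z : `|complex.Im z| <= cmod z.
Proof.
rewrite -(ler_sqr (_ : _ \is Num.nneg)) ?nnegrE ?cmod_ge0//.
by rewrite cmod_sqr real_normK ?num_real// lerDr sqr_ge0.
Qed.

Lemma cmod_leReIm z : cmod z <= `|complex.Re z| + `|complex.Im z|.
Proof.
rewrite -(ler_sqr (_ : _ \is Num.nneg)) ?nnegrE ?cmod_ge0 ?addr_ge0//.
rewrite cmod_sqr sqrrD !real_normK ?num_real// lerD2r lerDl.
by rewrite mulrn_wge0// mulr_ge0.
Qed.

Lemma ReD z w : complex.Re (z + w) = complex.Re z + complex.Re w.
Proof. by case: z; case: w. Qed.
Lemma ImD z w : complex.Im (z + w) = complex.Im z + complex.Im w.
Proof. by case: z; case: w. Qed.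
Lemma ReB z w : complex.Re (z - w) = complex.Re z - complex.Re w.
Proof. by case: z; case: w. Qed.
Lemma ImB z w : complex.Im (z - w) = complex.Im z - complex.Im w.
Proof. by case: z; case: w. Qed.
Lemma ReM z w : complex.Re (z * w) =
  complex.Re z * complex.Re w - complex.Im z * complex.Im w.
Proof. by case: z; case: w. Qed.
Lemma ImM z w : complex.Im (z * w) =
  complex.Re z * complex.Im w + complex.Im z * complex.Re w.
Proof. by case: z => a b; case: w. Qed.

Lemma ReIm_inj z w : complex.Re z = complex.Re w ->
  complex.Im z = complex.Im w -> z = w.
Proof. by case: z => a b; case: w => c d /= -> ->. Qed.

(** Real-valued form of [is_derive z 1 F l]: a bound by [e * cmod h] instead of a limit of quotients
    includes h = 0 and leaves only real inequalities to check. *)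
Definition has_deriv (F : C -> C) z l := forall e, 0 < e ->
  exists2 d, 0 < d & forall h, cmod h < d ->
    cmod (F (z + h) - F z - l * h) <= e * cmod h.

Lemma gtc0_rc (e : C) : 0 < e -> exists2 x : R, 0 < x & e = (x%:C)%C.
Proof.
move=> e0; exists (cmod e); first by rewrite cmod_gt0 gt_eqF.
by rewrite -norm_cmod gtr0_norm.
Qed.

Lemma has_derivP (F : C -> C) z l : has_deriv F z l <-> is_derive z 1 F l.
Proof.
have key : has_deriv F z l <->
    h^-1 *: (F (h *: 1 + z) - F z) @[h --> (0 : C)^'] --> l.
  split => [H|].
  - apply/cvgrPdist_le => /= _ /gtc0_rc[e e0 ->].
    have [d d0 dP] := H _ e0.
    exists (d%:C)%C => /=; first by rewrite ltcR.
    move=> h /=; rewrite sub0r normrN norm_cmod ltcR => hd h0.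
    rewrite norm_cmod lecR.
    rewrite -(ler_pM2r (_ : 0 < cmod h)) ?cmod_gt0//.
    apply: le_trans (dP _ hd); rewrite -cmodM cmodBC le_eqVlt; apply/orP; left.
    apply/eqP; congr cmod; rewrite /GRing.scale/= mulr1 (addrC z) mulrBl.
    by rewrite mulrAC mulVf// mul1r.
  - move/cvgrPdist_le => H e e0.
    have /H : 0 < (e%:C)%C :> C by rewrite ltcR.
    move=> [_ /= /gtc0_rc[d d0 ->] dP]; exists d => // h hd.
    have [->|h0] := eqVneq h 0.
      by rewrite addr0 subrr mulr0 subr0 cmod0 mulr0.
    have := dP h; rewrite /= sub0r normrN norm_cmod ltcR => /(_ hd h0).
    rewrite norm_cmod lecR -(ler_pM2r (_ : 0 < cmod h)) ?cmod_gt0//.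
    apply: le_trans; rewrite -cmodM cmodBC le_eqVlt; apply/orP; left.
    apply/eqP; congr cmod; rewrite /GRing.scale/= mulr1 (addrC z) mulrBl.
    by rewrite mulrAC mulVf// mul1r.
split=> [/key H|[H1 H2]].
  apply: DeriveDef; first by apply/cvg_ex; exists l.
  exact/cvg_lim.
by apply/key; rewrite -H2; exact: H1.
Qed.

Lemma derivable_has_deriv (F : C -> C) z :
  derivable F z 1 -> has_deriv F z (derive1 F z).
Proof. by move=> H; apply/has_derivP; rewrite derive1E; exact/derivableP. Qed.

Lemma has_deriv_derivable (F : C -> C) z l :
  has_deriv F z l -> derivable F z 1.
Proof. by move/has_derivP => []. Qed.

Lemma has_deriv_derive1 (F : C -> C) z l : has_deriv F z l -> derive1 F z = l.
Proof. by move/has_derivP => [_]; rewrite derive1E. Qed.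

Lemma has_deriv_eq (F G : C -> C) z l d : 0 < d ->
  (forall w, cmod (w - z) < d -> F w = G w) -> has_deriv F z l -> has_deriv G z l.
Proof.
move=> d0 FG H e e0; have [d' d'0 H'] := H e e0.
exists (Num.min d d'); first by rewrite lt_min d0.
move=> h; rewrite lt_min => /andP[hd hd'].
rewrite -!FG ?subrr ?cmod0//; last by rewrite addrC addKr.
exact: H'.
Qed.

Lemma has_derivD (F G : C -> C) z l m : has_deriv F z l -> has_deriv G z m ->
  has_deriv (fun w => F w + G w) z (l + m).
Proof. by move=> /has_derivP H1 /has_derivP H2; exact: (proj2 (has_derivP _ _ _) (is_deriveD H1 H2)). Qed.

Lemma has_derivB (F G : C -> C) z l m : has_deriv F z l -> has_deriv G z m ->
  has_deriv (fun w => F w - G w) z (l - m).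
Proof. by move=> /has_derivP H1 /has_derivP H2; exact: (proj2 (has_derivP _ _ _) (is_deriveB H1 H2)). Qed.

Lemma has_derivM (F G : C -> C) z l m : has_deriv F z l -> has_deriv G z m ->
  has_deriv (fun w => F w * G w) z (l * G z + F z * m).
Proof.
move=> /has_derivP H1 /has_derivP H2.
have H := is_deriveM H1 H2.
suff <- : F z *: m + G z *: l = l * G z + F z * m by exact: (proj2 (has_derivP (F * G) _ _) H).
by rewrite /GRing.scale/= addrC [G z * _]mulrC.
Qed.

Lemma has_deriv_cst (c : C) z : has_deriv (fun=> c) z 0.
Proof. by apply/has_derivP; exact: is_derive_cst. Qed.

Lemma has_deriv_id z : has_deriv id z 1.
Proof. by apply/has_derivP; exact: is_derive_id. Qed.

Definition contc (F : C -> C) z := forall e, 0 < e ->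
  exists2 d, 0 < d & forall w, cmod (w - z) < d -> cmod (F w - F z) < e.

Lemma has_deriv_contc F z l : has_deriv F z l -> contc F z.
Proof.
move=> H e e0; have [d d0 dP] := H 1 ltr01.
exists (Num.min d (e / (2 + cmod l))).
  by rewrite lt_min d0 divr_gt0// ltr_wpDr ?cmod_ge0.
move=> w; rewrite lt_min => /andP[wd we].
have := dP _ wd; rewrite (addrC z) subrK mul1r => H1.
have -> : F w - F z = (F w - F z - l * (w - z)) + l * (w - z) by rewrite subrK.
apply: le_lt_trans (cmodD _ _) _; rewrite cmodM.
have p0 : 0 < 2 + cmod l by rewrite ltr_wpDr ?cmod_ge0.
move: we; rewrite ltr_pdivlMr// => we.
have := cmod_ge0 (w - z) => ?.
have : cmod (w - z) * (2 + cmod l) < e by [].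
by nra.
Qed.

Lemma has_derivV (F : C -> C) z l : F z != 0 -> has_deriv F z l ->
  has_deriv (fun w => (F w)^-1) z (- l / F z ^+ 2).
Proof.
move=> Fz /has_derivP H.
have dF : derivable F z 1 by case: H.
have <- : 'D_1 (fun w => (F w)^-1) z = - l / F z ^+ 2.
  rewrite deriveV//; case: H => _ ->.
  by rewrite /GRing.scale/= mulNr mulNr mulrC.
rewrite -derive1E; apply: derivable_has_deriv; exact: derivableV.
Qed.

Lemma has_deriv_chain_scale (F : C -> C) (c z l : C) : has_deriv F (c * z) l ->
  has_deriv (fun w => F (c * w)) z (c * l).
Proof.
move=> H e e0.
have p0 : 0 < cmod c + 1 by rewrite ltr_wpDl ?cmod_ge0.
have [d d0 dP] := H (e / (cmod c + 1)) (divr_gt0 e0 p0).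
exists (d / (cmod c + 1)); first exact: divr_gt0.
move=> h hd; have hd' : cmod (c * h) < d.
  move: hd; rewrite cmodM ltr_pdivlMr// => hd.
  have := cmod_ge0 h; have := cmod_ge0 c; nra.
have := dP _ hd'; rewrite -mulrDr => H1.
have -> : c * l * h = l * (c * h) by ring.
apply: le_trans H1 _; rewrite cmodM -mulrA; apply: ler_wpM2l; first exact: ltW.
by rewrite mulrA ler_piMl ?cmod_ge0// mulrC ler_pdivrMr// mul1r lerDl.
Qed.

End ComplexBasics.

(** * Integrals of complex-valued paths over [0, 1] *)

Section PathIntegrals.
Variable R : realType.
Local Notation C := (Cplx R).
Local Notation leb := (@lebesgue_measure R).
Implicit Types (phi psi : R -> C).

(** Continuity is two-sided at the endpoints as well, since s ranges over the whole line; this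
    yields [{for t, continuous}] at 0 and 1 without one-sided limits. *)
Definition pathc phi := forall t, 0 <= t <= 1 -> forall e, 0 < e ->
  exists2 d, 0 < d & forall s, `|s - t| < d -> cmod (phi s - phi t) < e.

Lemma real_contP (f : R -> R) (t : R) : {for t, continuous f} <->
  forall e, 0 < e -> exists2 d, 0 < d & forall s, `|s - t| < d -> `|f s - f t| < e.
Proof.
split.
- move=> /cvgrPdist_lt H e e0; have [d /= d0 dP] := H _ e0.
  by exists d => // s sd; rewrite distrC; apply: dP => /=; rewrite distrC.
- move=> H; apply/cvgrPdist_lt => e e0; have [d d0 dP] := H _ e0.
  by exists d => //= s sd; rewrite distrC; apply: dP; rewrite distrC.
Qed.

Lemma within01 (f : R -> R) (a b : R) :
  (forall t, a <= t <= b -> {for t, continuous f}) -> {within `[a, b], continuous f}.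
Proof.
move=> H; apply: continuous_in_subspaceT => t; rewrite inE/= in_itv/= => tab.
exact: H.
Qed.

Lemma pathc_Re phi t : pathc phi -> 0 <= t <= 1 ->
  {for t, continuous (fun s => complex.Re (phi s))}.
Proof.
move=> H t01; apply/real_contP => e e0; have [d d0 dP] := H _ t01 _ e0.
exists d => // s sd; apply: le_lt_trans (dP _ sd).
by rewrite -ReB Re_le_cmod.
Qed.

Lemma pathc_Im phi t : pathc phi -> 0 <= t <= 1 ->
  {for t, continuous (fun s => complex.Im (phi s))}.
Proof.
move=> H t01; apply/real_contP => e e0; have [d d0 dP] := H _ t01 _ e0.
exists d => // s sd; apply: le_lt_trans (dP _ sd).
by rewrite -ImB Im_le_cmod.
Qed.

Lemma pathc_cmod phi t : pathc phi -> 0 <= t <= 1 ->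
  {for t, continuous (fun s => cmod (phi s))}.
Proof.
move=> H t01; apply/real_contP => e e0; have [d d0 dP] := H _ t01 _ e0.
exists d => // s sd; apply: le_lt_trans (dP _ sd).
by rewrite ler_norml ler_cmodB andbT lerNl opprB cmodBC ler_cmodB.
Qed.

Lemma integrable_cont (f : R -> R) (a b : R) :
  (forall t, a <= t <= b -> {for t, continuous f}) ->
  leb.-integrable `[a, b] (EFin \o f).
Proof.
by move=> H; apply: continuous_compact_integrable; [exact: segment_compact|exact: within01].
Qed.

Lemma pathc_intRe phi : pathc phi ->
  leb.-integrable `[0, 1] (EFin \o (fun s => complex.Re (phi s))).
Proof. by move=> H; apply: integrable_cont => t; exact: pathc_Re. Qed.

Lemma pathc_intIm phi : pathc phi ->
  leb.-integrable `[0, 1] (EFin \o (fun s => complex.Im (phi s))).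
Proof. by move=> H; apply: integrable_cont => t; exact: pathc_Im. Qed.

Definition cint phi : C := Complex
  (\int[leb]_(t in `[0, 1]) complex.Re (phi t))
  (\int[leb]_(t in `[0, 1]) complex.Im (phi t)).

Lemma eq_cint phi psi : (forall t, 0 <= t <= 1 -> phi t = psi t) ->
  cint phi = cint psi.
Proof.
by move=> H; congr Complex; apply: eq_Rintegral => t;
  rewrite inE/= in_itv/= => /H ->.
Qed.

Lemma pathcD phi psi : pathc phi -> pathc psi -> pathc (fun t => phi t + psi t).
Proof.
move=> H1 H2 t t01 e e0.
have [d1 d10 d1P] := H1 t t01 _ (divr_gt0 e0 (@ltr0n R 2)).
have [d2 d20 d2P] := H2 t t01 _ (divr_gt0 e0 (@ltr0n R 2)).
exists (Num.min d1 d2); first by rewrite lt_min d10.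
move=> s; rewrite lt_min => /andP[/d1P h1 /d2P h2].
rewrite opprD addrACA (splitr e); apply: le_lt_trans (cmodD _ _) _.
exact: ltrD.
Qed.

Lemma pathcZ (c : C) phi : pathc phi -> pathc (fun t => c * phi t).
Proof.
move=> H t t01 e e0; have p0 : 0 < cmod c + 1 by rewrite ltr_wpDl ?cmod_ge0.
have [d d0 dP] := H t t01 _ (divr_gt0 e0 p0).
exists d => // s /dP; rewrite ltr_pdivlMr// -mulrBr cmodM => h.
have := cmod_ge0 (phi s - phi t); nra.
Qed.

Lemma cintD phi psi : pathc phi -> pathc psi ->
  cint (fun t => phi t + psi t) = cint phi + cint psi.
Proof.
move=> H1 H2; apply: ReIm_inj; rewrite /cint ?ReD ?ImD/=.
- under eq_Rintegral do rewrite ReD.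
  by rewrite RintegralD//; exact: pathc_intRe.
- under eq_Rintegral do rewrite ImD.
  by rewrite RintegralD//; exact: pathc_intIm.
Qed.

Lemma cintZ (c : C) phi : pathc phi -> cint (fun t => c * phi t) = c * cint phi.
Proof.
move=> H; have iR := pathc_intRe H; have iI := pathc_intIm H.
apply: ReIm_inj; rewrite /cint ?ReM ?ImM/=.
- under eq_Rintegral do rewrite ReM.
  rewrite RintegralB//; first by rewrite !RintegralZl.
  + exact: (integrableZl _ _ iR).
  + exact: (integrableZl _ _ iI).
- under eq_Rintegral do rewrite ImM.
  rewrite RintegralD//; first by rewrite !RintegralZl.
  + exact: (integrableZl _ _ iI).
  + exact: (integrableZl _ _ iR).
Qed.

Lemma cintB phi psi : pathc phi -> pathc psi ->
  cint (fun t => phi t - psi t) = cint phi - cint psi.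
Proof.
move=> H1 H2; rewrite -[- cint psi]mulN1r -cintZ// -cintD//; last exact: pathcZ.
by apply: eq_cint => t _; rewrite mulN1r.
Qed.

Lemma leb01 : fine (leb `[0, 1]%classic) = 1.
Proof. by rewrite lebesgue_measure_itv/= lte_fin ltr01 oppr0 adde0. Qed.

Lemma cint_cst (c : C) : cint (fun=> c) = c.
Proof.
by case: c => a b; rewrite /cint !Rintegral_cst//= leb01 !mulr1.
Qed.

(** The factor 2 comes from bounding real and imaginary parts separately; a rotation of the integral
    would remove it, but no later constant has to be sharp. *)
Lemma cint_le phi : pathc phi ->
  cmod (cint phi) <= 2 * \int[leb]_(t in `[0, 1]) cmod (phi t).
Proof.
move=> H; apply: le_trans (cmod_leReIm _) _; rewrite mulrDl mul1r /=.
have iN : leb.-integrable `[0, 1] (EFin \o (fun t => cmod (phi t))).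
  by apply: integrable_cont => t; exact: pathc_cmod.
apply: lerD; (apply: le_trans; first apply: le_normr_Rintegral => //).
- exact: pathc_intRe.
- apply: le_Rintegral => //; last by move=> t _; exact: Re_le_cmod.
  exact: (integrable_norm (pathc_intRe H)).
- exact: pathc_intIm.
- apply: le_Rintegral => //; last by move=> t _; exact: Im_le_cmod.
  exact: (integrable_norm (pathc_intIm H)).
Qed.

Lemma cint_bound phi (M : R) : pathc phi ->
  (forall t, 0 <= t <= 1 -> cmod (phi t) <= M) -> cmod (cint phi) <= 2 * M.
Proof.
move=> H HM; apply: le_trans (cint_le H) _; rewrite ler_pM2l//.
have <- : \int[leb]_(t in `[0, 1]) M = M by rewrite Rintegral_cst//= leb01 mulr1.
apply: le_Rintegral => //.
- by apply: integrable_cont => t; exact: pathc_cmod.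
- by apply: integrable_cont => t _; exact: cst_continuous.
Qed.

Lemma Rint_affine (G : R -> R) (k c a b : R) : 0 < k -> a <= b ->
  (forall t, k * a + c <= t <= k * b + c -> {for t, continuous G}) ->
  \int[leb]_(x in `[k * a + c, k * b + c]) G x =
  k * \int[leb]_(x in `[a, b]) G (k * x + c).
Proof.
move=> k0 ab cG.
pose F : R -> R := fun x => k * x + c.
have dF (x : R) : is_derive x (1 : R) F k.
  rewrite /F; have := is_deriveD (is_deriveZ k (is_derive_id x 1)) (is_derive_cst c x 1).
  by rewrite /GRing.scale/= mulr1 addr0.
have F' : derive1 F = cst k by apply/funext => x; rewrite derive1E; apply: derive_val.
have cF x : {for x, continuous F}.
  by apply: differentiable_continuous; apply/derivable1_diffP; case: (dF x).
have h := @integration_by_substitution_increasing _ F G _ _ ab.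
rewrite /Rintegral -/(F a) -/(F b) h.
- have -> : (G \o F) * derive1 F = (fun x => k * G (k * x + c)).
    by apply/funext => x; rewrite F' mulrC.
  rewrite -[LHS]/(\int[leb]_(x in `[a, b]) (k * G (k * x + c))) RintegralZl//.
  apply: integrable_cont => t /andP[ta tb].
  apply: (@continuous_comp _ _ _ F G); first exact: cF.
  by apply: cG; rewrite /F !lerD2r !ler_pM2l// ta.
- by move=> x y _ _ xy; rewrite /F ltrD2r ltr_pM2l.
- by move=> x _; rewrite F'; exact: cst_continuous.
- by rewrite F'; exact: is_cvg_cst.
- by rewrite F'; exact: is_cvg_cst.
- split; first by move=> x _; case: (dF x).
  + exact: (cvg_at_right_filter (cF a)).
  + exact: (cvg_at_left_filter (cF b)).
- exact: within01.
Qed.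

Lemma Rint_split (G : R -> R) (a b c : R) : a <= c <= b ->
  (forall t, a <= t <= b -> {for t, continuous G}) ->
  \int[leb]_(x in `[a, b]) G x =
  \int[leb]_(x in `[a, c]) G x + \int[leb]_(x in `[c, b]) G x.
Proof.
move=> /andP[ac cb] cG.
have ic : leb.-integrable `[c, b] (EFin \o G).
  by apply: integrable_cont => t /andP[ct tb]; apply: cG; rewrite tb (le_trans ac).
have := @Rintegral_itvB _ G (BLeft a) (BRight b) c (integrable_cont cG).
rewrite !bnd_simp => /(_ ac cb); rewrite Rintegral_itv_obnd_cbnd.
  by move=> <-; rewrite addrC subrK.
apply: (integrableS _ _ _ ic) => //; apply: subset_itvr; by rewrite bnd_simp.
Qed.

Lemma Rint_half (G : R -> R) : (forall t, 0 <= t <= 1 -> {for t, continuous G}) ->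
  \int[leb]_(x in `[0, 1]) G x =
  2^-1 * (\int[leb]_(x in `[0, 1]) G (2^-1 * x) +
          \int[leb]_(x in `[0, 1]) G (2^-1 * x + 2^-1)).
Proof.
move=> cG.
have h0 : 0 < 2^-1 :> R by rewrite invr_gt0.
have h1 : 2^-1 <= 1 :> R by rewrite invf_le1// ler1n.
have A := @Rint_affine G 2^-1 0 0 1 h0 ler01.
have B := @Rint_affine G 2^-1 2^-1 0 1 h0 ler01.
have e1 : 2^-1 + 2^-1 = 1 :> R by rewrite [RHS]splitr !div1r.
rewrite mulr0 mulr1 add0r e1 in B; rewrite mulr0 mulr1 !addr0 in A.
rewrite (@Rint_split _ _ _ 2^-1)//; last by rewrite ltW.
rewrite A ?B ?mulrDr//; first by congr (_ * _ + _); apply: eq_Rintegral => x _; rewrite addr0.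
- by move=> t /andP[t0 t1]; apply: cG; rewrite t1 andbT (le_trans _ t0)// ltW.
- by move=> t /andP[t0 t1]; apply: cG; rewrite t0 (le_trans t1).
Qed.

Lemma Rint_rev (G : R -> R) : (forall t, 0 <= t <= 1 -> {for t, continuous G}) ->
  \int[leb]_(x in `[0, 1]) G (1 - x) = \int[leb]_(x in `[0, 1]) G x.
Proof.
move=> cG; rewrite (@Rintegration_by_substitution_onem _ G 1) ?ler01 ?lexx//.
  by rewrite /unstable.onem subrr.
exact: within01.
Qed.

Lemma cint_half phi : pathc phi ->
  cint phi = (2^-1) * (cint (fun t => phi (2^-1 * t)) + cint (fun t => phi (2^-1 * t + 2^-1))).
Proof.
move=> H; have e2 : (2^-1 : C) = ((2^-1)%:C)%C by rewrite rcV (rmorph_nat (real_complex R)).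
apply: ReIm_inj; rewrite e2 ?ReM ?ImM/= ?mul0r ?subr0 ?addr0.
- by rewrite Rint_half// => t; exact: pathc_Re.
- by rewrite Rint_half// => t; exact: pathc_Im.
Qed.

Lemma cint_rev phi : pathc phi -> cint (fun t => phi (1 - t)) = cint phi.
Proof.
move=> H; apply: ReIm_inj => /=.
- by rewrite (@Rint_rev (fun t => complex.Re (phi t)))// => t; exact: pathc_Re.
- by rewrite (@Rint_rev (fun t => complex.Im (phi t)))// => t; exact: pathc_Im.
Qed.

End PathIntegrals.

(** * Goursat's lemma and Cauchy's formula on squares *)

Section Goursat.
Variable R : realType.
Local Notation C := (Cplx R).
Local Notation leb := (@lebesgue_measure R).
Implicit Types (F G : C -> C) (a b c z w : C) (K : set C).

Definition seg a b (t : R) : C := a + (t%:C)%C * (b - a).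

(* The line integral of F along the segment [a, b]. *)
Definition J F a b : C := (b - a) * cint (fun t => F (seg a b t)).

Definition segc F a b := forall t, 0 <= t <= 1 -> contc F (seg a b t).

Lemma segBs a b s t : seg a b s - seg a b t = ((s - t)%:C)%C * (b - a).
Proof. by rewrite /seg rcB; ring. Qed.

Lemma seg_pathc F a b : segc F a b -> pathc (fun t => F (seg a b t)).
Proof.
move=> H t t01 e e0; have [d d0 dP] := H t t01 e e0.
have p0 : 0 < cmod (b - a) + 1 by rewrite ltr_wpDl ?cmod_ge0.
exists (d / (cmod (b - a) + 1)); first exact: divr_gt0.
move=> s; rewrite ltr_pdivlMr// => h; apply: dP.
rewrite segBs cmodM cmod_rc.
have := cmod_ge0 (b - a); have := normr_ge0 (s - t); nra.
Qed.

Lemma seg_rev a b t : seg b a t = seg a b (1 - t).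
Proof. by rewrite /seg rcB (rmorph1 (real_complex R)); ring. Qed.

Lemma J_rev F a b : segc F a b -> J F b a = - J F a b.
Proof.
move=> H; rewrite /J -(cint_rev (seg_pathc H)) -mulNr opprB; congr (_ * _).
by apply: eq_cint => t _; rewrite seg_rev.
Qed.

Lemma rc2V : ((2^-1)%:C)%C = 2^-1 :> C.
Proof. by rewrite rcV (rmorph_nat (real_complex R)). Qed.

Definition mid a b : C := (2^-1) * (a + b).

Lemma seg_mid a b : mid a b = seg a b 2^-1.
Proof. by rewrite /mid /seg rc2V; field. Qed.

Lemma J_mid F a b : segc F a b -> J F a b = J F a (mid a b) + J F (mid a b) b.
Proof.
move=> H; rewrite /J (cint_half (seg_pathc H)).
have -> : mid a b - a = 2^-1 * (b - a) by rewrite /mid; field.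
have -> : b - mid a b = 2^-1 * (b - a) by rewrite /mid; field.
rewrite mulrDr mulrDr; congr (_ + _).
- rewrite mulrA [_ * 2^-1]mulrC; congr (_ * _); apply: eq_cint => t _.
  by congr F; rewrite /seg /mid rcM rc2V; field.
- rewrite mulrA [_ * 2^-1]mulrC; congr (_ * _); apply: eq_cint => t _.
  by congr F; rewrite /seg /mid rcD rcM rc2V; field.
Qed.

Lemma J_bound F a b (M : R) : segc F a b ->
  (forall t, 0 <= t <= 1 -> cmod (F (seg a b t)) <= M) ->
  cmod (J F a b) <= 2 * M * cmod (b - a).
Proof.
move=> H HM; rewrite /J cmodM mulrC ler_wpM2r ?cmod_ge0//.
exact: cint_bound (seg_pathc H) _.
Qed.

Lemma JB F G a b : segc F a b -> segc G a b ->
  J (fun w => F w - G w) a b = J F a b - J G a b.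
Proof. by move=> H1 H2; rewrite /J (cintB (seg_pathc H1) (seg_pathc H2)) mulrBr. Qed.

Lemma has_deriv_affine (al be : C) z : has_deriv (fun w => al + be * w) z be.
Proof.
move=> e e0; exists 1 => // h _.
have -> : al + be * (z + h) - (al + be * z) - be * h = 0 by ring.
by rewrite cmod0 mulr_ge0 ?cmod_ge0// ltW.
Qed.

Lemma pathc_rc : pathc (fun t : R => (t%:C)%C : C).
Proof.
move=> t _ e e0; exists e => // s; by rewrite -rcB cmod_rc.
Qed.

(** By the reversal t -> 1 - t the integral I satisfies I = 1 - I. *)
Lemma cint_rc : cint (fun t : R => (t%:C)%C : C) = 2^-1.
Proof.
have h := cint_rev pathc_rc.
have c1 : pathc (fun=> 1 : C).
  by move=> t _ e e0; exists 1 => // s _; rewrite subrr cmod0.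
have : cint (fun t : R => ((1 - t)%:C)%C : C) = 1 - cint (fun t : R => (t%:C)%C : C).
  rewrite -[X in X - _](cint_cst 1) -cintB//; last exact: pathc_rc.
  by apply: eq_cint => t _; rewrite rcB (rmorph1 (real_complex R)).
rewrite h => e; have e2 : 2 * cint (fun t : R => (t%:C)%C : C) = 1.
  by rewrite mulr_natl mulr2n {1}e subrK.
have n2 : (2 : C) != 0 by rewrite pnatr_eq0.
by apply: (mulfI n2); rewrite e2 divff.
Qed.

(** Affine functions are integrated exactly by the midpoint rule, so their integral over a triangle
    vanishes by algebra, without primitives. *)
Lemma J_affine (al be : C) a b :
  J (fun w => al + be * w) a b = (b - a) * (al + be * mid a b).
Proof.
rewrite /J; congr (_ * _).
have -> : cint (fun t => al + be * seg a b t) =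
          cint (fun t => (al + be * a) + (be * (b - a)) * (t%:C)%C).
  by apply: eq_cint => t _; rewrite /seg; ring.
rewrite cintD; last 2 first.
- by move=> t _ e e0; exists 1 => // s _; rewrite subrr cmod0.
- exact/pathcZ/pathc_rc.
by rewrite cint_cst (cintZ _ pathc_rc) cint_rc /mid; field.
Qed.

Definition tri F a b c : C := J F a b + J F b c + J F c a.

Lemma tri_affine (al be : C) a b c : tri (fun w => al + be * w) a b c = 0.
Proof. by rewrite /tri !J_affine /mid; field. Qed.

Definition convexC K := forall a b t, K a -> K b -> 0 <= t <= 1 -> K (seg a b t).

Definition closedC K := forall x, ~ K x ->
  exists2 d, 0 < d & forall y, cmod (y - x) < d -> ~ K y.

Lemma convex_mid K a b : convexC K -> K a -> K b -> K (mid a b).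
Proof.
move=> Kc Ka Kb; rewrite seg_mid; apply: Kc => //.
by rewrite invr_ge0 ler0n invf_le1// ler1n.
Qed.

(** With r n = 2 k 2^(-n) the intervals [u n - r n, u n + r n] are nested, and the supremum of their
    left ends lies in all of them. *)
Lemma nested_limit (u : nat -> R) (k : R) : 0 <= k ->
  (forall n, `|u n.+1 - u n| <= k * 2^-1 ^+ n) ->
  exists x, forall n, `|u n - x| <= 2 * k * 2^-1 ^+ n.
Proof.
move=> k0 H; pose r n := 2 * k * 2^-1 ^+ n.
have rS n : r n.+1 = k * 2^-1 ^+ n by rewrite /r exprS; field.
have rS2 n : r n = 2 * (k * 2^-1 ^+ n) by rewrite /r; ring.
have lo n : u n - r n <= u n.+1 - r n.+1.
  by have := H n; rewrite ler_norml rS rS2 => /andP[]; lra.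
have hi n : u n.+1 + r n.+1 <= u n + r n.
  by have := H n; rewrite ler_norml rS rS2 => /andP[]; lra.
have loD n m : u n - r n <= u (n + m)%N - r (n + m)%N.
  elim: m => [|m ih]; first by rewrite addn0.
  by rewrite addnS; apply: le_trans ih _.
have hiD n m : u (n + m)%N + r (n + m)%N <= u n + r n.
  elim: m => [|m ih]; first by rewrite addn0.
  by rewrite addnS; apply: le_trans (hi _) ih.
have r0 n : 0 <= r n by rewrite /r !mulr_ge0// exprn_ge0.
have lohi n m : u n - r n <= u m + r m.
  apply: le_trans (loD n m) _; apply: le_trans (hiD m n); rewrite addnC.
  by have := r0 (m + n)%N; lra.
pose A := [set u n - r n | n in [set: nat]].
have ub m : ubound A (u m + r m) by move=> _ [n _ <-].
have ne : A !=set0 by exists (u 0%N - r 0%N), 0%N.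
exists (sup A) => n; rewrite ler_distl; apply/andP; split.
- rewrite lerBlDr; apply: ge_sup => //.
- by rewrite -lerBlDr; apply: ub_le_sup; [exists (u 0%N + r 0%N)|exists n].
Qed.

Section Tri.
Variables (F : C -> C) (K : set C).
Hypotheses (Kc : convexC K) (Kcl : closedC K).
Hypothesis dF : forall z, K z -> exists l, has_deriv F z l.

Lemma Ksegc a b : K a -> K b -> segc F a b.
Proof.
move=> Ka Kb t t01; have [l hl] := dF (Kc Ka Kb t01).
exact: has_deriv_contc hl.
Qed.

Lemma tri_subdiv a b c : K a -> K b -> K c ->
  tri F a b c = tri F a (mid a b) (mid c a) + tri F (mid a b) b (mid b c)
    + tri F (mid b c) c (mid c a) + tri F (mid a b) (mid b c) (mid c a).
Proof.
move=> Ka Kb Kk; rewrite /tri (J_mid (Ksegc Ka Kb)) (J_mid (Ksegc Kb Kk)).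
rewrite (J_mid (Ksegc Kk Ka)).
have Mab := convex_mid Kc Ka Kb.
have Mbc := convex_mid Kc Kb Kk.
have Mca := convex_mid Kc Kk Ka.
rewrite (J_rev (Ksegc Mab Mbc)) (J_rev (Ksegc Mbc Mca)) (J_rev (Ksegc Mca Mab)).
move: (J F) => j; ring.
Qed.

Definition small (s : R) a b c :=
  [/\ K a, K b & K c] /\ [/\ cmod (b - a) <= s, cmod (c - b) <= s & cmod (a - c) <= s].

Lemma small_sub s a b c : small s a b c ->
  [/\ small (s / 2) a (mid a b) (mid c a), small (s / 2) (mid a b) b (mid b c),
    small (s / 2) (mid b c) c (mid c a) & small (s / 2) (mid a b) (mid b c) (mid c a)].
Proof.
move=> [[Ka Kb Kk] [ab bc ca]].
have Mab := convex_mid Kc Ka Kb.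
have Mbc := convex_mid Kc Kb Kk.
have Mca := convex_mid Kc Kk Ka.
have h (x y z : C) : x = 2^-1 * y \/ x = 2^-1 * (- y) -> cmod y <= s -> cmod x <= s / 2.
  have e2 : cmod (2^-1 : C) = 2^-1 by rewrite -rc2V cmod_rc ger0_norm// invr_ge0.
  by move=> [->|->] hy; rewrite cmodM ?cmodN e2; lra.
by split; (split; first by []); split; do ?[
  by apply: (h _ _ 0 _ ab); ((left + right); rewrite /mid; field)
 |by apply: (h _ _ 0 _ bc); ((left + right); rewrite /mid; field)
 |by apply: (h _ _ 0 _ ca); ((left + right); rewrite /mid; field)].
Qed.

(** Subtracting the tangent affine function does not change the integral over the triangle and
    leaves an integrand of order e s. The factor 8 matches the distance from a vertex to the limit
    point in the bisection. *)
Lemma tri_local x : K x -> forall e, 0 < e -> exists2 d, 0 < d & forall s a b c,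
  small s a b c -> 0 < s < d -> cmod (a - x) <= 8 * s ->
  cmod (tri F a b c) <= e * s ^+ 2.
Proof.
move=> Kx e e0; have [l hl] := dF Kx.
(* Vertices lie within 9 s of x and points of the edges within 10 s, so each edge costs 2 (e / 60)
   (10 s) s = (e / 3) s^2. *)
have e60 : 0 < e / 60 by rewrite divr_gt0.
have [d d0 dP] := hl (e / 60) e60.
exists (d / 10); first exact: divr_gt0.
move=> s a b c [[Ka Kb Kk] [ab bc ca]] /andP[s0 sd] ax.
pose A w : C := (F x - l * x) + l * w.
have cA u v : segc A u v.
  by move=> t _; apply: has_deriv_contc; exact: has_deriv_affine.
have -> : tri F a b c = tri (fun w => F w - A w) a b c.
  have -> : tri (fun w => F w - A w) a b c = tri F a b c - tri A a b c.
    by rewrite /tri !JB//; do ?[exact: Ksegc]; ring.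
  by rewrite tri_affine subr0.
have E u v : K u -> K v -> cmod (u - x) <= 9 * s -> cmod (v - x) <= 9 * s ->
   cmod (v - u) <= s -> cmod (J (fun w => F w - A w) u v) <= (e / 3) * s ^+ 2.
  move=> Ku Kv ux vx uv.
  have cFA : segc (fun w => F w - A w) u v.
    move=> t t01; have [m hm] := dF (Kc Ku Kv t01).
    exact: (has_deriv_contc (has_derivB hm (has_deriv_affine _ _ _))).
  have B t : 0 <= t <= 1 -> cmod (F (seg u v t) - A (seg u v t)) <= (e / 60) * (10 * s).
    move=> t01; have H : cmod (seg u v t - x) <= 10 * s.
      have -> : seg u v t - x = (u - x) + (t%:C)%C * (v - u) by rewrite /seg; ring.
      apply: le_trans (cmodD _ _) _; rewrite cmodM cmod_rc.
      by have := cmod_ge0 (v - u); move: t01 => /andP[t0 t1]; rewrite ger0_norm//; nra.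
    have := dP (seg u v t - x); rewrite (addrC x) subrK => /(_ _) P.
    apply: (@le_trans _ _ (e / 60 * cmod (seg u v t - x))).
      have -> : F (seg u v t) - A (seg u v t) = F (seg u v t) - F x - l * (seg u v t - x).
        by rewrite /A; ring.
      by apply: P; lra.
    by rewrite ler_pM2l// divr_gt0.
  apply: le_trans (J_bound cFA B) _.
  have -> : 2 * (e / 60 * (10 * s)) = e / 3 * s by field.
  by rewrite expr2 mulrA ler_wpM2l// mulr_ge0// ltW// divr_gt0.
have bx : cmod (b - x) <= 9 * s.
  have -> : b - x = (b - a) + (a - x) by ring.
  by apply: le_trans (cmodD _ _) _; lra.
have cx : cmod (c - x) <= 9 * s.
  have -> : c - x = (a - x) - (a - c) by ring.
  by apply: le_trans (cmodB _ _) _; lra.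
have ax9 : cmod (a - x) <= 9 * s by lra.
rewrite /tri; apply: le_trans (cmodD _ _) _.
have := cmodD (J (fun w => F w - A w) a b) (J (fun w => F w - A w) b c).
have := E _ _ Ka Kb ax9 bx ab; have := E _ _ Kb Kk bx cx bc; have := E _ _ Kk Ka cx ax9 ca.
lra.
Qed.

(** Goursat's bisection: if |tri| > e s^2, one of the four half-size triangles satisfies the same
    with s / 2. The chosen vertices converge to a point of K, where [tri_local] gives a
    contradiction. Besides differentiability on K, only convexity and closedness of K enter. *)
Lemma tri_eq0 a b c : K a -> K b -> K c -> tri F a b c = 0.
Proof.
move=> Ka Kb Kk.
pose s := 1 + cmod (b - a) + cmod (c - b) + cmod (a - c).
have s0 : 0 < s by rewrite /s !(ltr_wpDr (cmod_ge0 _)).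
have T0 : small s a b c.
  split=> //; rewrite /s; have := cmod_ge0 (b - a); have := cmod_ge0 (c - b).
  by have := cmod_ge0 (a - c); split; lra.
suff H : forall e, 0 < e -> cmod (tri F a b c) <= e * s ^+ 2.
  apply/eqP; rewrite -cmod_eq0 eq_le cmod_ge0 andbT; apply/ler_addgt0Pr => e e0.
  rewrite add0r; have s2 : 0 < s ^+ 2 by rewrite exprn_gt0.
  by apply: le_trans (H _ (divr_gt0 e0 s2)) _; rewrite divfK// gt_eqF.
move=> e e0; rewrite leNgt; apply/negP => bad0.
pose bad (p : R * (C * C * C)) := small p.1 p.2.1.1 p.2.1.2 p.2.2 /\
  e * p.1 ^+ 2 < cmod (tri F p.2.1.1 p.2.1.2 p.2.2).
(* The triple (0, 0, 0) is a dummy value for triangles that are not bad, so that [choice] gives a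
   total successor function. *)
have step p : exists q : C * C * C, bad p ->
    bad (p.1 / 2, q) /\ cmod (q.1.1 - p.2.1.1) <= p.1.
  case: p => r [[x y] z]; have [[/= S B]|nb] := pselect (bad (r, (x, y, z))); last first.
    by exists (0, 0, 0).
  have [S1 S2 S3 S4] := small_sub S.
  have [[Kx Ky Kz] [xy yz zx]] := S; have r0 : 0 <= r := le_trans (cmod_ge0 _) xy.
  have D := tri_subdiv Kx Ky Kz.
  have hm1 : cmod (mid x y - x) <= r.
    by case: S1 => _ [h _ _]; lra.
  have hm2 : cmod (mid y z - x) <= r.
    have -> : mid y z - x = (mid y z - mid x y) + (mid x y - x) by ring.
    apply: le_trans (cmodD _ _) _; case: S1 => _ [h _ _]; case: S4 => _ [h' _ _]; lra.
  have [b1|b1] := ltP (e * (r / 2) ^+ 2) (cmod (tri F x (mid x y) (mid z x))).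
    by exists (x, mid x y, mid z x) => _; split=> //=; rewrite subrr cmod0.
  have [b2|b2] := ltP (e * (r / 2) ^+ 2) (cmod (tri F (mid x y) y (mid y z))).
    by exists (mid x y, y, mid y z) => _; split.
  have [b3|b3] := ltP (e * (r / 2) ^+ 2) (cmod (tri F (mid y z) z (mid z x))).
    by exists (mid y z, z, mid z x) => _; split.
  have [b4|b4] := ltP (e * (r / 2) ^+ 2) (cmod (tri F (mid x y) (mid y z) (mid z x))).
    by exists (mid x y, mid y z, mid z x) => _; split.
  exfalso; move: B; rewrite D ltNge => /negP; apply.
  apply: le_trans (cmodD _ _) _.
  apply: le_trans (lerD (cmodD _ _) (lexx _)) _.
  apply: le_trans (lerD (lerD (cmodD _ _) (lexx _)) (lexx _)) _.
  by move: b1 b2 b3 b4; lra.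
have [f fP] := choice step.
pose T := fix T n := if n is n'.+1 then ((T n').1 / 2, f (T n')) else (s, (a, b, c)).
have badT n : bad (T n).
  by elim: n => [|n ih] //; case: (fP _ ih).
have sT n : (T n).1 = s * 2^-1 ^+ n.
  by elim: n => [|n ih] /=; rewrite ?expr0 ?mulr1// ih exprS; ring.
pose u n := (T n).2.1.1.
have uS n : cmod (u n.+1 - u n) <= s * 2^-1 ^+ n.
  by rewrite -sT; case: (fP _ (badT n)).
have [x1 x1P] : exists x, forall n, `|complex.Re (u n) - x| <= 2 * s * 2^-1 ^+ n.
  apply: nested_limit; first exact: ltW.
  by move=> n; apply: le_trans (uS n); rewrite -ReB Re_le_cmod.
have [x2 x2P] : exists x, forall n, `|complex.Im (u n) - x| <= 2 * s * 2^-1 ^+ n.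
  apply: nested_limit; first exact: ltW.
  by move=> n; apply: le_trans (uS n); rewrite -ImB Im_le_cmod.
pose x : C := Complex x1 x2.
have ux n : cmod (u n - x) <= 8 * (s * 2^-1 ^+ n).
  apply: le_trans (cmod_leReIm _) _; rewrite ReB ImB /=.
  have := x1P n; have := x2P n.
  have : 0 < s * 2^-1 ^+ n by rewrite mulr_gt0// exprn_gt0// invr_gt0.
  lra.
have lim0 (d : R) : 0 < d -> exists n, s * 2^-1 ^+ n < d.
  move=> d0; have : (fun n => s * 2^-1 ^+ n) @ \oo --> (s * 0 : R).
    apply: cvgMr; apply: cvg_expr; rewrite ger0_norm ?invr_ge0//.
    by rewrite invf_lt1// ltr1n.
  rewrite mulr0 => /cvgrPdist_lt /(_ _ d0)[N _ /(_ N (leqnn _))].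
  rewrite sub0r normrN ger0_norm ?mulr_ge0 ?exprn_ge0 ?invr_ge0// ?ltW//.
  by exists N.
have Kx : K x.
  apply: contrapT => /Kcl[d d0 dP].
  have d8 : 0 < d / 8 by rewrite divr_gt0.
  have [n nP] := lim0 (d / 8) d8.
  apply: (dP (u n)).
    by apply: le_lt_trans (ux n) _; lra.
  by case: (badT n) => [[[]]].
have [d d0 dP] := tri_local Kx e0.
have [n nP] := lim0 d d0.
have [S B] := badT n.
have sp : 0 < (T n).1 by rewrite sT mulr_gt0// exprn_gt0// invr_gt0.
have := dP _ _ _ _ S; rewrite sp sT nP -sT => /(_ isT).
have ux' := ux n; rewrite -sT in ux'; move=> /(_ ux').
by rewrite leNgt B.
Qed.

End Tri.
End Goursat.

(** * Primitives on the disc and contraction of edges towards a pole *)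

Section Cauchy.
Variable R : realType.
Local Notation C := (Cplx R).
Local Notation leb := (@lebesgue_measure R).
Implicit Types (F G : C -> C) (a b c z w : C) (K : set C) (r u v k s : R).

Definition holo F := forall z, cmod z < 1 -> exists l, has_deriv F z l.

Lemma conv_le (x y m t : R) : 0 <= t <= 1 -> x <= m -> y <= m -> (1 - t) * x + t * y <= m.
Proof. by move=> /andP[t0 t1] xm ym; nra. Qed.

Lemma conv_lt (x y m t : R) : 0 <= t <= 1 -> x < m -> y < m -> (1 - t) * x + t * y < m.
Proof.
move=> t01 xm ym; apply: le_lt_trans (_ : Num.max x y < m); last by rewrite gt_max xm.
by apply: conv_le; rewrite ?le_max ?lexx ?orbT.
Qed.

Definition lform u v z : R := u * complex.Re z + v * complex.Im z.

(** The closed convex sets fed to Goursat's lemma: a closed disc cut by a half-plane. The cut keeps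
    a pole outside; with u = v = k = 0 the set is the whole closed disc. *)
Definition capped r u v k : set C := [set w | cmod w <= r /\ k <= lform u v w].

Lemma lformB u v z w : lform u v (z - w) = lform u v z - lform u v w.
Proof. by rewrite /lform ReB ImB; ring. Qed.

Lemma lform_seg u v a b t :
  lform u v (seg a b t) = lform u v a + t * (lform u v b - lform u v a).
Proof. by rewrite /lform /seg ReD ImD ReM ImM ReB ImB /=; ring. Qed.

Lemma lform_le u v z : lform u v z <= (`|u| + `|v|) * cmod z.
Proof.
rewrite /lform mulrDl; apply: lerD.
  apply: le_trans (ler_norm _) _; rewrite normrM ler_wpM2l//; exact: Re_le_cmod.
apply: le_trans (ler_norm _) _; rewrite normrM ler_wpM2l//; exact: Im_le_cmod.
Qed.

Lemma cmod_seg a b t : 0 <= t <= 1 -> cmod (seg a b t) <= (1 - t) * cmod a + t * cmod b.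
Proof.
move=> /andP[t0 t1].
have -> : seg a b t = ((1 - t)%:C)%C * a + (t%:C)%C * b.
  by rewrite /seg rcB (rmorph1 (real_complex R)); ring.
apply: le_trans (cmodD _ _) _.
by rewrite !cmodM !cmod_rc !ger0_norm// subr_ge0.
Qed.

Lemma capped_convex r u v k : convexC (capped r u v k).
Proof.
move=> a b t [ar ak] [br bk] t01; split.
  apply: le_trans (cmod_seg _ _ t01) _; move: t01 => /andP[t0 t1]; nra.
by rewrite lform_seg; move: t01 => /andP[t0 t1]; nra.
Qed.

Lemma capped_closed r u v k : closedC (capped r u v k).
Proof.
move=> x nx; have [xr|xr] := ltP r (cmod x).
  exists (cmod x - r); first by rewrite subr_gt0.
  move=> y xy [yr _].
  by have := ler_cmodB x y; rewrite cmodBC; lra.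
have kx : lform u v x < k by rewrite ltNge; apply/negP => h; apply: nx.
have p0 : 0 < `|u| + `|v| + 1 by rewrite ltr_wpDl// addr_ge0.
exists ((k - lform u v x) / (`|u| + `|v| + 1)); first by rewrite divr_gt0// subr_gt0.
move=> y; rewrite ltr_pdivlMr// => xy [_ yk].
have := lform_le u v (y - x); rewrite lformB.
have := cmod_ge0 (y - x); nra.
Qed.

Lemma cst_contc c z : contc (fun=> c) z.
Proof. by move=> e e0; exists 1 => // w _; rewrite subrr cmod0. Qed.

Lemma J_cst c a b : J (fun=> c) a b = (b - a) * c.
Proof. by rewrite /J cint_cst. Qed.

Lemma JZ c G a b : segc G a b -> J (fun w => c * G w) a b = c * J G a b.
Proof. by move=> H; rewrite /J (cintZ _ (seg_pathc H)); ring. Qed.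

Lemma JD G H a b : segc G a b -> segc H a b ->
  J (fun w => G w + H w) a b = J G a b + J H a b.
Proof. by move=> H1 H2; rewrite /J (cintD (seg_pathc H1) (seg_pathc H2)) mulrDr. Qed.

Lemma eq_J F G a b : (forall t, 0 <= t <= 1 -> F (seg a b t) = G (seg a b t)) ->
  J F a b = J G a b.
Proof. by move=> H; congr (_ * _); exact: eq_cint. Qed.

Lemma capped_ball r z : capped r 0 0 0 z <-> cmod z <= r.
Proof. by split=> [[]//|h]; split=> //; rewrite /lform !mul0r addr0. Qed.

Lemma segc_cont F a b : (forall w, cmod w < 1 -> contc F w) ->
  cmod a < 1 -> cmod b < 1 -> segc F a b.
Proof.
move=> cF a1 b1 t t01; apply: cF.
by apply: le_lt_trans (cmod_seg _ _ t01) _; exact: conv_lt.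
Qed.

Lemma segc_holo F a b : holo F -> cmod a < 1 -> cmod b < 1 -> segc F a b.
Proof. by move=> hF; apply: segc_cont => w /hF[l]; exact: has_deriv_contc. Qed.

(** Continuity and vanishing triangle integrals are the only assumptions on F, so the lemma also
    plays the part of Morera's theorem for limits of holomorphic functions. *)
Lemma primitive_tri F z : (forall w, cmod w < 1 -> contc F w) ->
  (forall a b c, cmod a < 1 -> cmod b < 1 -> cmod c < 1 -> tri F a b c = 0) ->
  cmod z < 1 -> has_deriv (J F 0) z (F z).
Proof.
move=> cF TF z1 e e0.
have e2 : 0 < e / 2 by rewrite divr_gt0.
have [d d0 dP] := cF z z1 _ e2.
exists (Num.min d (1 - cmod z)); first by rewrite lt_min d0 subr_gt0.
move=> h; rewrite lt_min => /andP[hd hr].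
have zh1 : cmod (z + h) < 1 by apply: le_lt_trans (cmodD _ _) _; lra.
have o1 : cmod (0 : C) < 1 by rewrite cmod0.
have T := TF _ _ _ o1 z1 zh1.
have s0 : segc F 0 (z + h) by exact: segc_cont.
have sz : segc F z (z + h) by exact: segc_cont.
move: T; rewrite /tri (J_rev s0) => T.
have -> : J F 0 (z + h) - J F 0 z - F z * h = J (fun w => F w - F z) z (z + h).
  rewrite JB//; last by move=> t _; exact: cst_contc.
  rewrite J_cst; have -> : J F z (z + h) = J F 0 (z + h) - J F 0 z.
    by apply: subr0_eq; rewrite -[RHS]T; ring.
  by ring.
have -> : e * cmod h = 2 * (e / 2) * cmod (z + h - z).
  by rewrite addrC addKr; field.
apply: J_bound => t t01.
  move=> e' e'0; have [d' d'0 dP'] := sz t t01 _ e'0.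
  exists d' => // w /dP'; by rewrite opprB addrA subrK.
apply/ltW/dP; rewrite /seg addrC addKr (addrC z) addrK cmodM cmod_rc.
by move: t01 => /andP[t0 t1]; rewrite ger0_norm//; have := cmod_ge0 h; nra.
Qed.

Lemma holo_tri F a b c : holo F -> cmod a < 1 -> cmod b < 1 -> cmod c < 1 -> tri F a b c = 0.
Proof.
move=> hF a1 b1 c1; pose r := Num.max (cmod a) (Num.max (cmod b) (cmod c)).
have r1 : r < 1 by rewrite /r !gt_max a1 b1.
apply: (@tri_eq0 _ _ (capped r 0 0 0)).
- exact: capped_convex.
- exact: capped_closed.
- by move=> w /capped_ball wr; apply: hF; lra.
- by apply/capped_ball; rewrite /r le_max lexx.
- by apply/capped_ball; rewrite /r !le_max lexx orbT.
- by apply/capped_ball; rewrite /r !le_max lexx !orbT.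
Qed.

Lemma primitive F z : holo F -> cmod z < 1 -> has_deriv (J F 0) z (F z).
Proof.
move=> hF; apply: primitive_tri => [w /hF[l]|a b c]; first exact: has_deriv_contc.
exact: holo_tri.
Qed.

(* A linear form bounded below by k on [a, b] - z keeps the segment away from z. *)
Definition edge_ok r z a b := exists u v k, [/\ 0 < k, `|u| + `|v| <= 1,
  cmod a <= r /\ cmod b <= r, k <= lform u v (a - z) & k <= lform u v (b - z)].

Lemma edge_dist r z a b : edge_ok r z a b ->
  exists2 k, 0 < k & forall t, 0 <= t <= 1 -> k <= cmod (seg a b t - z).
Proof.
move=> [u [v [k [k0 uv _ ka kb]]]]; exists k => // t /andP[t0 t1].
apply: (@le_trans _ _ (lform u v (seg a b t - z))).
  by rewrite !lformB in ka kb *; rewrite lform_seg; nra.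
apply: le_trans (lform_le _ _ _) _.
have := cmod_ge0 (seg a b t - z); have := normr_ge0 u; have := normr_ge0 v; nra.
Qed.

Lemma seg_seg z a b t s : seg (seg z a s) (seg z b s) t = seg z (seg a b t) s.
Proof. by rewrite /seg; ring. Qed.

(** Goursat's lemma on the two triangles into which a diagonal cuts the quadrilateral a, a', b', b,
    where a' and b' are the images of a and b under the contraction towards z. The half-plane at
    height s k contains the quadrilateral but not z. *)
Lemma edge_scale r z a b G s : r < 1 -> cmod z <= r -> edge_ok r z a b ->
  (forall w, cmod w < 1 -> w != z -> exists l, has_deriv G w l) -> 0 < s <= 1 ->
  J G a b = J G a (seg z a s) + J G (seg z a s) (seg z b s) - J G b (seg z b s).
Proof.
move=> r1 zr [u [v [k [k0 uv [ar br] ka kb]]]] hG /andP[s0 s1].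
pose K := capped r u v (lform u v z + s * k).
have dK w : K w -> exists l, has_deriv G w l.
  move=> [wr wk]; apply: hG; first lra.
  apply/eqP => wz; move: wk; rewrite wz; nra.
rewrite !lformB in ka kb.
have s01 : 0 <= s <= 1 by rewrite ltW.
have Ka : K a by split=> //; nra.
have Kb : K b by split=> //; nra.
have Ka' : K (seg z a s).
  split; last by rewrite lform_seg; nra.
  by apply: le_trans (cmod_seg _ _ s01) _; nra.
have Kb' : K (seg z b s).
  split; last by rewrite lform_seg; nra.
  by apply: le_trans (cmod_seg _ _ s01) _; nra.
have Kc := @capped_convex r u v (lform u v z + s * k).
have Kcl := @capped_closed r u v (lform u v z + s * k).
have T1 := tri_eq0 Kc Kcl dK Ka Ka' Kb'.
have T2 := tri_eq0 Kc Kcl dK Ka Kb' Kb.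
have sc x y := @Ksegc _ G K Kc dK x y.
move: T1 T2; rewrite /tri (J_rev (sc _ _ Ka Kb')) (J_rev (sc _ _ Ka Kb)) (J_rev (sc _ _ Kb Kb')).
move: (J G) => j; set A := (X in X = 0 -> _) => T1; set B := (X in X = 0 -> _) => T2.
apply: subr0_eq; transitivity (- (A + B)); first by rewrite /A /B; ring.
by rewrite T1 T2 addr0 oppr0.
Qed.

Lemma has_deriv_kernel z w : w != z -> has_deriv (fun w => (w - z)^-1) w (- 1 / (w - z) ^+ 2).
Proof.
move=> wz; apply: has_derivV; first by rewrite subr_eq0.
rewrite -[X in has_deriv _ _ X]subr0; apply: has_derivB; [exact: has_deriv_id|exact: has_deriv_cst].
Qed.

Lemma scaled_kernel (x y p q : C) : x != 0 -> y != 0 ->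
  x * (p * (x * y)^-1) - q * y^-1 = (p - q) * y^-1.
Proof. by move=> x0 y0; rewrite invfM mulrCA mulVKf// mulrBl. Qed.

(** As s -> 0, F tends to F(z) on the contracted edge, while the factor s of arc length cancels the
    homogeneity of the kernel; what remains is F(z) times the kernel integral over the original
    edge. The two spokes towards z may diverge and are kept, to cancel around a closed contour. *)
Lemma edge_limit r z a b F : r < 1 -> cmod z <= r -> edge_ok r z a b -> holo F ->
  let G w := F w * (w - z)^-1 in
  forall e, 0 < e -> exists2 s0, 0 < s0 & forall s, 0 < s < s0 -> 
  cmod (J G a b - (J G a (seg z a s) - J G b (seg z b s)) - F z * J (fun w => (w - z)^-1) a b) <= e.
Proof.
move=> r1 zr ok hF G e e0.
have hG w : cmod w < 1 -> w != z -> exists l, has_deriv G w l.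
  move=> /hF[l hl] wz; eexists; apply: has_derivM; [exact: hl|exact: has_deriv_kernel].
have [k k0 kP] := edge_dist ok.
have [ar br] : cmod a <= r /\ cmod b <= r by case: ok => ? [? [? []]].
have [l hl] : exists l, has_deriv F z l by apply: hF; lra.
have p0 : 0 < 2 * (cmod (b - a) + 1) by rewrite mulr_gt0// ltr_wpDl ?cmod_ge0.
have e1 : 0 < e / (2 * (cmod (b - a) + 1)) * k by rewrite mulr_gt0// divr_gt0.
have [d d0 dP] := has_deriv_contc hl e1.
have r0 : 0 <= r := le_trans (cmod_ge0 _) zr.
exists (Num.min 1 (d / 2)); first by rewrite lt_min ltr01 divr_gt0.
move=> s /andP[s0]; rewrite lt_min => /andP[s1 sd].
have s01 : 0 < s <= 1 by rewrite s0 ltW.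
rewrite (edge_scale r1 zr ok hG s01).
have -> : J G a (seg z a s) + J G (seg z a s) (seg z b s) - J G b (seg z b s) -
  (J G a (seg z a s) - J G b (seg z b s)) = J G (seg z a s) (seg z b s) by ring.
have sn0 : (s%:C)%C != 0 :> C by rewrite rc_eq0 gt_eqF.
have inball w : cmod w <= r -> cmod (seg z w s) < 1.
  move=> wr; apply: le_lt_trans (cmod_seg _ _ _) _; first by rewrite !ltW.
  by nra.
have segne t : 0 <= t <= 1 -> seg a b t - z != 0.
  by move=> t01; rewrite -cmod_gt0; apply: lt_le_trans (kP _ t01).
have seg1 t : 0 <= t <= 1 -> cmod (seg a b t) <= r.
  by move=> t01; apply: le_trans (cmod_seg _ _ t01) _; move: t01 => /andP[t0 t1]; nra.
have segz t : seg z (seg a b t) s - z = (s%:C)%C * (seg a b t - z).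
  by rewrite {1}/seg; ring.
have pG : pathc (fun t => (s%:C)%C * G (seg (seg z a s) (seg z b s) t)).
  apply/pathcZ/seg_pathc => t t01; rewrite seg_seg.
  have [||m hm] := hG (seg z (seg a b t) s); [by apply: inball; exact: seg1| |exact: has_deriv_contc hm].
  by rewrite -subr_eq0 segz mulf_neq0// segne.
have pk : pathc (fun t => (seg a b t - z)^-1).
  apply: (@seg_pathc _ (fun w => (w - z)^-1)) => t t01.
  have wz : seg a b t != z by rewrite -subr_eq0 segne.
  exact: (has_deriv_contc (has_deriv_kernel wz)).
have -> : J G (seg z a s) (seg z b s) =
   (b - a) * cint (fun t => (s%:C)%C * G (seg (seg z a s) (seg z b s) t)).
  rewrite /J cintZ; last first.
    apply/seg_pathc => t t01; rewrite seg_seg.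
    have [||m hm] := hG (seg z (seg a b t) s); [by apply: inball; exact: seg1| |exact: has_deriv_contc hm].
    by rewrite -subr_eq0 segz mulf_neq0// segne.
  by rewrite mulrA; congr (_ * _); rewrite /seg; ring.
rewrite /J mulrCA -mulrBr -cintZ// -cintB//; last exact: pathcZ.
rewrite cmodM.
have B t : 0 <= t <= 1 -> cmod ((s%:C)%C * G (seg (seg z a s) (seg z b s) t)
     - F z * (seg a b t - z)^-1) <= e / (2 * (cmod (b - a) + 1)).
  move=> t01.
  have -> : (s%:C)%C * G (seg (seg z a s) (seg z b s) t) - F z * (seg a b t - z)^-1
     = (F (seg z (seg a b t) s) - F z) * (seg a b t - z)^-1.
    by rewrite seg_seg /G segz scaled_kernel// segne.
  rewrite cmodM cmodV ler_pdivrMr ?cmod_gt0 ?segne//.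
  have : cmod (F (seg z (seg a b t) s) - F z) < e / (2 * (cmod (b - a) + 1)) * k.
    apply: dP; rewrite segz cmodM cmod_rc ger0_norm ?(ltW s0)//.
    have : cmod (seg a b t - z) <= 2 by apply: le_trans (cmodB _ _) _; have := seg1 t t01; lra.
    have := cmod_ge0 (seg a b t - z); nra.
  move=> /ltW h; apply: le_trans h _; rewrite ler_wpM2l ?kP//.
  by rewrite divr_ge0// ltW.
have pB : pathc (fun t => (s%:C)%C * G (seg (seg z a s) (seg z b s) t)
     - F z * (seg a b t - z)^-1).
  have := pathcD pG (pathcZ (- F z) pk).
  by under eq_fun do rewrite mulNr.
apply: le_trans (ler_wpM2l (cmod_ge0 _) (cint_bound pB B)) _.
rewrite [X in X <= _](_ : _ = e * (cmod (b - a) / (cmod (b - a) + 1))); last first.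
  by field; have := cmod_ge0 (b - a); move=> ?; apply/eqP; lra.
apply: ler_piMr; first exact: ltW.
by rewrite ler_pdivrMr ?mul1r ?lerDl ?ltr_wpDl ?cmod_ge0.
Qed.

End Cauchy.

(** * Differentiation of Cauchy integrals with respect to the pole *)

Section CauchyFormula.
Variable R : realType.
Local Notation C := (Cplx R).
Local Notation leb := (@lebesgue_measure R).
Implicit Types (F G : C -> C) (a b c z w : C) (r u v k s : R).

Definition kern z w : C := (w - z)^-1.

Lemma has_derivX (G : C -> C) w l n : has_deriv G w l ->
  exists m, has_deriv (fun w => G w ^+ n) w m.
Proof.
move=> H; elim: n => [|n [m ih]]; first by exists 0; exact: has_deriv_cst.
rewrite (_ : (fun w => G w ^+ n.+1) = (fun w => G w * G w ^+ n)).
  by eexists; exact: has_derivM H ih.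
by apply/funext => x; rewrite exprS.
Qed.

Lemma edge_segc r z a b F n : r < 1 -> edge_ok r z a b -> holo F ->
  segc (fun w => F w * kern z w ^+ n) a b.
Proof.
move=> r1 ok hF t t01; have [k k0 kP] := edge_dist ok.
have [ar br] : cmod a <= r /\ cmod b <= r by case: ok => ? [? [? []]].
have [|l hl] := hF (seg a b t).
  by apply: le_lt_trans (cmod_seg _ _ t01) _; apply: conv_lt => //; lra.
have wz : seg a b t != z.
  by rewrite -subr_eq0 -cmod_gt0; apply: lt_le_trans (kP _ t01).
have [m hm] := has_derivX n (has_deriv_kernel wz).
exact: (has_deriv_contc (has_derivM hl hm)).
Qed.

Lemma pathc_bounded (phi : R -> C) : pathc phi ->
  exists M, forall t, 0 <= t <= 1 -> cmod (phi t) <= M.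
Proof.
move=> H; have [c _ cP] := @EVT_max R (fun t => cmod (phi t)) 0 1 ler01
   (within01 (fun t => pathc_cmod H)).
by exists (cmod (phi c)) => t t01; apply: cP; rewrite in_itv.
Qed.

Lemma edge_bound F a b : segc F a b ->
  exists M, 0 <= M /\ forall t, 0 <= t <= 1 -> cmod (F (seg a b t)) <= M.
Proof.
move=> H; have [M MP] := pathc_bounded (seg_pathc H); exists M; split=> //.
by apply: le_trans (MP 0 _); rewrite ?cmod_ge0// lexx ler01.
Qed.

Lemma edge_ok_near r z a b : edge_ok r z a b -> exists2 d, 0 < d &
  forall z', cmod (z' - z) < d -> edge_ok r z' a b.
Proof.
move=> [u [v [k [k0 uv ab ka kb]]]]; exists (k / 2); first by rewrite divr_gt0.
move=> z' zz; exists u, v, (k / 2); split=> //; first by rewrite divr_gt0.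
all: rewrite !lformB in ka kb *.
all: have := lform_le u v (z' - z); rewrite lformB.
all: have := cmod_ge0 (z' - z); have := normr_ge0 u; have := normr_ge0 v; nra.
Qed.

(* With x = 1/(w-z-h) and y = 1/(w-z) one has x - y = h x y, hence
   x - y - h y^2 = h^2 x y^2 and x^2 - y^2 - 2 h y^3 = h^2 x y^2 (x + 2 y). *)
Lemma J_kern_deriv r z a b F (n : nat) : r < 1 -> edge_ok r z a b -> holo F ->
  (n == 1%N) || (n == 2%N) ->
  has_deriv (fun z => J (fun w => F w * kern z w ^+ n) a b) z
    (n%:R * J (fun w => F w * kern z w ^+ n.+1) a b).
Proof.
move=> r1 ok hF n12 e e0.
have [k k0 kP] := edge_dist ok.
have [d d0 dP] := edge_ok_near ok.
have sF : segc F a b.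
  have [ar br] : cmod a <= r /\ cmod b <= r by case: ok => ? [? [? []]].
  by apply: segc_holo => //; lra.
have [M [M0 MP]] := edge_bound sF.
pose q := k^-1; have q0 : 0 < q by rewrite invr_gt0.
(* For |h| < k / 2 one has |x| <= 2 q and |y| <= q; the terms with q^4 and q^3 cover n = 2 and n =
   1. *)
pose B := 2 * (M * (8 * q ^+ 4 + 8 * q ^+ 3)) * cmod (b - a) + 1.
have B0 : 0 < B.
  have q3 : 0 < q ^+ 3 by rewrite exprn_gt0.
  have q4 : 0 < q ^+ 4 by rewrite exprn_gt0.
  by rewrite ltr_wpDl// !mulr_ge0 ?cmod_ge0// addr_ge0// mulr_ge0// ltW.
exists (Num.min d (Num.min (k / 2) (e / B))).
  by rewrite !lt_min d0 !divr_gt0.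
move=> h; rewrite !lt_min => /and3P[hd hk he].
have ok' : edge_ok r (z + h) a b by apply: dP; rewrite addrC addKr.
rewrite -mulrA (mulrC _ h) mulrA.
have s1 := @edge_segc _ _ _ _ F n r1 ok' hF.
have s2 := @edge_segc _ _ _ _ F n r1 ok hF.
have s3 := @edge_segc _ _ _ _ F n.+1 r1 ok hF.
have sc c G : segc G a b -> segc (fun w => c * G w) a b.
  move=> H t t01 e' e'0; have p0 : 0 < cmod c + 1 by rewrite ltr_wpDl ?cmod_ge0.
  have [d' d'0 d'P] := H t t01 _ (divr_gt0 e'0 p0).
  exists d' => // w /d'P; rewrite ltr_pdivlMr// -mulrBr cmodM => h'.
  by have := cmod_ge0 (G w - G (seg a b t)); nra.
have sB G H : segc G a b -> segc H a b -> segc (fun w => G w - H w) a b.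
  move=> H1 H2 t t01 e' e'0; have e2 : 0 < e' / 2 by rewrite divr_gt0.
  have [d1 d10 d1P] := H1 t t01 _ e2; have [d2 d20 d2P] := H2 t t01 _ e2.
  exists (Num.min d1 d2); first by rewrite lt_min d10.
  move=> w; rewrite lt_min => /andP[/d1P h1 /d2P h2].
  have -> : G w - H w - (G (seg a b t) - H (seg a b t)) =
    (G w - G (seg a b t)) - (H w - H (seg a b t)) by ring.
  by apply: le_lt_trans (cmodB _ _) _; lra.
rewrite -JB// -JZ// -JB//; [|exact: sB|exact: sc].
have bnd t : 0 <= t <= 1 -> cmod (F (seg a b t) * kern (z + h) (seg a b t) ^+ n -
   F (seg a b t) * kern z (seg a b t) ^+ n -
   n%:R * h * (F (seg a b t) * kern z (seg a b t) ^+ n.+1)) <=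
   cmod h ^+ 2 * (M * (8 * q ^+ 4 + 8 * q ^+ 3)).
  move=> t01; have Fb := MP t t01; have kt := kP t t01.
  move: (F (seg a b t)) (Fb) => f fM.
  pose x := kern (z + h) (seg a b t); pose y := kern z (seg a b t).
  have w0 : seg a b t - z != 0 by rewrite -cmod_gt0; lra.
  have kt' : k / 2 <= cmod (seg a b t - (z + h)).
    by have := ler_cmodB (seg a b t - z) h; rewrite opprD addrA; lra.
  have wh0 : seg a b t - (z + h) != 0 by rewrite -cmod_gt0; lra.
  have xy : x = y + h * x * y.
    rewrite /x /y /kern; move: w0 wh0; move: (seg a b t) => w w0 wh0.
    by field; rewrite w0.
  have k20 : 0 < k / 2 by lra.
  have q20 : 2 * q = (k / 2)^-1 by rewrite invf_div mulrC.
  have xk : cmod x <= 2 * q by rewrite /x /kern cmodV q20 lef_pV2 ?posrE//; lra.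
  have yk : cmod y <= q by rewrite /y /kern cmodV lef_pV2 ?posrE//; lra.
  have x0 := cmod_ge0 x; have y0 := cmod_ge0 y.
  have H3 : cmod (x * y ^+ 2) <= 2 * q ^+ 3.
    rewrite cmodM cmodX; have -> : 2 * q ^+ 3 = (2 * q) * q ^+ 2 by ring.
    by apply: ler_pM => //; [exact: exprn_ge0|rewrite lerXn2r// nnegrE ltW].
  have q3 : 0 < q ^+ 3 by rewrite exprn_gt0.
  have q4 : 0 < q ^+ 4 by rewrite exprn_gt0.
  rewrite -/x -/y; case/orP: n12 => /eqP ->.
  - rewrite [X in cmod X](_ : _ = f * (h ^+ 2 * (x * y ^+ 2))); last first.
      by rewrite expr1 mul1r {1}xy {1}xy; ring.
    rewrite [cmod (f * _)]cmodM [cmod (h ^+ 2 * _)]cmodM cmodX mulrCA ler_wpM2l ?sqr_ge0//.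
    by apply: ler_pM; rewrite ?cmod_ge0//; apply: le_trans H3 _; lra.
  - rewrite [X in cmod X](_ : _ = f * (h ^+ 2 * ((x * y ^+ 2) * (x + 2 * y)))); last first.
      have E : x - y = h * x * y by rewrite {1}xy; ring.
      transitivity (f * ((x - y) * (x + y) - 2 * h * y ^+ 3)); first by ring.
      rewrite E; transitivity (f * h * y * ((x - y) * (x + 2 * y))); first by ring.
      by rewrite E; ring.
    have X2 : cmod (x + 2 * y) <= 4 * q.
      apply: le_trans (cmodD _ _) _; rewrite cmodM.
      have -> : cmod (2 : C) = 2 by rewrite -(rmorph_nat (real_complex R)) cmod_rc ger0_norm.
      lra.
    rewrite [cmod (f * _)]cmodM [cmod (h ^+ 2 * _)]cmodM cmodX mulrCA ler_wpM2l ?sqr_ge0//.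
    apply: ler_pM; rewrite ?cmod_ge0// cmodM.
    apply: le_trans (ler_pM _ _ H3 X2) _; rewrite ?cmod_ge0//.
    have -> : 2 * q ^+ 3 * (4 * q) = 8 * q ^+ 4 by ring.
    by lra.
apply: le_trans (J_bound _ bnd) _; first by apply: (sB); [exact: sB|exact: sc].
have -> : 2 * (cmod h ^+ 2 * (M * (8 * q ^+ 4 + 8 * q ^+ 3))) * cmod (b - a)
   = cmod h ^+ 2 * (B - 1) by rewrite /B; ring.
move: he; rewrite ltr_pdivlMr// => he; have := cmod_ge0 h; nra.
Qed.

Definition corner z s (i j : R) : C := z + Complex (i * s) (j * s).

Definition contour G z s : C :=
  J G (corner z s (-1) (-1)) (corner z s 1 (-1)) +
  J G (corner z s 1 (-1)) (corner z s 1 1) +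
  J G (corner z s 1 1) (corner z s (-1) 1) +
  J G (corner z s (-1) 1) (corner z s (-1) (-1)).

Definition sqin z s z' := `|complex.Re (z' - z)| <= s /\ `|complex.Im (z' - z)| <= s.

Lemma cmod_corner z s i j : 0 <= s -> `|i| <= 1 -> `|j| <= 1 ->
  cmod (corner z s i j) <= cmod z + 2 * s.
Proof.
move=> s0 i1 j1; apply: le_trans (cmodD _ _) _; rewrite lerD2l.
apply: le_trans (cmod_leReIm _) _ => /=; rewrite !normrM (ger0_norm s0).
nra.
Qed.

(** The linear form of each edge is its outer normal. A point of the concentric square of half the
    size keeps distance at least s / 2 from every edge. *)
Lemma corners_ok z0 s z : 0 < s -> sqin z0 (s / 2) z -> let r := cmod z0 + 2 * s in
  [/\ edge_ok r z (corner z0 s (-1) (-1)) (corner z0 s 1 (-1)),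
      edge_ok r z (corner z0 s 1 (-1)) (corner z0 s 1 1),
      edge_ok r z (corner z0 s 1 1) (corner z0 s (-1) 1) &
      edge_ok r z (corner z0 s (-1) 1) (corner z0 s (-1) (-1))].
Proof.
move=> s0; rewrite /sqin !ler_norml ReB ImB => -[/andP[h1 h2] /andP[h3 h4]]; set r := cmod z0 + 2 * s.
have n1 : `|-1| <= 1 :> R by rewrite normrN normr1.
have p1 : `|1| <= 1 :> R by rewrite normr1.
have cc i j : `|i| <= 1 -> `|j| <= 1 -> cmod (corner z0 s i j) <= r.
  by move=> *; apply: cmod_corner => //; exact: ltW.
have s20 : 0 < s / 2 by rewrite divr_gt0.
split.
- exists 0, (-1), (s / 2); rewrite normrN normr0 normr1 add0r; split=> //; [by split; exact: cc| |];
    by rewrite lformB /lform /corner ReD ImD /=; lra.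
- exists 1, 0, (s / 2); rewrite normr0 normr1 addr0; split=> //; [by split; exact: cc| |];
    by rewrite lformB /lform /corner ReD ImD /=; lra.
- exists 0, 1, (s / 2); rewrite normr0 normr1 add0r; split=> //; [by split; exact: cc| |];
    by rewrite lformB /lform /corner ReD ImD /=; lra.
- exists (-1), 0, (s / 2); rewrite normrN normr0 normr1 addr0; split=> //; [by split; exact: cc| |];
    by rewrite lformB /lform /corner ReD ImD /=; lra.
Qed.

End CauchyFormula.

(** * Cauchy's formula on squares and holomorphy of the derivative *)

Section CauchyFormula.
Variable R : realType.
Local Notation C := (Cplx R).
Local Notation leb := (@lebesgue_measure R).
Implicit Types (F G : C -> C) (a b c z w : C) (r u v k s : R).

(* The contour integral of the kernel is not evaluated: it suffices that it does
   not vanish (kern_contour_Im). *)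
Lemma cauchy_formula F z0 s z : holo F -> 0 < s -> cmod z0 + 2 * s < 1 ->
  sqin z0 (s / 2) z ->
  contour (fun w => F w * kern z w) z0 s = F z * contour (kern z) z0 s.
Proof.
move=> hF s0 r1 zin; have [E1 E2 E3 E4] := corners_ok s0 zin.
have zr : cmod z <= cmod z0 + 2 * s.
  have -> : z = z0 + (z - z0) by rewrite addrC subrK.
  apply: le_trans (cmodD _ _) _; rewrite lerD2l.
  by apply: le_trans (cmod_leReIm _) _; case: zin; lra.
apply: subr0_eq; apply/eqP; rewrite -cmod_eq0 eq_le cmod_ge0 andbT.
apply/ler_addgt0Pr => e e0; rewrite add0r.
have e4 : 0 < e / 4 by rewrite divr_gt0.
have [s1 s10 L1] := edge_limit r1 zr E1 hF e4.
have [s2 s20 L2] := edge_limit r1 zr E2 hF e4.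
have [s3 s30 L3] := edge_limit r1 zr E3 hF e4.
have [s4 s40 L4] := edge_limit r1 zr E4 hF e4.
have [t tP] : exists t, [/\ 0 < t < s1, 0 < t < s2, 0 < t < s3 & 0 < t < s4].
  exists ((Num.min (Num.min s1 s2) (Num.min s3 s4)) / 2).
  set m := Num.min _ _; have m0 : 0 < m by rewrite !lt_min s10 s20 s30.
  have : m <= m by []; rewrite {2}/m !le_min => /andP[/andP[? ?] /andP[? ?]].
  by split; lra.
(* y1, ..., y4 are the spokes; each occurs in two neighbouring edges with opposite signs and drops
   out of the sum. *)
have cf (x1 x2 x3 x4 y1 y2 y3 y4 k1 k2 k3 k4 f : C) :
    cmod (x1 - (y1 - y2) - f * k1) <= e / 4 -> cmod (x2 - (y2 - y3) - f * k2) <= e / 4 ->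
    cmod (x3 - (y3 - y4) - f * k3) <= e / 4 -> cmod (x4 - (y4 - y1) - f * k4) <= e / 4 ->
    cmod (x1 + x2 + x3 + x4 - f * (k1 + k2 + k3 + k4)) <= e.
  move=> h1 h2 h3 h4.
  rewrite [X in cmod X](_ : _ = (x1 - (y1 - y2) - f * k1) + (x2 - (y2 - y3) - f * k2) +
    (x3 - (y3 - y4) - f * k3) + (x4 - (y4 - y1) - f * k4)); last by ring.
  apply: le_trans (cmodD _ _) _; apply: le_trans (lerD (cmodD _ _) (lexx _)) _.
  apply: le_trans (lerD (lerD (cmodD _ _) (lexx _)) (lexx _)) _; lra.
case: tP => /L1 B1 /L2 B2 /L3 B3 /L4 B4.
exact: cf B1 B2 B3 B4.
Qed.

(** On the edge, Im((b - a) / (w - z)) equals Im((b - a) conj(a - z)) / |w - z|^2: replacing w by a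
    changes conj(w - z) by a real multiple of conj(b - a), whose product with b - a is real. *)
Lemma Im_edge z a b (A B : R) : segc (kern z) a b -> 0 < A -> 0 < B ->
  (forall t, 0 <= t <= 1 -> seg a b t != z) ->
  A <= complex.Im ((b - a) * (a - z)^*%C) ->
  (forall t, 0 <= t <= 1 -> cmod (seg a b t - z) ^+ 2 <= B) ->
  A / B <= complex.Im (J (kern z) a b).
Proof.
move=> sk A0 B0 ne HA HB; rewrite /J -cintZ; last exact: seg_pathc sk.
rewrite /cint /=.
have <- : \int[leb]_(t in `[0, 1]) (A / B) = A / B.
  by rewrite Rintegral_cst//= leb01 mulr1.
apply: le_Rintegral => //.
- by apply: integrable_cont => t _; exact: cst_continuous.
- exact: (pathc_intIm (pathcZ _ (seg_pathc sk))).
move=> t; rewrite /= in_itv/= => t01.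
have w0 : seg a b t - z != 0 by rewrite subr_eq0 ne.
have Bt := HB t t01.
have -> : complex.Im ((b - a) * kern z (seg a b t)) =
   complex.Im ((b - a) * (a - z)^*%C) / cmod (seg a b t - z) ^+ 2.
  have p0 : cmod (seg a b t - z) ^+ 2 != 0 by rewrite sqrf_eq0 cmod_eq0.
  apply: (canRL (mulfK p0)).
  have -> : kern z (seg a b t) = (((cmod (seg a b t - z) ^+ 2)^-1)%:C)%C * (seg a b t - z)^*%C.
    apply: (mulfI w0); rewrite /kern mulfV// mulrCA.
    have -> : (seg a b t - z) * (seg a b t - z)^*%C = ((cmod (seg a b t - z) ^+ 2)%:C)%C.
      by rewrite -sqr_normc norm_cmod -rmorphXn.
    by rewrite rcV mulVf// rc_eq0.
  move: p0; move: (cmod _ ^+ 2) => p p0; rewrite /seg.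
  case: a b z {sk ne HA HB w0 Bt} => [a1 a2] [b1 b2] [z1 z2] /=; by field.
rewrite ler_pM//.
- exact: ltW.
- by rewrite invr_ge0 ltW.
- by rewrite lef_pV2 ?posrE// exprn_gt0// cmod_gt0.
Qed.

Lemma sum4_ge (x y u v : R) : 5^-1 <= x -> 5^-1 <= y -> 5^-1 <= u -> 5^-1 <= v ->
  2^-1 <= x + y + u + v.
Proof. lra. Qed.

(** [Im_edge] gives at least 1/5 on each edge: A = s^2 is the length 2 s times a distance of at
    least s / 2 from z, and B = 5 s^2 exceeds 2 (3 s / 2)^2. *)
Lemma kern_contour_Im z0 s z : 0 < s -> cmod z0 + 2 * s < 1 -> sqin z0 (s / 2) z ->
  2^-1 <= complex.Im (contour (kern z) z0 s).
Proof.
move=> s0 r1 zin; have [E1 E2 E3 E4] := corners_ok s0 zin.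
have h1 : holo (fun=> 1 : C) by move=> w _; exists 0; exact: has_deriv_cst.
have K r a b : r < 1 -> edge_ok r z a b -> segc (kern z) a b /\
   (forall t, 0 <= t <= 1 -> seg a b t != z).
  move=> r1' ok; split.
    have := @edge_segc _ _ _ _ _ (fun=> 1) 1%N r1' ok h1.
    by rewrite (_ : (fun w => 1 * _) = kern z)//; apply/funext => w; rewrite mul1r expr1.
  move=> t t01; have [k k0 kP] := edge_dist ok.
  by rewrite -subr_eq0 -cmod_gt0; apply: lt_le_trans (kP _ t01).
move: zin; rewrite /sqin !ler_norml ReB ImB => -[/andP[x1 x2] /andP[y1 y2]].
have s2 : 0 < s ^+ 2 by rewrite exprn_gt0.
have s5 : 0 < 5 * s ^+ 2 by rewrite mulr_gt0.
have Q i j i' j' : `|i| <= 1 -> `|j| <= 1 -> `|i'| <= 1 -> `|j'| <= 1 ->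
    forall t, 0 <= t <= 1 ->
    cmod (seg (corner z0 s i j) (corner z0 s i' j') t - z) ^+ 2 <= 5 * s ^+ 2.
  rewrite !ler_norml => /andP[i1 i2] /andP[j1 j2] /andP[i3 i4] /andP[j3 j4].
  move=> t t01; have /andP[t0 t1] := t01; rewrite cmod_sqr ReB ImB /seg /corner.
  have ReN (x : C) : complex.Re (- x) = - complex.Re x by case: x.
  have ImN (x : C) : complex.Im (- x) = - complex.Im x by case: x.
  rewrite !(ReD, ImD, ReM, ImM, ReB, ImB, ReN, ImN) /=.
  have ii : -1 <= i + t * (i' - i) <= 1 by apply/andP; split; nra.
  have jj : -1 <= j + t * (j' - j) <= 1 by apply/andP; split; nra.
  move: ii jj => /andP[ii1 ii2] /andP[jj1 jj2].
  set p := (X in X ^+ 2 + _); set o := (X in _ + X ^+ 2).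
  have P1 : `|p| <= 3 / 2 * s.
    have -> : p = (i + t * (i' - i)) * s - (complex.Re z - complex.Re z0) by rewrite /p; ring.
    by rewrite ler_norml; apply/andP; split; nra.
  have P2 : `|o| <= 3 / 2 * s.
    have -> : o = (j + t * (j' - j)) * s - (complex.Im z - complex.Im z0) by rewrite /o; ring.
    by rewrite ler_norml; apply/andP; split; nra.
  have P3 (x : R) : `|x| <= 3 / 2 * s -> x ^+ 2 <= 9 / 4 * s ^+ 2.
    by rewrite ler_norml => /andP[? ?]; nra.
  by have := P3 _ P1; have := P3 _ P2; lra.
have ImJ (x y : C) : complex.Im (x * y^*%C) = complex.Im x * complex.Re y - complex.Re x * complex.Im y.
  by case: x y => [? ?] [? ?] /=; ring.
have e5 : s ^+ 2 / (5 * s ^+ 2) = 5^-1 by field; exact: lt0r_neq0.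
have I1 : 5^-1 <= complex.Im (J (kern z) (corner z0 s (-1) (-1)) (corner z0 s 1 (-1))).
  have [K1 K2] := K _ _ _ r1 E1; rewrite -e5; apply: Im_edge => //; last first.
    by apply: Q; rewrite ?normrN normr1.
  by rewrite ImJ /corner !(ReB, ImB, ReD, ImD) /=; nra.
have I2 : 5^-1 <= complex.Im (J (kern z) (corner z0 s 1 (-1)) (corner z0 s 1 1)).
  have [K1 K2] := K _ _ _ r1 E2; rewrite -e5; apply: Im_edge => //; last first.
    by apply: Q; rewrite ?normrN normr1.
  by rewrite ImJ /corner !(ReB, ImB, ReD, ImD) /=; nra.
have I3 : 5^-1 <= complex.Im (J (kern z) (corner z0 s 1 1) (corner z0 s (-1) 1)).
  have [K1 K2] := K _ _ _ r1 E3; rewrite -e5; apply: Im_edge => //; last first.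
    by apply: Q; rewrite ?normrN normr1.
  by rewrite ImJ /corner !(ReB, ImB, ReD, ImD) /=; nra.
have I4 : 5^-1 <= complex.Im (J (kern z) (corner z0 s (-1) 1) (corner z0 s (-1) (-1))).
  have [K1 K2] := K _ _ _ r1 E4; rewrite -e5; apply: Im_edge => //; last first.
    by apply: Q; rewrite ?normrN normr1.
  by rewrite ImJ /corner !(ReB, ImB, ReD, ImD) /=; nra.
by rewrite /contour !ImD; exact: sum4_ge.
Qed.

Lemma contour_deriv F z0 s z n : holo F -> 0 < s -> cmod z0 + 2 * s < 1 ->
  sqin z0 (s / 2) z -> (n == 1%N) || (n == 2%N) ->
  has_deriv (fun z => contour (fun w => F w * kern z w ^+ n) z0 s) z
    (n%:R * contour (fun w => F w * kern z w ^+ n.+1) z0 s).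
Proof.
move=> hF s0 r1 zin n12; have [E1 E2 E3 E4] := corners_ok s0 zin.
rewrite /contour !mulrDr.
apply: has_derivD; last exact: J_kern_deriv r1 E4 hF n12.
apply: has_derivD; last exact: J_kern_deriv r1 E3 hF n12.
apply: has_derivD; last exact: J_kern_deriv r1 E2 hF n12.
exact: J_kern_deriv r1 E1 hF n12.
Qed.

(** Near z0 the function F is a quotient of two contour integrals, [N 1] over [k 1]. Differentiating
    this quotient twice uses [contour_deriv] for n = 1 and n = 2. *)
Lemma holo_derive1 F : holo F -> holo (derive1 F).
Proof.
move=> hF z0 z01; pose s := (1 - cmod z0) / 4.
have s0 : 0 < s by rewrite divr_gt0// subr_gt0.
have r1 : cmod z0 + 2 * s < 1 by rewrite /s; lra.
have h1 : holo (fun=> 1 : C) by move=> w _; exists 0; exact: has_deriv_cst.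
pose N n z := contour (fun w => F w * kern z w ^+ n) z0 s.
pose k n z := contour (fun w => 1 * kern z w ^+ n) z0 s.
have near z : cmod (z - z0) < s / 2 -> sqin z0 (s / 2) z.
  by move=> h; split; apply: le_trans (ltW h); [exact: Re_le_cmod|exact: Im_le_cmod].
have kn0 z : sqin z0 (s / 2) z -> k 1%N z != 0.
  move=> zin; apply/eqP => k0; have := kern_contour_Im s0 r1 zin.
  have -> : kern z = (fun w => 1 * kern z w ^+ 1).
    by apply/funext => w; rewrite mul1r expr1.
  by rewrite -/(k 1%N z) k0 /=; lra.
have FE z : sqin z0 (s / 2) z -> F z = N 1%N z * (k 1%N z)^-1.
  move=> zin; have := cauchy_formula hF s0 r1 zin.
  have e1 : (fun w => F w * kern z w) = (fun w => F w * kern z w ^+ 1).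
    by apply/funext => w; rewrite expr1.
  have e2 : kern z = (fun w => 1 * kern z w ^+ 1).
    by apply/funext => w; rewrite mul1r expr1.
  by rewrite e1 {2}e2 -/(N 1%N z) -/(k 1%N z) => ->; rewrite mulfK// kn0.
have s20 : 0 < s / 2 by rewrite divr_gt0.
have dN z : sqin z0 (s / 2) z -> has_deriv (N 1%N) z (N 2%N z).
  by move=> zin; have := @contour_deriv F _ _ _ 1%N hF s0 r1 zin isT; rewrite mul1r.
have dk z : sqin z0 (s / 2) z -> has_deriv (k 1%N) z (k 2%N z).
  by move=> zin; have := @contour_deriv _ _ _ _ 1%N h1 s0 r1 zin isT; rewrite mul1r.
have dF z : cmod (z - z0) < s / 2 -> derive1 F z =
    N 2%N z * (k 1%N z)^-1 + N 1%N z * (- k 2%N z * ((k 1%N z)^-1 * (k 1%N z)^-1)).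
  move=> zd; have zin := near _ zd; apply: has_deriv_derive1.
  apply: (@has_deriv_eq _ (fun z => N 1%N z * (k 1%N z)^-1) _ _ _ (s / 2 - cmod (z - z0))).
  - by rewrite subr_gt0.
  - move=> w wz; rewrite FE//; apply: near.
    have -> : w - z0 = (w - z) + (z - z0) by ring.
    by apply: le_lt_trans (cmodD _ _) _; lra.
  - have := has_derivM (dN _ zin) (has_derivV (kn0 _ zin) (dk _ zin)).
    by rewrite expr2 invfM.
have in0 : sqin z0 (s / 2) z0 by apply: near; rewrite subrr cmod0.
have dN2 := @contour_deriv F _ _ _ 2%N hF s0 r1 in0 isT.
have dk2 := @contour_deriv _ _ _ _ 2%N h1 s0 r1 in0 isT.
have di := has_derivV (kn0 _ in0) (dk _ in0).
eexists; apply: (@has_deriv_eq _ (fun z => N 2%N z * (k 1%N z)^-1 +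
    N 1%N z * ((-1) * k 2%N z * ((k 1%N z)^-1 * (k 1%N z)^-1))) _ _ _ (s / 2)) => //.
  by move=> w wd; rewrite dF// mulN1r.
apply: has_derivD; first exact: has_derivM dN2 di.
apply: has_derivM; first exact: dN.
apply: has_derivM; last exact: (has_derivM di di).
by apply: has_derivM; [exact: has_deriv_cst|exact: dk2].
Qed.

End CauchyFormula.

(** * Sub-mean value property of |F|^p *)

Section PlaneMeasure.
Variable R : realType.
Local Notation C := (Cplx R).
Local Notation leb := (@lebesgue_measure R).
Local Notation leb2 := (leb \x leb)%E.
Implicit Types (w : R * R) (z : C) (r s : R).

Definition pt w : C := Complex w.1 w.2.

Definition dset : set (R * R) := [set w | disc (pt w)].

(** A product of intervals has constant slices, which lets Fubini relate edge integrals to area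
    integrals. *)
Definition sq z r : set (R * R) :=
  `[complex.Re z - r, complex.Re z + r] `*` `[complex.Im z - r, complex.Im z + r].

Lemma sqP z r w : sq z r w <-> sqin z r (pt w).
Proof.
by rewrite /sq /sqin /= !in_itv/= ReB ImB /= !ler_distl.
Qed.

Lemma measurable_sq z r : measurable (sq z r).
Proof. exact: measurableX. Qed.

(** An open set is the union of the countably many rational boxes contained in it. *)
Lemma box_open_measurable (A : set (R * R)) :
  (forall w, A w -> exists2 d, 0 < d & forall w', `|w'.1 - w.1| < d ->
     `|w'.2 - w.2| < d -> A w') -> measurable A.
Proof.
move=> oA; pose B (q : rat * rat * rat) : set (R * R) :=
  `]ratr q.1.1 - ratr q.2, ratr q.1.1 + ratr q.2[ `*` `]ratr q.1.2 - ratr q.2, ratr q.1.2 + ratr q.2[.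
have -> : A = \bigcup_q [set w | B q w /\ B q `<=` A].
  apply/seteqP; split => [w Aw|w [q _ [/[swap]]]]; last exact.
  have [d d0 dA] := oA w Aw.
  have /rat_in_itvoo[e] : d / 4 < d / 2 by lra.
  rewrite in_itv/= => /andP[e1 e2].
  have /rat_in_itvoo[x] : w.1 - ratr e < w.1 + ratr e by lra.
  rewrite in_itv/= => /andP[x1 x2].
  have /rat_in_itvoo[y] : w.2 - ratr e < w.2 + ratr e by lra.
  rewrite in_itv/= => /andP[y1 y2].
  exists (x, y, e) => //; split.
    by rewrite /B /=; split; rewrite /= in_itv/=; apply/andP; split; lra.
  move=> -[u v] [] /=; rewrite !in_itv/= => /andP[u1 u2] /andP[v1 v2].
  by apply: dA; rewrite ltr_norml /=; apply/andP; split; lra.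
apply: countable_bigcupT_measurable; first exact: countableP.
move=> q; have [h|h] := pselect (B q `<=` A).
  by rewrite (_ : [set w | _] = B q); [exact: measurableX|apply/seteqP; split=> w //= []].
by rewrite (_ : [set w | _] = set0)//; apply/seteqP; split=> w //= [].
Qed.

(** The hypothesis makes D open along with f continuous, so preimages of open intervals are open in
    the plane. *)
Lemma box_continuous_measurable (D : set (R * R)) (f : R * R -> R) :
  (forall w, D w -> forall e, 0 < e -> exists2 d, 0 < d & forall w', `|w'.1 - w.1| < d ->
     `|w'.2 - w.2| < d -> D w' /\ `|f w' - f w| < e) -> measurable_fun D f.
Proof.
move=> H; apply: (measurability _ (RGenOpens.measurableE R)) => _ [_ [a [b ->]] <-].
apply: box_open_measurable => w [Dw] /=; rewrite in_itv/= => /andP[aw wb].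
have [|d d0 dP] := H w Dw (Num.min (f w - a) (b - f w)).
  by rewrite lt_min !subr_gt0 aw.
exists d => // w' h1 h2; have [Dw' ] := dP w' h1 h2.
rewrite lt_min ltr_norml ltr_norml => /andP[/andP[? ?] /andP[? ?]].
by split=> //=; rewrite in_itv/=; apply/andP; split; lra.
Qed.

Lemma cmod_pt_le (z : C) w : cmod (pt w - z) <= `|w.1 - complex.Re z| + `|w.2 - complex.Im z|.
Proof. by apply: le_trans (cmod_leReIm _) _; rewrite ReB ImB. Qed.

Lemma dset_open w : dset w -> exists2 d, 0 < d & forall w', `|w'.1 - w.1| < d ->
     `|w'.2 - w.2| < d -> dset w'.
Proof.
rewrite /dset /disc /= => w1; exists ((1 - cmod (pt w)) / 2); first by rewrite divr_gt0// subr_gt0.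
move=> w' h1 h2; have := cmod_pt_le (pt w) w'.
by have := ler_cmodB (pt w') (pt w); rewrite /=; lra.
Qed.

Lemma measurable_dset : measurable dset.
Proof. exact: box_open_measurable dset_open. Qed.

Lemma contc_measurable (f : C -> C) : (forall z, cmod z < 1 -> contc f z) ->
  measurable_fun dset (fun w => cmod (f (pt w))).
Proof.
move=> cf; apply: box_continuous_measurable => w Dw e e0.
have [d1 d10 d1P] := dset_open Dw; have [d d0 dP] := cf _ Dw e e0.
exists (Num.min d1 (d / 2)); first by rewrite lt_min d10 divr_gt0.
move=> w'; rewrite !lt_min => /andP[a1 a2] /andP[b1 b2]; split; first exact: d1P.
have : cmod (f (pt w') - f (pt w)) < e.
  by apply: dP; apply: le_lt_trans (cmod_pt_le _ _) _; rewrite /=; lra.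
by apply: le_lt_trans; rewrite ler_norml ler_cmodB andbT lerNl opprB cmodBC ler_cmodB.
Qed.

Lemma holo_contc (F : C -> C) z : holo F -> cmod z < 1 -> contc F z.
Proof. by move=> hF /hF[l]; exact: has_deriv_contc. Qed.

Lemma holo_measurable (F : C -> C) : holo F -> measurable_fun dset (fun w => cmod (F (pt w))).
Proof. by move=> hF; apply: contc_measurable => z z1; exact: holo_contc. Qed.

Lemma measurable_pt_cmod : measurable_fun setT (fun w => cmod (pt w)).
Proof.
apply: box_continuous_measurable => w _ e e0; exists (e / 2); first by rewrite divr_gt0.
move=> w' h1 h2; split=> //; have := cmod_pt_le (pt w) w' => /=.
have : `|cmod (pt w') - cmod (pt w)| <= cmod (pt w' - pt w).
  by rewrite ler_norml ler_cmodB andbT lerNl opprB cmodBC ler_cmodB.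
lra.
Qed.

Definition refl (c x : R) : measurableTypeR R := c - x.

Lemma measurable_refl (c : R) : measurable_fun setT (refl c).
Proof. by apply: measurable_funB => //; exact: measurable_cst. Qed.

(** Uniqueness of Lebesgue measure: the preimage of a half-open interval under the reflection is a
    half-open interval of the same length. *)
Lemma leb_refl (c : R) (A : set R) : measurable A -> pushforward leb (refl c) A = leb A.
Proof.
move=> mA; apply/esym/lebesgue_measure_unique => //=; first exact: measurable_refl.
move=> mr _ [[a b] _ <-]; rewrite /pushforward /=.
have -> : refl c @^-1` `]a, b]%classic = `[c - b, c - a[%classic.
  apply/seteqP; split => x /=; rewrite !in_itv/= /refl => /andP[h1 h2];
    apply/andP; split; lra.
rewrite !lebesgue_measure_itv/= !lte_fin.
have -> : (c - b < c - a) = (a < b) by rewrite ltrD2l ltrN2.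
by case: ifPn => // _; rewrite -!EFinB; congr EFin; ring.
Qed.

Lemma integral_refl (c : R) (f : R -> \bar R) : measurable_fun setT f ->
  (forall x, (0 <= f x)%E) -> (\int[leb]_x f (c - x)%R = \int[leb]_x f x)%E.
Proof.
move=> mf f0.
have := @ge0_integral_pushforward _ _ (measurableTypeR R) (measurableTypeR R) R (refl c)
  (measurable_refl c) leb setT f measurableT mf (fun x _ => f0 x).
rewrite preimage_setT => <-.
apply: eq_measure_integral => [|mr A mA _]; [exact: measurable_refl|exact: leb_refl].
Qed.

(** A translation is the composition of the reflections x -> - x and x -> c - x. *)
Lemma integral_shift (c : R) (f : R -> \bar R) : measurable_fun setT f ->
  (forall x, (0 <= f x)%E) -> (\int[leb]_x f (c + x)%R = \int[leb]_x f x)%E.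
Proof.
move=> mf f0; rewrite -(@integral_refl c f)// -(@integral_refl 0 (fun x => f (c - x)))//.
- by apply: eq_integral => x _; rewrite sub0r opprK.
- by apply: measurableT_comp => //; exact: measurable_refl.
Qed.

End PlaneMeasure.

(** * Mean value inequality for |F| on squares *)

Section SubMeanValue.
Variable R : realType.
Local Notation C := (Cplx R).
Local Notation leb := (@lebesgue_measure R).
Local Notation leb2 := (leb \x leb)%E.
Implicit Types (z a b : C) (r s : R) (F : C -> C).

Lemma sq_dset z r : cmod z + 2 * r < 1 -> sq z r `<=` @dset R.
Proof.
move=> r1 w /sqP[h1 h2]; rewrite /dset /disc /=.
have -> : pt w = z + (pt w - z) by rewrite addrC subrK.
apply: le_lt_trans (cmodD _ _) _; apply: le_lt_trans r1; rewrite lerD2l.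
by apply: le_trans (cmod_leReIm _) _; lra.
Qed.

Lemma seg_corner_Re z s i j i' j' t : complex.Re (seg (corner z s i j) (corner z s i' j') t)
  = complex.Re z + (i + t * (i' - i)) * s.
Proof. by rewrite /seg ReD ReM ReB ImB /corner !ReD !ImD /=; ring. Qed.

Lemma seg_corner_Im z s i j i' j' t : complex.Im (seg (corner z s i j) (corner z s i' j') t)
  = complex.Im z + (j + t * (j' - j)) * s.
Proof. by rewrite /seg ImD ImM ReB ImB /corner !ReD !ImD /=; ring. Qed.

(** The constant 4 is the product of 2 s for the length, 1 / s for the kernel and 2 from
    [cint_le]. *)
Lemma J_kern_le F z a b s : 0 < s -> segc F a b -> segc (fun w => F w * kern z w) a b ->
  (forall t, 0 <= t <= 1 -> s <= cmod (seg a b t - z)) -> cmod (b - a) <= 2 * s ->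
  cmod (J (fun w => F w * kern z w) a b) <= 4 * \int[leb]_(t in `[0, 1]) cmod (F (seg a b t)).
Proof.
move=> s0 sF sFk sd ba; rewrite /J cmodM.
have pF := seg_pathc sF; have pk := seg_pathc sFk.
apply: le_trans (ler_pM (cmod_ge0 _) (cmod_ge0 _) ba (cint_le pk)) _.
set I := (X in _ <= _ * X).
suff H : \int[leb]_(t in `[0, 1]) cmod (F (seg a b t) * kern z (seg a b t)) <= s^-1 * I.
  rewrite mulrA [X in _ <= X](_ : _ = 2 * s * 2 * (s^-1 * I)); last by field; exact: lt0r_neq0.
  by rewrite ler_wpM2l// !mulr_ge0// ltW.
rewrite /I -RintegralZl//; last by apply: integrable_cont => t; exact: pathc_cmod.
apply: le_Rintegral => //.
- by apply: integrable_cont => t; exact: pathc_cmod.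
- apply: integrable_cont => t t01; apply: (@continuousM _ _ (cst s^-1)); first exact: cst_continuous.
  exact: pathc_cmod.
- move=> t; rewrite /= in_itv/= => t01; rewrite cmodM mulrC ler_wpM2r ?cmod_ge0//.
  by rewrite /kern cmodV lef_pV2 ?posrE ?sd//; apply: lt_le_trans (sd _ t01).
Qed.

Definition edge_mean F a b : R := \int[leb]_(t in `[0, 1]) cmod (F (seg a b t)).

(** By Cauchy's formula and [kern_contour_Im], |F(z)| / 2 is at most the modulus of the contour
    integral, and each edge costs at most 4 times its mean, whence 8. *)
Lemma contour_lower F z s : holo F -> 0 < s -> cmod z + 2 * s < 1 ->
    cmod (F z) <= 8 * (edge_mean F (corner z s (-1) (-1)) (corner z s 1 (-1)) +
     edge_mean F (corner z s 1 (-1)) (corner z s 1 1) +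
     edge_mean F (corner z s 1 1) (corner z s (-1) 1) +
     edge_mean F (corner z s (-1) 1) (corner z s (-1) (-1))).
Proof.
move=> hF s0 r1; pose I := edge_mean F.
have zin : sqin z (s / 2) z.
  by rewrite /sqin subrr !normr0; split; rewrite divr_ge0// ltW.
have := cauchy_formula hF s0 r1 zin.
have /= K := kern_contour_Im s0 r1 zin.
have K2 : 2^-1 <= cmod (contour (kern z) z s).
  by apply: le_trans K _; apply: le_trans (ler_norm _) _; exact: Im_le_cmod.
move=> /(congr1 (@cmod R)); rewrite cmodM => E.
have [E1 E2 E3 E4] := corners_ok s0 zin.
have sk a b : edge_ok (cmod z + 2 * s) z a b -> segc (fun w => F w * kern z w) a b.
  move=> ok; have := @edge_segc _ _ _ _ _ F 1%N r1 ok hF.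
  by rewrite (_ : (fun w => F w * _ ^+ 1) = (fun w => F w * kern z w))//; apply/funext => w; rewrite expr1.
have c1 i j : `|i| <= 1 -> `|j| <= 1 -> cmod (corner z s i j) < 1.
  by move=> i1 j1; apply: le_lt_trans r1; apply: cmod_corner => //; exact: ltW.
have sF i j i' j' : `|i| <= 1 -> `|j| <= 1 -> `|i'| <= 1 -> `|j'| <= 1 ->
   segc F (corner z s i j) (corner z s i' j').
  by move=> *; apply: segc_holo => //; exact: c1.
have n1 : `|-1| <= 1 :> R by rewrite normrN normr1.
have p1 : `|1| <= 1 :> R by rewrite normr1.
have edge i j i' j' : `|i| <= 1 -> `|j| <= 1 -> `|i'| <= 1 -> `|j'| <= 1 ->
   edge_ok (cmod z + 2 * s) z (corner z s i j) (corner z s i' j') ->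
   (i = i' /\ `|i| = 1 /\ `|j' - j| <= 2) \/ (j = j' /\ `|j| = 1 /\ `|i' - i| <= 2) ->
   cmod (J (fun w => F w * kern z w) (corner z s i j) (corner z s i' j')) <=
   4 * I (corner z s i j) (corner z s i' j').
  move=> i1 j1 i'1 j'1 ok H; apply: (J_kern_le s0 (sF _ _ _ _ i1 j1 i'1 j'1) (sk _ _ ok)).
  - move=> t t01; case: H => -[<- [ii _]].
    + apply: le_trans (Re_le_cmod _); rewrite ReB seg_corner_Re subrr mulr0 addr0 addrC addKr.
      by rewrite normrM ii mul1r ger0_norm// ltW.
    + apply: le_trans (Im_le_cmod _); rewrite ImB seg_corner_Im subrr mulr0 addr0 addrC addKr.
      by rewrite normrM ii mul1r ger0_norm// ltW.
  - apply: le_trans (cmod_leReIm _) _; rewrite ReB ImB /corner !ReD !ImD /=.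
    rewrite [_ - _](_ : _ = (i' - i) * s); last by ring.
    rewrite [X in _ + `|X|](_ : _ = (j' - j) * s); last by ring.
    rewrite !normrM (ger0_norm (ltW s0)).
    by case: H => -[<- [_]]; rewrite subrr normr0 mul0r ?add0r ?addr0 => h; rewrite ler_pM2r.
have n2 : `|1 - (-1)| <= 2 :> R by rewrite opprK ger0_norm.
have n3 : `|-1 - 1| <= 2 :> R by rewrite -opprD normrN ger0_norm.
have F1 := edge _ _ _ _ n1 n1 p1 n1 E1 (or_intror (conj erefl (conj _ n2))).
have F2 := edge _ _ _ _ p1 n1 p1 p1 E2 (or_introl (conj erefl (conj (normr1 _) n2))).
have F3 := edge _ _ _ _ p1 p1 n1 p1 E3 (or_intror (conj erefl (conj (normr1 _) n3))).
have F4 := edge _ _ _ _ n1 p1 n1 n1 E4 (or_introl (conj erefl (conj _ n3))).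
move: F1 F4; rewrite normrN normr1 => /(_ erefl) F1 /(_ erefl) F4.
have : cmod (F z) * 2^-1 <= cmod (contour (fun w => F w * kern z w) z s).
  by rewrite E ler_wpM2l ?cmod_ge0.
rewrite /contour => H0.
have H1 := cmodD.
have : cmod (contour (fun w => F w * kern z w) z s) <= 4 * I (corner z s (-1) (-1)) (corner z s 1 (-1)) +
     4 * I (corner z s 1 (-1)) (corner z s 1 1) +
     4 * I (corner z s 1 1) (corner z s (-1) 1) +
     4 * I (corner z s (-1) 1) (corner z s (-1) (-1)).
  apply: le_trans (cmodD _ _) _; apply: lerD => //.
  apply: le_trans (cmodD _ _) _; apply: lerD => //.
  by apply: le_trans (cmodD _ _) _; apply: lerD.
rewrite /contour; rewrite -/I; move: (cmod (_ + _)) H0 => y; move: (cmod (F z)) => c.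
do 4!(move: (I _ _) => ?); clear; lra.
Qed.

Lemma shrink_itv (c s r : R) : 0 < s -> s <= r ->
  c - r <= c - s <= c + r /\ c - r <= c + s <= c + r.
Proof. by move=> s0 sr; split; apply/andP; split; lra. Qed.

Lemma shrink_conv (c s r t : R) : 0 < s -> s <= r -> 0 <= t <= 1 ->
  c - r <= 2 * s * t + (c - s) <= c + r.
Proof. by move=> s0 sr /andP[t0 t1]; apply/andP; split; nra. Qed.

Section Mean.
Variables (F : C -> C) (z : C) (r : R).
Hypotheses (hF : holo F) (r0 : 0 < r) (r1 : cmod z + 2 * r < 1).

Let phi : R * R -> \bar R := (fun w => (cmod (F (pt w)))%:E) \_ (sq z r).

Let mphi : measurable_fun setT phi.
Proof.
apply: (measurable_restrictT _ (@measurable_sq R z r)).1.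
apply/measurable_EFinP; apply: (measurable_funS (@measurable_dset R)); last exact: holo_measurable.
exact: sq_dset.
Qed.

Let phi0 w : (0 <= phi w)%E.
Proof. by rewrite /phi /patch; case: ifP => // _; rewrite lee_fin cmod_ge0. Qed.

Let H y := (\int[leb]_x phi (x, y))%E.
Let V x := (\int[leb]_y phi (x, y))%E.
Let A := (\int[leb2]_(w in sq z r) (cmod (F (pt w)))%:E)%E.

Let mH : measurable_fun setT H.
Proof. exact: (@measurable_fun_fubini_tonelli_G _ _ _ _ R leb phi mphi phi0). Qed.
Let mV : measurable_fun setT V.
Proof. exact: (@measurable_fun_fubini_tonelli_F _ _ _ _ R leb phi mphi phi0). Qed.
Let H0 y : (0 <= H y)%E. Proof. exact: integral_ge0. Qed.
Let V0 y : (0 <= V y)%E. Proof. exact: integral_ge0. Qed.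
Let AV : A = (\int[leb]_x V x)%E.
Proof. by rewrite /A integral_mkcond fubini_tonelli1. Qed.
Let AH : A = (\int[leb]_y H y)%E.
Proof. by rewrite AV; exact: fubini_tonelli. Qed.

(** Turns the integrals over [0, 1] that occur in [edge_mean] into parts of slice integrals of the
    area measure. *)
Let line_le (G : R -> R) (f : R -> \bar R) (c s : R) : 0 < s ->
  (forall t, c - s <= t <= c + s -> {for t, continuous G}) ->
  measurable_fun setT f -> (forall x, (0 <= f x)%E) ->
  (forall t, c - s <= t <= c + s -> f t = (G t)%:E) ->
  ((2 * s * \int[leb]_(t in `[0, 1]) G (2 * s * t + (c - s)))%:E <= \int[leb]_x f x)%E.
Proof.
move=> s0 cG mf f0 fG.
have e1 : 2 * s * 0 + (c - s) = c - s by ring.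
have e2 : 2 * s * 1 + (c - s) = c + s by ring.
have := @Rint_affine _ G (2 * s) (c - s) 0 1 (mulr_gt0 (ltr0n _ 2) s0) ler01.
rewrite e1 e2 => <-//.
rewrite /Rintegral fineK; last by apply: integrable_fin_num => //; exact: integrable_cont.
apply: le_trans (ge0_subset_integral leb (measurable_itv `[c - s, c + s]) measurableT mf _ _) => //.
rewrite le_eqVlt; apply/orP; left; apply/eqP/eq_integral => t.
by rewrite inE/= in_itv/= => /fG ->.
Qed.

Let cF t u : sqin z r (Complex t u) -> contc F (Complex t u).
Proof.
move=> h; apply: holo_contc => //.
by have := @sq_dset z r r1 (t, u) ((sqP z r (t, u)).2 h).
Qed.

Let phiE t u : sqin z r (Complex t u) -> phi (t, u) = (cmod (F (Complex t u)))%:E.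
Proof. by move=> h; rewrite /phi patchE mem_set//; apply/sqP. Qed.

Let contx t u : sqin z r (Complex t u) -> {for t, continuous (fun t => cmod (F (Complex t u)))}.
Proof.
move=> h; apply/real_contP => e e0; have [d d0 dP] := cF h e0.
exists d => // s' sd; apply: le_lt_trans (dP (Complex s' u) _).
  by rewrite ler_norml ler_cmodB andbT lerNl opprB cmodBC ler_cmodB.
by apply: le_lt_trans (cmod_leReIm _) _; rewrite ReB ImB /= subrr normr0 addr0.
Qed.

Let conty t u : sqin z r (Complex t u) -> {for u, continuous (fun u => cmod (F (Complex t u)))}.
Proof.
move=> h; apply/real_contP => e e0; have [d d0 dP] := cF h e0.
exists d => // s' sd; apply: le_lt_trans (dP (Complex t s') _).
  by rewrite ler_norml ler_cmodB andbT lerNl opprB cmodBC ler_cmodB.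
by apply: le_lt_trans (cmod_leReIm _) _; rewrite ReB ImB /= subrr normr0 add0r.
Qed.

Let x0 := complex.Re z.
Let y0 := complex.Im z.

Let sqinE t u : sqin z r (Complex t u) <-> (x0 - r <= t <= x0 + r /\ y0 - r <= u <= y0 + r).
Proof. by rewrite /sqin ReB ImB /= !ler_distl. Qed.

Let Hle s y : 0 < s <= r -> y0 - r <= y <= y0 + r ->
  ((2 * s * \int[leb]_(t in `[0, 1]) cmod (F (Complex (2 * s * t + (x0 - s)) y)))%:E <= H y)%E.
Proof.
move=> /andP[s0 sr] yr.
apply: (@line_le (fun t => cmod (F (Complex t y))) (fun x => phi (x, y)) x0 s s0) => //.
- by move=> t /andP[t1 t2]; apply: contx; apply/sqinE; split=> //; apply/andP; split; lra.
- exact: (measurableT_comp mphi).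
- by move=> t /andP[t1 t2]; rewrite phiE//; apply/sqinE; split=> //; apply/andP; split; lra.
Qed.

Let Vle s x : 0 < s <= r -> x0 - r <= x <= x0 + r ->
  ((2 * s * \int[leb]_(t in `[0, 1]) cmod (F (Complex x (2 * s * t + (y0 - s)))))%:E <= V x)%E.
Proof.
move=> /andP[s0 sr] xr.
apply: (@line_le (fun t => cmod (F (Complex x t))) (fun y => phi (x, y)) y0 s s0) => //.
- by move=> t /andP[t1 t2]; apply: conty; apply/sqinE; split=> //; apply/andP; split; lra.
- exact: (measurableT_comp mphi).
- by move=> t /andP[t1 t2]; rewrite phiE//; apply/sqinE; split=> //; apply/andP; split; lra.
Qed.

(** The edges of the square of half-side s lie on the four lines parallel to the axes at distance s
    from z; extending an edge to the whole slice only increases the integral. *)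
Lemma square_lower s : 0 < s <= r ->
  ((s * cmod (F z))%:E <= 4%:E * (H (y0 - s) + V (x0 + s)%R + H (y0 + s)%R + V (x0 - s)%R))%E.
Proof.
move=> sr; have /andP[s0 sr'] := sr.
have r1s : cmod z + 2 * s < 1 by apply: le_lt_trans r1; rewrite lerD2l ler_pM2l.
have L := contour_lower hF s0 r1s.
have segE i j i' j' t : seg (corner z s i j) (corner z s i' j') t =
   Complex (x0 + (i + t * (i' - i)) * s) (y0 + (j + t * (j' - j)) * s).
  by apply: ReIm_inj; rewrite ?seg_corner_Re ?seg_corner_Im.
have rg := shrink_itv y0 s0 sr'; have rgx := shrink_itv x0 s0 sr'.
pose h y := \int[leb]_(t in `[0, 1]) cmod (F (Complex (2 * s * t + (x0 - s)) y)).
pose v x := \int[leb]_(t in `[0, 1]) cmod (F (Complex x (2 * s * t + (y0 - s)))).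
have e1 : edge_mean F (corner z s (-1) (-1)) (corner z s 1 (-1)) = h (y0 - s).
  apply: eq_Rintegral => t _; rewrite segE; congr (cmod (F (Complex _ _))); ring.
have e2 : edge_mean F (corner z s 1 (-1)) (corner z s 1 1) = v (x0 + s).
  apply: eq_Rintegral => t _; rewrite segE; congr (cmod (F (Complex _ _))); ring.
have in01 t := @shrink_conv x0 s r t s0 sr'; have in01y t := @shrink_conv y0 s r t s0 sr'.
have caff (c x : R) : {for x, continuous (fun t : R => 2 * s * t + c)}.
  apply: continuousD; last exact: cst_continuous.
  by apply: continuousM; [exact: cst_continuous|exact: cvg_id].
(* The upper and the left edge run backwards, so their parametrizations agree with [h] and [v] only
   after t -> 1 - t. *)
have e3 : edge_mean F (corner z s 1 1) (corner z s (-1) 1) = h (y0 + s).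
  rewrite /h -Rint_rev; last first.
    move=> t t01; apply: (@continuous_comp _ _ _ (fun t : R => 2 * s * t + (x0 - s))
      (fun x => cmod (F (Complex x (y0 + s))))); first exact: caff.
    by apply: contx; apply/sqinE; split; [exact: in01|case: rg].
  apply: eq_Rintegral => t _; rewrite segE; congr (cmod (F (Complex _ _))); ring.
have e4 : edge_mean F (corner z s (-1) 1) (corner z s (-1) (-1)) = v (x0 - s).
  rewrite /v -Rint_rev; last first.
    move=> t t01; apply: (@continuous_comp _ _ _ (fun t : R => 2 * s * t + (y0 - s))
      (fun y => cmod (F (Complex (x0 - s) y)))); first exact: caff.
    by apply: conty; apply/sqinE; split; [case: rgx|exact: in01y].
  apply: eq_Rintegral => t _; rewrite segE; congr (cmod (F (Complex _ _))); ring.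
move: L; rewrite e1 e2 e3 e4 => L.
apply: (@le_trans _ _ (4%:E * ((2 * s * h (y0 - s)%R)%:E + (2 * s * v (x0 + s)%R)%:E +
    (2 * s * h (y0 + s)%R)%:E + (2 * s * v (x0 - s)%R)%:E))%E).
  rewrite -!EFinD -EFinM lee_fin.
  have -> : 4 * (2 * s * h (y0 - s) + 2 * s * v (x0 + s) + 2 * s * h (y0 + s) + 2 * s * v (x0 - s))
    = s * (8 * (h (y0 - s) + v (x0 + s) + h (y0 + s) + v (x0 - s))) by ring.
  by rewrite ler_pM2l.
rewrite lee_pmul2l//; case: rg => rg1 rg2; case: rgx => rgx1 rgx2.
by repeat apply: leeD; [exact: Hle|exact: Vle|exact: Hle|exact: Vle].
Qed.

(** [square_lower] is integrated over s in [r/2, r]. Over the whole line in s each of the four terms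
    integrates to A, after a reflection or a translation; hence (r/2)(r/2)|F(z)| <= 16 A. *)
Lemma mean_value_sq : ((r ^+ 2 * cmod (F z))%:E <= 64%:E * A)%E.
Proof.
have A0 : (0 <= A)%E by apply: integral_ge0 => w _; rewrite lee_fin cmod_ge0.
pose G s := (4%:E * (H (y0 - s) + V (x0 + s)%R + H (y0 + s)%R + V (x0 - s)%R))%E.
have mrefl (c : R) : measurable_fun setT (fun s : R => c - s).
  by apply: measurable_funB => //; exact: measurable_cst.
have mshift (c : R) : measurable_fun setT (fun s : R => c + s).
  by apply: measurable_funD => //; exact: measurable_cst.
have m1 : measurable_fun setT (fun s => H (y0 - s)) by exact: (measurableT_comp mH).
have m2 : measurable_fun setT (fun s => V (x0 + s)) by exact: (measurableT_comp mV).
have m3 : measurable_fun setT (fun s => H (y0 + s)) by exact: (measurableT_comp mH).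
have m4 : measurable_fun setT (fun s => V (x0 - s)) by exact: (measurableT_comp mV).
have m12 := emeasurable_funD m1 m2.
have m123 := emeasurable_funD m12 m3.
have m1234 := emeasurable_funD m123 m4.
have n2 s : (0 <= H (y0 - s) + V (x0 + s)%R)%E := adde_ge0 (H0 _) (V0 _).
have n3 s : (0 <= H (y0 - s) + V (x0 + s)%R + H (y0 + s)%R)%E := adde_ge0 (n2 s) (H0 _).
have n4 s : (0 <= H (y0 - s) + V (x0 + s)%R + H (y0 + s)%R + V (x0 - s)%R)%E :=
  adde_ge0 (n3 s) (V0 _).
have GA : (\int[leb]_s G s = 4%:E * (A + A + A + A))%E.
  rewrite ge0_integralZl//.
  rewrite ge0_integralD//.
  rewrite ge0_integralD//.
  rewrite ge0_integralD//.
  by rewrite !integral_refl// !integral_shift// -AH -AV.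
have mG : measurable_fun setT G by exact: measurable_funeM.
have : (\int[leb]_(s in `[(r / 2)%R, r]) (r / 2 * cmod (F z))%:E <= \int[leb]_s G s)%E.
  apply: le_trans (ge0_subset_integral leb (measurable_itv `[(r / 2)%R, r]) measurableT mG _ _) => //; last first.
    by move=> s _; exact: (mule_ge0 _ (n4 s)).
  apply: ge0_le_integral => //.
  - by move=> s _; rewrite lee_fin mulr_ge0 ?cmod_ge0// divr_ge0// ltW.
  - exact: measurable_funS mG.
  - move=> s; rewrite /= in_itv/= => /andP[s1 s2].
    apply: le_trans (square_lower _); last by rewrite s2 andbT (lt_le_trans _ s1)// divr_gt0.
    by rewrite lee_fin ler_wpM2r ?cmod_ge0.
rewrite GA integral_cst//= lebesgue_measure_itv/= lte_fin.
have -> : r / 2 < r by have := r0; lra.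
rewrite -EFinB -EFinM => h; case: A A0 h => [a|_ _|]; last by [].
- rewrite lee_fin => a0; rewrite -!EFinD -!EFinM !lee_fin => h.
  have : r / 2 * cmod (F z) * (r - r / 2) = r ^+ 2 * cmod (F z) / 4 by field.
  by lra.
- by rewrite gt0_muley// leey.
Qed.

End Mean.
End SubMeanValue.

(** * From |F| to |F|^p *)

Section SubMeanPower.
Variable R : realType.
Local Notation C := (Cplx R).
Local Notation leb := (@lebesgue_measure R).
Local Notation leb2 := (leb \x leb)%E.
Implicit Types (z a b : C) (r s p : R) (F : C -> C).

(** Compactness of the closed square in filter form. The filter is arbitrary: the filter at infinity
    gives bounds, an ultrafilter gives uniform convergence. *)
Lemma sq_near (I : Type) (Fl : set_system I) z r (P : I -> C -> Prop) : Filter Fl ->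
  (forall w, sqin z r w -> exists2 d, 0 < d &
     Fl [set i | forall w', cmod (w' - w) < d -> P i w']) ->
  Fl [set i | forall w, sqin z r w -> P i w].
Proof.
move=> FF H.
have cK : compact (sq z r).
  by apply: compact_setX; exact: segment_compact.
move/compact_near_coveringP : cK => /(_ I Fl (fun i w => P i (pt w)) FF) K.
have : \forall i \near Fl, sq z r `<=` (fun w => P i (pt w)).
  apply: K => x /sqP xK; have [d d0 dP] := H _ xK.
  have d2 : 0 < d / 2 by rewrite divr_gt0.
  exists (ball x (d / 2), [set i | forall w', cmod (w' - pt x) < d -> P i w']) => /=.
    by split=> //; exact: nbhsx_ballx.
  move=> [x' i] /= [[b1 b2] h]; apply: h.
  apply: le_lt_trans (cmod_pt_le _ _) _ => /=.
  move: b1 b2; rewrite /ball/= distrC (distrC x.2); lra.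
apply: filterS => i h w win; have -> : w = pt (complex.Re w, complex.Im w) by case: w {win}.
by apply: h; apply/sqP; case: w win.
Qed.

Lemma contc_bounded F z r : (forall w, sqin z r w -> contc F w) ->
  exists M, forall w, sqin z r w -> cmod (F w) <= M.
Proof.
move=> H; suff [n nP] : exists n : nat, forall w, sqin z r w -> cmod (F w) <= n%:R.
  by exists n%:R.
have := @sq_near nat \oo z r (fun n w => cmod (F w) <= n%:R) _.
case=> [w wK|N _ /(_ N (leqnn N)) h]; last by exists N.
have [d d0 dP] := H _ wK _ ltr01; exists d => //.
have [m mP] : exists m : nat, cmod (F w) + 1 <= m%:R.
  by exists (Num.truncn (cmod (F w) + 1)).+1; apply/ltW; exact: truncnS_gt.
exists m => // n /= mn w' /dP h.
have : F w' = (F w' - F w) + F w by rewrite subrK.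
move=> ->; apply: le_trans (cmodD _ _) _.
have : m%:R <= n%:R :> R by rewrite ler_nat.
lra.
Qed.

Lemma sqin_disc z r w : cmod z + 2 * r < 1 -> sqin z r w -> cmod w < 1.
Proof.
by move=> r1; case: w => a b h; exact: (@sq_dset R z r r1 (a, b) ((sqP z r (a, b)).2 h)).
Qed.

Lemma lepow p (x y : R) : 0 <= p -> 0 <= x -> x <= y -> x `^ p <= y `^ p.
Proof. by move=> p0 x0 xy; apply: ge0_ler_powR => //; rewrite nnegrE// (le_trans x0). Qed.

Definition sq_int p F z r : \bar R :=
  (\int[leb2]_(w in sq z r) ((cmod (F (pt w))) `^ p)%:E)%E.

Lemma sq_int_ge0 p F z r : (0 <= sq_int p F z r)%E.
Proof. by apply: integral_ge0 => w _; rewrite lee_fin powR_ge0. Qed.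

Lemma measurable_sq_pow p F z r : holo F -> sq z r `<=` @dset R ->
  measurable_fun (sq z r) (fun w => ((cmod (F (pt w))) `^ p)%:E).
Proof.
move=> hF sub; apply/measurable_EFinP.
apply: (@measurableT_comp _ _ _ _ _ _ (fun x : R => x `^ p)) => //.
exact: (measurable_funS (@measurable_dset R) sub (holo_measurable hF)).
Qed.

Lemma leb2_sq z r : 0 < r -> leb2 (sq z r) = (4 * r ^+ 2)%:E.
Proof.
move=> r0.
have E (x : R) : leb `[x - r, x + r]%classic = (2 * r)%:E.
  rewrite lebesgue_measure_itv/= lte_fin (_ : x - r < x + r); last lra.
  by rewrite -EFinB; congr EFin; ring.
transitivity (leb `[(complex.Re z - r)%R, (complex.Re z + r)%R]%classic *
   leb `[(complex.Im z - r)%R, (complex.Im z + r)%R]%classic)%E; first exact: product_measure1E.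
by rewrite !E -EFinM; congr EFin; ring.
Qed.

Lemma mean_value_pow : exists2 k0 : R, 0 < k0 & forall F z r, holo F -> 0 < r ->
  cmod z + 2 * r < 1 -> ((r ^+ 2 * cmod (F z))%:E <= k0%:E * sq_int 1 F z r)%E.
Proof.
exists 64 => [|F z r hF r0 r1]; first by rewrite ltr0n.
rewrite /sq_int; under eq_integral do rewrite powRr1 ?cmod_ge0//.
exact: mean_value_sq.
Qed.

Lemma powR_split (u q : R) : 0 < u -> u `^ (1 - q) * u `^ q = u.
Proof.
move=> u0; rewrite -powRD; first by rewrite subrK powRr1// ltW.
by rewrite (gt_eqF u0) implybT.
Qed.

Lemma powR_cancel (u q : R) : 0 < u -> u `^ (- q) * u `^ q = 1.
Proof. by move=> u0; rewrite powRN mulVf// gt_eqF// powR_gt0. Qed.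

(** In place of Jensen's inequality: u <= l + l^(1 - p) u^p for every u >= 0. At the level l =
    |F(z)| / (8 k0) the constant term amounts to half of the left side and is absorbed. *)
Lemma sub_mean_ge1 (k0 : R) p F z r : 0 < k0 ->
  (forall F z r, holo F -> 0 < r ->
  cmod z + 2 * r < 1 -> ((r ^+ 2 * cmod (F z))%:E <= k0%:E * sq_int 1 F z r)%E) ->
  1 <= p -> holo F -> 0 < r -> cmod z + 2 * r < 1 ->
  ((r ^+ 2 * cmod (F z) `^ p)%:E <= (2 * k0 * (8 * k0) `^ (p - 1))%:E * sq_int p F z r)%E.
Proof.
move=> k00 mean p1 hF r0 r1; set c := cmod (F z).
have [c0|c0] := eqVneq c 0.
  rewrite c0 powR0 ?mulr0; last by apply/eqP; lra.
  by apply: mule_ge0; [rewrite lee_fin !mulr_ge0 ?powR_ge0// ltW|exact: sq_int_ge0].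
have cp : 0 < c by rewrite lt_neqAle eq_sym c0 cmod_ge0.
pose l := c / (8 * k0); have k80 : 0 < 8 * k0 by rewrite mulr_gt0.
have l0 : 0 < l by rewrite divr_gt0.
have sub := @sq_dset _ z r r1.
have mp := measurable_sq_pow p hF sub; have m1 := measurable_sq_pow 1 hF sub.
have ptw u : 0 <= u -> u <= l + l `^ (1 - p) * u `^ p.
  move=> u0; have [ul|lu] := leP u l.
    by apply: (le_trans ul); rewrite lerDl mulr_ge0 ?powR_ge0.
  have up : 0 < u := lt_trans l0 lu.
  apply: (@le_trans _ _ (l `^ (1 - p) * u `^ p)); last by rewrite lerDr ltW.
  rewrite -{1}(powR_split p up) ler_wpM2r ?powR_ge0//.
  have -> : 1 - p = - (p - 1) by ring.
  rewrite !powRN lef_pV2 ?posrE ?powR_gt0//; apply: lepow; lra.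
have I1 : (sq_int 1 F z r <= (l * (4 * r ^+ 2))%:E + (l `^ (1 - p))%:E * sq_int p F z r)%E.
  have msq := @measurable_sq R z r.
  have p0 w : sq z r w -> (0 <= (cmod (F (pt w)) `^ p)%:E)%E by rewrite lee_fin powR_ge0.
  have lp0 : (0 <= (l `^ (1 - p))%:E)%E by rewrite lee_fin powR_ge0.
  have -> : (l * (4 * r ^+ 2))%:E = (\int[leb2]_(w in sq z r) l%:E)%E.
    by rewrite integral_cst// EFinM; congr (_ * _)%E; apply/esym; exact: leb2_sq.
  rewrite [X in (_ + X)%E](_ : _ = (\int[leb2]_(w in sq z r)
    ((l `^ (1 - p))%:E * (cmod (F (pt w)) `^ p)%:E))%E); last by rewrite ge0_integralZl.
  have mm : measurable_fun (sq z r) (fun w => ((l `^ (1 - p))%:E * (cmod (F (pt w)) `^ p)%:E)%E).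
    exact: measurable_funeM.
  have mm0 w : sq z r w -> (0 <= (l `^ (1 - p))%:E * (cmod (F (pt w)) `^ p)%:E)%E.
    by move=> win; apply: mule_ge0 => //; exact: p0.
  have l00 : (0 <= l%:E)%E by rewrite lee_fin ltW.
  rewrite -ge0_integralD//.
  apply: ge0_le_integral => //.
  - by move=> w _; rewrite lee_fin powR_ge0.
  - exact: emeasurable_funD.
  - by move=> w _; rewrite -EFinM -EFinD lee_fin powRr1 ?cmod_ge0//; apply/ptw/cmod_ge0.
have := le_trans (mean _ _ _ hF r0 r1) (lee_wpmul2l _ I1); rewrite lee_fin (ltW k00) -/c => /(_ isT).
have := sq_int_ge0 p F z r; case: (sq_int p F z r) => [A|_ _|]; last by [].
- rewrite lee_fin => A0 h0; have {h0}h : r ^+ 2 * c <= k0 * (l * (4 * r ^+ 2) + l `^ (1 - p) * A) by [].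
  rewrite -EFinM lee_fin.
  have h2 : r ^+ 2 * c <= 2 * k0 * l `^ (1 - p) * A.
    have e : k0 * (l * (4 * r ^+ 2)) = r ^+ 2 * c / 2.
      by rewrite /l; field; rewrite gt_eqF.
    by move: h; rewrite mulrDr e; lra.
  have e1 : l `^ (1 - p) = c `^ (1 - p) * (8 * k0) `^ (p - 1).
    rewrite /l powRM ?invr_ge0; [|exact: ltW cp|exact: ltW k80]; congr (_ * _).
    by rewrite -powR_inv1 ?(ltW k80)// -powRrM; congr (_ `^ _); ring.
  have e2 : c `^ p = c * c `^ (p - 1) by rewrite mulr_powRB1 ?(ltW cp)// (lt_le_trans ltr01).
  rewrite e2; have cp1 : 0 < c `^ (p - 1) by rewrite powR_gt0.
  have e3 : c `^ (1 - p) * c `^ (p - 1) = 1.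
    by rewrite (_ : 1 - p = - (p - 1)) ?powR_cancel//; ring.
  rewrite e1 in h2; rewrite mulrA; apply: le_trans (ler_wpM2r (ltW cp1) h2) _.
  rewrite le_eqVlt; apply/orP; left; apply/eqP.
  transitivity ((2 * k0) * (c `^ (1 - p) * c `^ (p - 1)) * (8 * k0) `^ (p - 1) * A); first by ring.
  by rewrite e3 mulr1.
- by rewrite gt0_muley ?leey// lte_fin !(mulr_gt0, powR_gt0).
Qed.

(* Take w0 nearly maximizing |F(w)|^p d(w)^2, with d the distance to the boundary of
   the square: near w0, |F|^(1-p) is at most a multiple of |F(w0)|^(1-p), which
   reduces the claim to p = 1. *)
Lemma sub_mean_lt1 (k0 : R) p F z r : 0 < k0 ->
  (forall F z r, holo F -> 0 < r ->
  cmod z + 2 * r < 1 -> ((r ^+ 2 * cmod (F z))%:E <= k0%:E * sq_int 1 F z r)%E) ->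
  0 < p < 1 -> holo F -> 0 < r -> cmod z + 2 * r < 1 ->
  ((r ^+ 2 * cmod (F z) `^ p)%:E <= (8 * k0 * 8 `^ ((1 - p) / p))%:E * sq_int p F z r)%E.
Proof.
move=> k00 mean /andP[p0 p1] hF r0 r1; set c := cmod (F z).
have [c0|c0] := eqVneq c 0.
  rewrite c0 powR0 ?mulr0; last by apply/eqP; lra.
  by apply: mule_ge0; [rewrite lee_fin !mulr_ge0 ?powR_ge0// ltW|exact: sq_int_ge0].
have cp : 0 < c by rewrite lt_neqAle eq_sym c0 cmod_ge0.
have sub := @sq_dset _ z r r1.
have [B BP] : exists B, forall w, sqin z r w -> cmod (F w) <= B.
  by apply: contc_bounded => w win; apply: holo_contc => //; exact: sqin_disc r1 win.
pose d w := r - Num.max `|complex.Re (w - z)| `|complex.Im (w - z)|.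
pose val w := cmod (F w) `^ p * d w ^+ 2.
pose T := [set val w | w in [set w | sqin z r w]].
have dr w : sqin z r w -> 0 <= d w <= r.
  move=> [h1 h2]; rewrite /d subr_ge0 ge_max h1 h2 /= lerBlDr lerDl le_max.
  by rewrite normr_ge0.
have zin : sqin z r z by rewrite /sqin subrr !normr0 ltW.
have dz : d z = r by rewrite /d subrr !normr0 maxxx subr0.
have ubT : has_ubound T.
  exists (B `^ p * r ^+ 2) => _ [w win <-]; have /andP[d0 d1] := dr _ win.
  apply: ler_pM; rewrite ?powR_ge0 ?exprn_ge0//.
    by apply: lepow; rewrite ?cmod_ge0 ?BP// ltW.
  by rewrite lerXn2r// nnegrE// ltW.
pose M := sup T.
have MT w : sqin z r w -> val w <= M by move=> win; apply: ub_le_sup => //; exists w.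
have M0 : 0 < M.
  apply: lt_le_trans (MT _ zin); rewrite /val dz mulr_gt0// ?powR_gt0// exprn_gt0//.
have [w0 w0in w0M] : exists2 w0, sqin z r w0 & M / 2 < val w0.
  have Tne : T !=set0 by exists (val z), z.
  have M2 : M / 2 < sup T by rewrite -/M; lra.
  by have [_ [w win <-] h] := sup_gt Tne M2; exists w.
have /andP[d0 dr0] := dr _ w0in.
have c0p : 0 < cmod (F w0) `^ p.
  rewrite lt_neqAle powR_ge0 andbT eq_sym; apply/eqP => h; move: w0M.
  by rewrite /val h mul0r; lra.
have dp : 0 < d w0.
  rewrite lt_neqAle d0 andbT eq_sym; apply/eqP => h; move: w0M.
  by rewrite /val h expr0n mulr0; lra.
have c0' : 0 < cmod (F w0) by apply: gt0_powR c0p => //; exact: cmod_ge0.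
pose t := d w0 / 2; have t0 : 0 < t by rewrite divr_gt0.
have maxD : `|complex.Re (w0 - z)| <= r - d w0 /\ `|complex.Im (w0 - z)| <= r - d w0.
  by rewrite /d subKr; split; rewrite le_max lexx ?orbT.
have subsq w : sqin w0 t w -> sqin z r w /\ d w0 / 2 <= d w.
  move=> [h1 h2]; case: maxD => m1 m2.
  have E1 : `|complex.Re (w - z)| <= r - d w0 / 2.
    have -> : w - z = (w - w0) + (w0 - z) by ring.
    by rewrite ReD; apply: le_trans (ler_normD _ _) _; move: h1; rewrite /t; lra.
  have E2 : `|complex.Im (w - z)| <= r - d w0 / 2.
    have -> : w - z = (w - w0) + (w0 - z) by ring.
    by rewrite ImD; apply: le_trans (ler_normD _ _) _; move: h2; rewrite /t; lra.
  split; first by split; lra.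
  by rewrite {2}/d lerBrDr -lerBrDl ge_max E1 E2.
have t1 : cmod w0 + 2 * t < 1.
  have -> : w0 = z + (w0 - z) by rewrite addrC subrK.
  apply: le_lt_trans r1.
  have := cmodD z (w0 - z); have := cmod_leReIm (w0 - z); case: maxD; rewrite /t; lra.
have ptw w : sqin w0 t w -> cmod (F w) <= (8 `^ ((1 - p) / p) * cmod (F w0) `^ (1 - p)) * cmod (F w) `^ p.
  move=> /subsq[win dw].
  (* The constant is 2 times 4: [val w <= M] and [M / 2 < val w0] cost 2, and the square of
     [d w0 / 2 <= d w] costs 4. *)
  have h8 : cmod (F w) `^ p <= 8 * cmod (F w0) `^ p.
    have := MT _ win; rewrite /val => h.
    have : cmod (F w) `^ p * (d w0 / 2) ^+ 2 <= M.
      apply: le_trans h; rewrite ler_wpM2l ?powR_ge0// lerXn2r ?nnegrE//.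
        by rewrite divr_ge0.
      by case/andP: (dr _ win).
    move: w0M; rewrite /val; have : 0 < d w0 ^+ 2 by rewrite exprn_gt0.
    rewrite expr_div_n; move: (d w0 ^+ 2) => D D0 h1 h2.
    rewrite -(ler_pM2r D0); move: h2; have -> : D / 2 ^+ 2 = D / 4 by field.
    by rewrite mulrA; lra.
  have [->|Fw0] := eqVneq (cmod (F w)) 0; first by rewrite mulr_ge0 ?powR_ge0 ?mulr_ge0 ?powR_ge0.
  have Fw : 0 < cmod (F w) by rewrite lt_neqAle eq_sym Fw0 cmod_ge0.
  rewrite -{1}(powR_split p Fw) ler_wpM2r ?powR_ge0//.
  have e2 x : 0 <= x -> x `^ (1 - p) = (x `^ p) `^ ((1 - p) / p).
    by move=> x0; rewrite -powRrM mulrC divfK// gt_eqF.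
  rewrite (e2 (cmod (F w))) ?cmod_ge0// (e2 (cmod (F w0))) ?cmod_ge0//.
  rewrite -powRM ?powR_ge0//; apply: lepow => //; rewrite ?powR_ge0//.
  by rewrite divr_ge0 ?(ltW p0)// subr_ge0 ltW.
have sub0 := @sq_dset _ w0 t t1.
pose K := 8 `^ ((1 - p) / p) * cmod (F w0) `^ (1 - p).
have K0 : 0 < K by rewrite mulr_gt0 ?powR_gt0.
have mp0 := measurable_sq_pow p hF sub0; have m10 := measurable_sq_pow 1 hF sub0.
have mp := measurable_sq_pow p hF sub.
have I1 : (sq_int 1 F w0 t <= K%:E * sq_int p F z r)%E.
  apply: (@le_trans _ _ (K%:E * sq_int p F w0 t)%E).
    have msq := @measurable_sq R w0 t.
    have p0' w : sq w0 t w -> (0 <= (cmod (F (pt w)) `^ p)%:E)%E by rewrite lee_fin powR_ge0.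
    have K00 : (0 <= K%:E)%E by rewrite lee_fin ltW.
    rewrite [X in (_ <= X)%E](_ : _ = (\int[leb2]_(w in sq w0 t)
      (K%:E * (cmod (F (pt w)) `^ p)%:E))%E); last by rewrite ge0_integralZl.
    apply: ge0_le_integral => //.
    - by move=> w _; rewrite lee_fin powR_ge0.
    - exact: measurable_funeM.
    - by move=> w /sqP win; rewrite -EFinM lee_fin powRr1 ?cmod_ge0//; exact: ptw.
  rewrite lee_wpmul2l// ?lee_fin ?(ltW K0)//.
  apply: ge0_subset_integral => //; try exact: measurable_sq.
    by move=> w _; rewrite lee_fin powR_ge0.
  by move=> w /sqP /subsq[win _]; apply/sqP.
have := le_trans (mean _ _ _ hF t0 t1) (lee_wpmul2l _ I1).
rewrite lee_fin (ltW k00) => /(_ isT).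
have := sq_int_ge0 p F z r; case: (sq_int p F z r) => [A|_ _|]; last by [].
- rewrite lee_fin => A0; rewrite -!EFinM !lee_fin => h.
  have e1 := powR_split p c0'.
  have h2 : t ^+ 2 * cmod (F w0) `^ p <= k0 * 8 `^ ((1 - p) / p) * A.
    have q0 : 0 < cmod (F w0) `^ (1 - p) by rewrite powR_gt0.
    rewrite -(ler_pM2l q0); move: h; rewrite -{1}e1 /K; lra.
  have := MT _ zin; rewrite /val dz -/c => h3; move: w0M; rewrite /val => h4.
  have et : d w0 ^+ 2 = 4 * t ^+ 2 by rewrite /t; field.
  move: h4; rewrite et => h4; rewrite mulrC; apply: (le_trans h3); lra.
- by rewrite gt0_muley ?leey// lte_fin !(mulr_gt0, powR_gt0).
Qed.

Lemma sub_mean p : 0 < p -> exists2 k : R, 0 < k & forall F z r, holo F -> 0 < r ->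
  cmod z + 2 * r < 1 -> ((r ^+ 2 * cmod (F z) `^ p)%:E <= k%:E * sq_int p F z r)%E.
Proof.
move=> p0; have [k0 k00 mean] := mean_value_pow.
have [p1|p1] := leP 1 p.
  exists (2 * k0 * (8 * k0) `^ (p - 1)); first by rewrite !mulr_gt0// powR_gt0// mulr_gt0.
  by move=> *; exact: sub_mean_ge1.
exists (8 * k0 * 8 `^ ((1 - p) / p)); first by rewrite !mulr_gt0// powR_gt0.
by move=> *; apply: sub_mean_lt1 => //; rewrite p0.
Qed.

End SubMeanPower.

(** * Mean value inequality on segments and one-dimensional integrals of powers *)

Section RealEstimates.
Variable R : realType.
Local Notation C := (Cplx R).
Local Notation leb := (@lebesgue_measure R).
Implicit Types (x y s t : R).

Lemma real_is_derive (phi : R -> R) (t l : R) :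
  (forall e, 0 < e -> exists2 d, 0 < d & forall h, `|h| < d ->
     `|phi (t + h) - phi t - l * h| <= e * `|h|) -> is_derive t 1 phi l.
Proof.
move=> H.
have key : h^-1 *: (phi (h *: 1 + t) - phi t) @[h --> (0 : R)^'] --> l.
  apply/cvgrPdist_le => /= e e0; have [d d0 dP] := H _ e0.
  exists d => // h /=; rewrite sub0r normrN => hd h0.
  rewrite -(ler_pM2r (_ : 0 < `|h|)) ?normr_gt0//.
  apply: le_trans (dP _ hd); rewrite -normrM distrC le_eqVlt; apply/orP; left.
  apply/eqP; congr (Num.norm _); rewrite /GRing.scale/= mulr1 (addrC t) mulrBl.
  by rewrite mulrAC mulVf// mul1r.
by apply: DeriveDef; [apply/cvg_ex; exists l|exact/cvg_lim].
Qed.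

Lemma seg_is_derive (f : C -> C) (z1 z2 l : C) (t : R) : has_deriv f (seg z1 z2 t) l ->
  is_derive t 1 (fun t => complex.Re (f (seg z1 z2 t))) (complex.Re (l * (z2 - z1))) /\
  is_derive t 1 (fun t => complex.Im (f (seg z1 z2 t))) (complex.Im (l * (z2 - z1))).
Proof.
move=> H.
have K e : 0 < e -> exists2 d, 0 < d & forall h : R, `|h| < d ->
    cmod (f (seg z1 z2 (t + h)) - f (seg z1 z2 t) - (l * (z2 - z1)) * (h%:C)%C) <= e * `|h|.
  move=> e0; have p0 : 0 < cmod (z2 - z1) + 1 by rewrite ltr_wpDl ?cmod_ge0.
  have [d d0 dP] := H _ (divr_gt0 e0 p0).
  exists (d / (cmod (z2 - z1) + 1)); first exact: divr_gt0.
  move=> h; rewrite ltr_pdivlMr// => hd.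
  have hc : cmod ((h%:C)%C * (z2 - z1)) < d.
    by rewrite cmodM cmod_rc; have := normr_ge0 h; have := cmod_ge0 (z2 - z1); nra.
  have := dP _ hc; have -> : seg z1 z2 t + (h%:C)%C * (z2 - z1) = seg z1 z2 (t + h).
    by rewrite /seg rcD; ring.
  have -> : l * ((h%:C)%C * (z2 - z1)) = l * (z2 - z1) * (h%:C)%C by ring.
  move/le_trans; apply; rewrite cmodM cmod_rc mulrCA mulrA -!mulrA.
  rewrite [X in X <= _](_ : _ = e * `|h| * (cmod (z2 - z1) / (cmod (z2 - z1) + 1))); last by ring.
  apply: ler_piMr; first by rewrite mulr_ge0// ltW.
  by rewrite ler_pdivrMr// mul1r lerDl.
split; apply: real_is_derive => e /K[d d0 dP]; exists d => // h /dP; apply: le_trans.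
- have -> : complex.Re (f (seg z1 z2 (t + h))) - complex.Re (f (seg z1 z2 t)) -
     complex.Re (l * (z2 - z1)) * h = complex.Re (f (seg z1 z2 (t + h)) - f (seg z1 z2 t) -
     l * (z2 - z1) * (h%:C)%C) by rewrite !ReB (ReM _ (h%:C)%C) /=; ring.
  exact: Re_le_cmod.
- have -> : complex.Im (f (seg z1 z2 (t + h))) - complex.Im (f (seg z1 z2 t)) -
     complex.Im (l * (z2 - z1)) * h = complex.Im (f (seg z1 z2 (t + h)) - f (seg z1 z2 t) -
     l * (z2 - z1) * (h%:C)%C) by rewrite !ImB (ImM _ (h%:C)%C) /=; ring.
  exact: Im_le_cmod.
Qed.

(** Real and imaginary parts take their mean values at different points, which costs the factor
    2. *)
Lemma mean_value_ineq (f f' : C -> C) (z1 z2 : C) (M : R) :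
  (forall t, 0 <= t <= 1 -> has_deriv f (seg z1 z2 t) (f' (seg z1 z2 t))) ->
  (forall t, 0 <= t <= 1 -> cmod (f' (seg z1 z2 t)) <= M) ->
  cmod (f z2 - f z1) <= 2 * M * cmod (z2 - z1).
Proof.
move=> df HM.
have s0 : seg z1 z2 0 = z1 by rewrite /seg mul0r addr0.
have s1 : seg z1 z2 1 = z2 by rewrite /seg (rmorph1 (real_complex R)); ring.
have in01 (t : R) : t \in `]0, 1[ -> 0 <= t <= 1.
  by rewrite in_itv/= => /andP[t0 t1]; rewrite !ltW.
have cR : {within `[0, 1], continuous (fun t => complex.Re (f (seg z1 z2 t)))}.
  apply: within01 => t t01; have [[/derivable1_diffP h _] _] := seg_is_derive (df _ t01).
  exact: differentiable_continuous.
have cI : {within `[0, 1], continuous (fun t => complex.Im (f (seg z1 z2 t)))}.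
  apply: within01 => t t01; have [_ [/derivable1_diffP h _]] := seg_is_derive (df _ t01).
  exact: differentiable_continuous.
have [c c01] := @MVT_segment R _ (fun t => complex.Re (f' (seg z1 z2 t) * (z2 - z1))) 0 1 ler01
  (fun t h => (seg_is_derive (df t (in01 _ h))).1) cR.
have [d d01] := @MVT_segment R _ (fun t => complex.Im (f' (seg z1 z2 t) * (z2 - z1))) 0 1 ler01
  (fun t h => (seg_is_derive (df t (in01 _ h))).2) cI.
rewrite !s0 !s1 subr0 !mulr1 => eI eR.
apply: le_trans (cmod_leReIm _) _; rewrite ReB ImB eR eI.
rewrite in_itv/= in c01; rewrite in_itv/= in d01.
have := HM _ c01; have := HM _ d01.
have := Re_le_cmod (f' (seg z1 z2 c) * (z2 - z1)); have := Im_le_cmod (f' (seg z1 z2 d) * (z2 - z1)).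
rewrite !cmodM; have := cmod_ge0 (z2 - z1); nra.
Qed.

Lemma FTC_itv (f F : R -> R) (a b : R) : a <= b ->
  (forall x, a <= x <= b -> is_derive x 1 F (f x)) ->
  (forall x, a <= x <= b -> {for x, continuous f}) ->
  (\int[leb]_(x in `[a, b]) (f x)%:E = (F b - F a)%:E)%E.
Proof.
rewrite le_eqVlt => /orP[/eqP <- _ _|ab dF cf].
  by rewrite set_itv1 integral_set1 subrr.
have cF x : a <= x <= b -> {for x, continuous F}.
  by move=> xab; apply: differentiable_continuous; apply/derivable1_diffP; case: (dF x xab).
rewrite (@continuous_FTC2 _ f F)//.
- exact: within01.
- split.
  + by move=> x; rewrite in_itv/= => /andP[ax xb]; case: (dF x) => //; rewrite !ltW.
  + by apply: cvg_at_right_filter; apply: cF; rewrite lexx ltW.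
  + by apply: cvg_at_left_filter; apply: cF; rewrite lexx ltW.
- move=> x; rewrite in_itv/= => /andP[ax xb]; rewrite derive1E.
  by case: (dF x) => //; rewrite !ltW.
Qed.

Lemma is_derive_cont (F : R -> R) (x l : R) : is_derive x 1 F l -> {for x, continuous F}.
Proof.
by move=> [h _]; apply: differentiable_continuous; apply/derivable1_diffP.
Qed.

Lemma is_derive_pow_affine (k m q x : R) : 0 < k * x + m ->
  is_derive x 1 (fun x => (k * x + m) `^ q) (q * (k * x + m) `^ (q - 1) * k).
Proof.
move=> p0.
have d1 : is_derive x 1 (fun x : R => k * x + m) k.
  have := is_deriveD (is_deriveZ k (is_derive_id x 1)) (is_derive_cst m x 1).
  by rewrite /GRing.scale/= mulr1 addr0.
have := @is_derive1_comp R (fun y => y `^ q) (fun x => k * x + m) x _ _ (is_derive1_powR q p0) d1.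
by rewrite /=.
Qed.

Lemma le_integral_setU d (T : measurableType d) (mu : {measure set T -> \bar R})
    (A B D : set T) (f : T -> \bar R) : measurable A -> measurable B -> measurable D ->
  measurable_fun setT f -> (forall u : T, (0 <= f u)%E) -> A `<=` B `|` D ->
  (\int[mu]_(x in A) f x <= \int[mu]_(x in B) f x + \int[mu]_(x in D) f x)%E.
Proof.
move=> mA mB mD mf f0 ABD.
apply: (@le_trans _ _ (\int[mu]_(x in B `|` (D `\` B)) f x)%E).
  apply: ge0_subset_integral => //; first exact/measurableU/measurableD.
    exact: measurable_funS mf.
  by move=> x /ABD[|]; [left|have [|] := pselect (B x); [left|right]].
rewrite ge0_integral_setU//; last 3 first.
- exact: measurableD.
- exact: measurable_funS mf.
- by apply/disj_setPS => x [Bx [_ /(_ Bx)]].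
rewrite leeD2l//; apply: ge0_subset_integral => //; first exact: measurableD.
exact: measurable_funS mf.
Qed.

(** One-dimensional model of |1 - conj(a) z|: with eta = 1 - |a| and b the real or imaginary part of
    a, its value at the same coordinate of z is at most twice that modulus. *)
Definition wt (eta b x : R) : R := eta + `|x - b|.

Lemma wt_ge (eta b x : R) : eta <= wt eta b x.
Proof. by rewrite /wt lerDl. Qed.

Lemma measurable_wt (eta b q : R) : measurable_fun setT (fun x => (wt eta b x `^ q)%:E).
Proof.
apply/measurable_EFinP; apply: (@measurableT_comp _ _ _ _ _ _ (fun x : R => x `^ q)) => //.
apply: measurable_funD => //; apply: measurableT_comp => //.
by apply: measurable_funB => //; exact: measurable_cst.
Qed.

Lemma int_wt (eta b T k : R) : 0 < eta -> 0 <= T -> k != 1 ->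
  (\int[leb]_(x in `[(b - T)%R, (b + T)%R]) (wt eta b x `^ (- k))%:E <=
   (2 * (((eta + T) `^ (1 - k) - eta `^ (1 - k)) / (1 - k)))%:E)%E.
Proof.
move=> e0 T0 k1.
have k1' : 1 - k != 0 by rewrite subr_eq0 eq_sym.
apply: (le_trans (@le_integral_setU _ _ leb _ `[(b - T)%R, b]%classic `[b, (b + T)%R]%classic _ _ _ _ _ _ _)) => //.
- exact: measurable_wt.
- by move=> x; rewrite lee_fin powR_ge0.
- by move=> x /=; rewrite !in_itv/= => /andP[h1 h2]; have [xb|bx] := leP x b; [left|right]; rewrite ?h1 ?h2 ?(ltW bx).
have I1 : (\int[leb]_(x in `[(b - T)%R, b]) (wt eta b x `^ (- k))%:E =
   (((eta + T) `^ (1 - k) - eta `^ (1 - k)) / (1 - k))%:E)%E.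
  pose f x := ((-1) * x + (eta + b)) `^ (- k).
  pose F x := (- (1 - k)^-1) * ((-1) * x + (eta + b)) `^ (1 - k).
  rewrite (_ : (\int[leb]_(x in _) _)%E = (\int[leb]_(x in `[(b - T)%R, b]) (f x)%:E)%E); last first.
    apply: eq_integral => x; rewrite inE/= in_itv/= => /andP[x1 x2].
    by rewrite /f /wt ler0_norm ?subr_le0//; congr (_ `^ _)%:E; ring.
  have pos x : b - T <= x <= b -> 0 < (-1) * x + (eta + b) by move=> /andP[? ?]; lra.
  transitivity ((F b - F (b - T))%:E); last first.
    rewrite /F; congr EFin; rewrite (_ : -1 * b + (eta + b) = eta); last by ring.
    by rewrite (_ : -1 * (b - T) + (eta + b) = eta + T); [field|ring].
  apply: FTC_itv; first by lra.
  + move=> x /pos xp; rewrite /F /f.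
    have := is_deriveZ (- (1 - k)^-1) (is_derive_pow_affine (1 - k) xp).
    rewrite (_ : 1 - k - 1 = - k); last by ring.
    by rewrite /GRing.scale/= (_ : - (1 - k)^-1 * _ = (-1 * x + (eta + b)) `^ (- k)); last by field.
  + by move=> x /pos xp; exact: (is_derive_cont (is_derive_pow_affine (- k) xp)).
have I2 : (\int[leb]_(x in `[b, (b + T)%R]) (wt eta b x `^ (- k))%:E =
   (((eta + T) `^ (1 - k) - eta `^ (1 - k)) / (1 - k))%:E)%E.
  pose f x := (1 * x + (eta - b)) `^ (- k).
  pose F x := ((1 - k)^-1) * (1 * x + (eta - b)) `^ (1 - k).
  rewrite (_ : (\int[leb]_(x in _) _)%E = (\int[leb]_(x in `[b, (b + T)%R]) (f x)%:E)%E); last first.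
    apply: eq_integral => x; rewrite inE/= in_itv/= => /andP[x1 x2].
    by rewrite /f /wt ger0_norm ?subr_ge0//; congr (_ `^ _)%:E; ring.
  have pos x : b <= x <= b + T -> 0 < 1 * x + (eta - b) by move=> /andP[? ?]; lra.
  transitivity ((F (b + T) - F b)%:E); last first.
    rewrite /F; congr EFin; rewrite (_ : 1 * b + (eta - b) = eta); last by ring.
    by rewrite (_ : 1 * (b + T) + (eta - b) = eta + T); [field|ring].
  apply: FTC_itv; first by lra.
  + move=> x /pos xp; rewrite /F /f.
    have := is_deriveZ ((1 - k)^-1) (is_derive_pow_affine (1 - k) xp).
    rewrite (_ : 1 - k - 1 = - k); last by ring.
    by rewrite /GRing.scale/= (_ : (1 - k)^-1 * _ = (1 * x + (eta - b)) `^ (- k)); last by field.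
  + by move=> x /pos xp; exact: (is_derive_cont (is_derive_pow_affine (- k) xp)).
by rewrite I1 I2 -EFinD lee_fin mulr_natl mulr2n.
Qed.

(** u^s = u u^(s - 1), where u^(s - 1) is decreasing; negative s are covered as well. *)
Lemma powR_subadd x y s : 0 < x -> 0 < y -> s < 1 -> (x + y) `^ s <= x `^ s + y `^ s.
Proof.
move=> x0 y0 s1; have xy : 0 < x + y by rewrite addr_gt0.
have E u : 0 < u -> u `^ s = u * u `^ (s - 1).
  move=> u0; rewrite -{2}(powRr1 (ltW u0)) -powRD ?(gt_eqF u0) ?implybT//.
  by congr (_ `^ _); ring.
rewrite !E// mulrDl; apply: lerD; apply: ler_wpM2l; rewrite ?(ltW x0) ?(ltW y0)//.
- rewrite -opprB !powRN lef_pV2 ?posrE ?powR_gt0//; apply: lepow; lra.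
- rewrite -opprB !powRN lef_pV2 ?posrE ?powR_gt0//; apply: lepow; lra.
Qed.

Lemma int_wt_tail (eta b T k : R) : 0 < eta -> 0 <= T -> 1 < k ->
  (\int[leb]_(x in `[(b - T)%R, (b + T)%R]) (wt eta b x `^ (- k))%:E <=
   (2 / (k - 1) * eta `^ (1 - k))%:E)%E.
Proof.
move=> e0 T0 k1; apply: le_trans (int_wt _ e0 T0 _) _; first by rewrite gt_eqF.
rewrite lee_fin -mulrA ler_pM2l//.
have -> : ((eta + T) `^ (1 - k) - eta `^ (1 - k)) / (1 - k) =
  (k - 1)^-1 * (eta `^ (1 - k) - (eta + T) `^ (1 - k)).
  by field; apply/andP; split; apply/eqP; lra.
rewrite ler_pM2l ?invr_gt0 ?subr_gt0// lerBlDr lerDl powR_ge0//.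
Qed.

(** The bound must not depend on where c lies relative to b: outside [b - r, b + r] the weight is at
    least r, and inside the primitive is explicit. *)
Lemma int_wt_local (eta b c r k : R) : 0 < eta -> 0 < r -> 0 < k < 1 ->
  (\int[leb]_(x in `[(c - r)%R, (c + r)%R]) (wt eta b x `^ (- k))%:E <=
   ((2 + 2 / (1 - k)) * r `^ (1 - k))%:E)%E.
Proof.
move=> e0 r0 /andP[k0 k1].
pose I := `[(c - r)%R, (c + r)%R]%classic; pose I' := `[(b - r)%R, (b + r)%R]%classic.
have mw := measurable_wt eta b (- k).
have w0 x : (0 <= (wt eta b x `^ (- k))%:E)%E by rewrite lee_fin powR_ge0.
have mI : measurable I by exact: measurable_itv.
have mI' : measurable I' by exact: measurable_itv.
have mII : measurable (I `\` I') by exact: measurableD.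
apply: (le_trans (@le_integral_setU _ _ leb I (I `\` I') I' _ mI mII mI' mw w0 _)).
  by move=> x Ix; have [|] := pselect (I' x); [right|left].
rewrite mulrDl EFinD; apply: leeD.
  apply: (@le_trans _ _ (\int[leb]_(x in I) (r `^ (- k))%:E)%E).
    apply: (@le_trans _ _ (\int[leb]_(x in I `\` I') (r `^ (- k))%:E)%E).
      apply: ge0_le_integral => //.
      + exact: measurable_funS mw.
      + move=> x [_ nI]; rewrite lee_fin !powRN lef_pV2 ?posrE ?powR_gt0//; last first.
          by apply: lt_le_trans (wt_ge _ _ _).
        apply: lepow; [exact: ltW|exact: ltW|]; have [//|h] := leP r (wt eta b x).
        exfalso; apply: nI; rewrite /I' /= in_itv/= -ler_distl.
        by move: h e0; rewrite /wt; lra.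
    apply: ge0_subset_integral => //.
    by move=> x _; rewrite lee_fin powR_ge0.
  rewrite integral_cst//= /I lebesgue_measure_itv/= lte_fin.
  have -> : c - r < c + r by lra.
  rewrite -EFinB -EFinM lee_fin.
  have -> : r `^ (1 - k) = r * r `^ (- k).
    by rewrite -{2}(powRr1 (ltW r0)) -powRD ?(gt_eqF r0) ?implybT.
  by rewrite le_eqVlt; apply/orP; left; apply/eqP; ring.
apply: (le_trans (int_wt _ e0 (ltW r0) _)); first by rewrite lt_eqF.
rewrite lee_fin -[X in _ <= X]mulrA ler_pM2l// [_ / (1 - k)]mulrC.
rewrite ler_pM2l ?invr_gt0 ?subr_gt0//.
have k2 : 1 - k < 1 by lra.
by have := powR_subadd e0 r0 k2; lra.
Qed.

End RealEstimates.

(** * Carleson embedding *)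

Section Kernel.
Variable R : realType.
Local Notation C := (Cplx R).
Local Notation leb := (@lebesgue_measure R).
Local Notation leb2 := (leb \x leb)%E.
Implicit Types (a z : C) (p q : R).

Definition tau a z : R := cmod (1 - a^*%C * z).

Lemma tau_eta a z : cmod a < 1 -> cmod z < 1 -> 1 - cmod a <= tau a z.
Proof.
move=> a1 z1; have := ler_cmodB 1 (a^*%C * z); rewrite cmod1 cmodM cmod_conj => h.
by apply: le_trans h; have := cmod_ge0 a; have := cmod_ge0 z; nra.
Qed.

Lemma tau_sqr a z : tau a z ^+ 2 - cmod (a - z) ^+ 2 = (1 - cmod a ^+ 2) * (1 - cmod z ^+ 2).
Proof.
rewrite /tau !cmod_sqr.
have ReN (x : C) : complex.Re (- x) = - complex.Re x by case: x.
have ImN (x : C) : complex.Im (- x) = - complex.Im x by case: x.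
by case: a z => [a1 a2] [z1 z2] /=; ring.
Qed.

Lemma tau_dist a z : cmod a < 1 -> cmod z < 1 -> cmod (a - z) <= tau a z.
Proof.
move=> a1 z1; rewrite -(ler_sqr (_ : _ \is Num.nneg)) ?nnegrE ?cmod_ge0//.
rewrite -subr_ge0 tau_sqr mulr_ge0// subr_ge0 expr_le1// ?cmod_ge0// ltW//.
Qed.

Lemma tau_gt0 a z : cmod a < 1 -> cmod z < 1 -> 0 < tau a z.
Proof. by move=> a1 z1; apply: lt_le_trans (tau_eta a1 z1); rewrite subr_gt0. Qed.

Lemma tau_wt_Re a z : cmod a < 1 -> cmod z < 1 ->
  wt (1 - cmod a) (complex.Re a) (complex.Re z) <= 2 * tau a z.
Proof.
move=> a1 z1; have := tau_eta a1 z1; have := tau_dist a1 z1.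
have := Re_le_cmod (a - z); rewrite ReB /wt distrC; lra.
Qed.

Lemma tau_wt_Im a z : cmod a < 1 -> cmod z < 1 ->
  wt (1 - cmod a) (complex.Im a) (complex.Im z) <= 2 * tau a z.
Proof.
move=> a1 z1; have := tau_eta a1 z1; have := tau_dist a1 z1.
have := Im_le_cmod (a - z); rewrite ImB /wt distrC; lra.
Qed.

Definition om a z : R := (1 - cmod a ^+ 2) / tau a z ^+ 2.

Lemma mobius_om a z : cmod a < 1 -> cmod z < 1 ->
  1 - cmod (mobius a z) ^+ 2 = (1 - cmod z ^+ 2) * om a z.
Proof.
move=> a1 z1; have t0 := tau_gt0 a1 z1.
rewrite /mobius cmodM cmodV -/(tau a z) expr_div_n /om mulrA [X in _ = X / _]mulrC -tau_sqr.
by field; rewrite gt_eqF.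
Qed.

Lemma om_ge0 a z : cmod a < 1 -> 0 <= om a z.
Proof.
by move=> a1; rewrite /om divr_ge0 ?sqr_ge0// subr_ge0 expr_le1 ?cmod_ge0// ltW.
Qed.

Lemma om_le a z : cmod a < 1 -> cmod z < 1 -> om a z <= 2 / tau a z.
Proof.
move=> a1 z1; have t0 := tau_gt0 a1 z1; have te := tau_eta a1 z1.
rewrite /om expr2 invfM mulrA ler_pM2r ?invr_gt0// ler_pdivrMr//.
have := cmod_ge0 a; nra.
Qed.

Lemma prod_integral_le (A B : set R) (f g : R -> \bar R) (c1 c2 : R) :
  measurable A -> measurable B -> measurable_fun setT f -> measurable_fun setT g ->
  (forall x, (0 <= f x)%E) -> (forall x, (0 <= g x)%E) -> 0 <= c2 ->
  (\int[leb]_(x in A) f x <= c1%:E)%E -> (\int[leb]_(x in B) g x <= c2%:E)%E ->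
  (\int[leb2]_(w in A `*` B) (f w.1 * g w.2) <= (c1 * c2)%:E)%E.
Proof.
move=> mA mB mf mg f0 g0 c20 fA gB.
pose f' := f \_ A; pose g' := g \_ B.
have mf' : measurable_fun setT f'.
  by apply: (measurable_restrictT _ mA).1; exact: measurable_funS mf.
have mg' : measurable_fun setT g'.
  by apply: (measurable_restrictT _ mB).1; exact: measurable_funS mg.
have f'0 x : (0 <= f' x)%E by rewrite /f' /patch; case: ifP.
have g'0 x : (0 <= g' x)%E by rewrite /g' /patch; case: ifP.
rewrite integral_mkcond.
rewrite [X in (X <= _)%E](_ : _ = (\int[leb2]_w (f' w.1 * g' w.2))%E); last first.
  apply: eq_integral => -[x y] _; rewrite /f' /g' /patch in_setX /=.
  by case: (x \in A); case: (y \in B); rewrite ?mul0e ?mule0.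
rewrite fubini_tonelli1//; last 2 first.
- by apply: emeasurable_funM; exact: measurableT_comp.
- by move=> w; rewrite mule_ge0.
rewrite /fubini_F /=.
under eq_integral => x _ do rewrite ge0_integralZl//.
rewrite ge0_integralZr//; last exact: integral_ge0.
rewrite -!integral_mkcond EFinM.
by apply: lee_pmul => //; exact: integral_ge0.
Qed.

Lemma powR_neg_le (x y q : R) : 0 <= q -> 0 < x -> x <= y -> y `^ (- q) <= x `^ (- q).
Proof.
move=> q0 x0 xy; have y0 : 0 < y := lt_le_trans x0 xy.
by rewrite !powRN lef_pV2 ?posrE ?powR_gt0//; apply: lepow => //; exact: ltW.
Qed.

(** [tau] dominates the weights of both coordinates up to a factor 2, so its negative powers are
    bounded by a function of the real part times one of the imaginary part, as [prod_integral_le]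
    requires. *)
Lemma tau_split a z (s t : R) : cmod a < 1 -> cmod z < 1 -> 0 <= s -> 0 <= t ->
  tau a z `^ (- (s + t)) <= 2 `^ (s + t) *
   (wt (1 - cmod a) (complex.Re a) (complex.Re z) `^ (- s) *
    wt (1 - cmod a) (complex.Im a) (complex.Im z) `^ (- t)).
Proof.
move=> a1 z1 s0 t0; have T0 := tau_gt0 a1 z1.
have e0 : 0 < 1 - cmod a by rewrite subr_gt0.
have w1 := lt_le_trans e0 (wt_ge (1 - cmod a) (complex.Re a) (complex.Re z)).
have w2 := lt_le_trans e0 (wt_ge (1 - cmod a) (complex.Im a) (complex.Im z)).
have h1 := tau_wt_Re a1 z1; have h2 := tau_wt_Im a1 z1.
have E u x : 0 <= u -> 0 < x -> x <= 2 * tau a z -> tau a z `^ (- u) <= 2 `^ u * x `^ (- u).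
  move=> u0 x0 xt; apply: (@le_trans _ _ ((x / 2) `^ (- u))).
    by apply: powR_neg_le => //; lra.
  rewrite powRM ?(ltW x0) ?invr_ge0// mulrC -powR_inv1// -powRrM.
  by rewrite (_ : -1 * - u = u)//; ring.
have -> : tau a z `^ (- (s + t)) = tau a z `^ (- s) * tau a z `^ (- t).
  by rewrite opprD powRD// (gt_eqF T0) implybT.
have -> : (2 : R) `^ (s + t) = 2 `^ s * 2 `^ t.
  by rewrite powRD// (_ : (2 : R) == 0 = false) ?implybT// pnatr_eq0.
rewrite mulrACA; apply: ler_pM; rewrite ?powR_ge0//; exact: E.
Qed.

Lemma measurable_tau a q : measurable_fun setT (fun w => (tau a (pt w) `^ q)%:E).
Proof.
apply/measurable_EFinP; apply: (@measurableT_comp _ _ _ _ _ _ (fun x : R => x `^ q)) => //.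
apply: box_continuous_measurable => w _ e e0.
have p0 : 0 < cmod a + 1 by rewrite ltr_wpDl ?cmod_ge0.
exists (e / (2 * (cmod a + 1))); first by rewrite divr_gt0// mulr_gt0.
move=> w'; rewrite !ltr_pdivlMr ?mulr_gt0// => h1 h2; split=> //.
rewrite /tau; set x := 1 - _; set y := 1 - _.
have xy : `|cmod x - cmod y| <= cmod (x - y).
  have h3 := ler_cmodB x y; have h4 := ler_cmodB y x; rewrite (cmodBC y) in h4.
  by rewrite ler_norml h3 andbT lerNl opprB.
apply: le_lt_trans xy _; have -> : x - y = a^*%C * (pt w - pt w') by rewrite /x /y; ring.
rewrite cmodM cmod_conj cmodBC.
have := cmod_pt_le (pt w) w' => /= h3.
have := cmod_ge0 a; have := cmod_ge0 (pt w' - pt w); nra.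
Qed.

(** Sharing the exponent equally between the coordinates leaves p / 2 < 1 in each, and such a
    singularity is integrable uniformly in a. *)
Lemma tau_int p : 0 < p < 2 -> exists2 k, 0 < k & forall a (w : C) (r : R), cmod a < 1 -> 0 < r ->
  (\int[leb2]_(u in sq w r `&` @dset R) (tau a (pt u) `^ (- p))%:E <= (k * r `^ (2 - p))%:E)%E.
Proof.
move=> /andP[p0 p2]; pose k1 := 2 + 2 / (1 - p / 2).
have k10 : 0 < k1.
  by rewrite /k1 addr_gt0// divr_gt0//; lra.
exists (2 `^ p * (k1 * k1)); first by rewrite mulr_gt0 ?powR_gt0// mulr_gt0.
move=> a w r a1 r0.
have e0 : 0 < 1 - cmod a by rewrite subr_gt0.
pose fx x := (wt (1 - cmod a) (complex.Re a) x `^ (- (p / 2)))%:E.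
pose fy x := (wt (1 - cmod a) (complex.Im a) x `^ (- (p / 2)))%:E.
have ph : 0 < p / 2 < 1 by apply/andP; split; lra.
have mx : measurable_fun setT fx by exact: measurable_wt.
have my : measurable_fun setT fy by exact: measurable_wt.
have fx0 x : (0 <= fx x)%E by rewrite lee_fin powR_ge0.
have fy0 x : (0 <= fy x)%E by rewrite lee_fin powR_ge0.
have K0 : 0 <= k1 * r `^ (1 - p / 2) by rewrite mulr_ge0 ?powR_ge0// ltW.
have P := prod_integral_le (measurable_itv `[complex.Re w - r, complex.Re w + r])
  (measurable_itv `[complex.Im w - r, complex.Im w + r]) mx my fx0 fy0 K0
  (int_wt_local _ _ e0 r0 ph) (int_wt_local _ _ e0 r0 ph).
have m2 : measurable_fun setT (fun u : R * R => (fx u.1 * fy u.2)%E).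
  by apply: emeasurable_funM; exact: measurableT_comp.
have mS := @measurable_sq R w r; have mD := @measurable_dset R.
have mSD : measurable (sq w r `&` @dset R) by exact: measurableI.
apply: (@le_trans _ _ (\int[leb2]_(u in sq w r `&` @dset R) ((2 `^ p)%:E * (fx u.1 * fy u.2)))%E).
  apply: ge0_le_integral => //.
  - by move=> u _; rewrite lee_fin powR_ge0.
  - exact: measurable_funS (measurable_tau a (- p)).
  - by apply: measurable_funeM; exact: measurable_funS m2.
  - move=> u [_ u1]; rewrite /fx /fy -!EFinM lee_fin.
    have := @tau_split a (pt u) (p / 2) (p / 2) a1 u1; rewrite -splitr.
    by move: ph => /andP[/ltW h _]; apply.
have m3 : measurable_fun (sq w r `&` @dset R) (fun u : R * R => (fx u.1 * fy u.2)%E).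
  exact: measurable_funS m2.
have m30 u : (sq w r `&` @dset R) u -> (0 <= fx u.1 * fy u.2)%E by move=> _; rewrite mule_ge0.
have c0 : (0 <= (2 `^ p)%:E :> \bar R)%E by rewrite lee_fin powR_ge0.
have := ge0_integralZl leb2 mSD m3 m30 c0 => /= ->.
rewrite -mulrA EFinM lee_wpmul2l ?lee_fin ?powR_ge0//.
apply: (@le_trans _ _ (\int[leb2]_(u in sq w r) (fx u.1 * fy u.2))%E).
  apply: ge0_subset_integral => //; first exact: measurable_funS m2.
  by move=> u _; rewrite mule_ge0.
apply: (le_trans P); rewrite lee_fin.
have -> : r `^ (2 - p) = r `^ (1 - p / 2) * r `^ (1 - p / 2).
  by rewrite -powRD ?(gt_eqF r0) ?implybT//; congr (_ `^ _); field.
by rewrite -/k1 le_eqVlt; apply/orP; left; apply/eqP; ring.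
Qed.

(* Telescopes against u / (1 + u). *)
Lemma theta_sum (y q : R) n : 0 < y -> 0 < q < 1 ->
  \sum_(k < n) (y * q ^+ k) / (1 + y * q ^+ k) ^+ 2 <= (1 - q)^-1.
Proof.
move=> y0 /andP[q0 q1]; pose th u : R := u / (1 + u).
have q10 : 0 < 1 - q by rewrite subr_gt0.
have step u : 0 < u -> u / (1 + u) ^+ 2 <= (1 - q)^-1 * (th u - th (u * q)).
  move=> u0; have u1 : 0 < 1 + u by rewrite addr_gt0.
  have uq1 : 0 < 1 + u * q by rewrite addr_gt0// mulr_gt0.
  have -> : (1 - q)^-1 * (th u - th (u * q)) = u / ((1 + u) * (1 + u * q)).
    by rewrite /th; field; rewrite !gt_eqF.
  rewrite ler_pM2l// lef_pV2 ?posrE ?exprn_gt0 ?mulr_gt0// expr2 ler_pM2l// lerD2l.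
  by rewrite ler_piMr// ltW.
have H : \sum_(k < n) (y * q ^+ k) / (1 + y * q ^+ k) ^+ 2 <= (1 - q)^-1 * (th y - th (y * q ^+ n)).
  elim: n => [|n ih]; first by rewrite big_ord0 expr0 mulr1 subrr mulr0.
  rewrite big_ord_recr/=; apply: le_trans (lerD ih (step _ _)) _.
    by rewrite mulr_gt0// exprn_gt0.
  by rewrite -mulrDr exprSr mulrA; rewrite le_eqVlt; apply/orP; left; apply/eqP; ring.
apply: le_trans H _; rewrite -[X in _ <= X]mulr1 ler_pM2l ?invr_gt0//.
have : th y <= 1 by rewrite /th ler_pdivrMr ?mul1r ?lerDr// addr_gt0.
have : 0 <= th (y * q ^+ n).
  by rewrite /th divr_ge0 ?addr_ge0// mulr_ge0 ?exprn_ge0// ltW.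
lra.
Qed.

(* A substitute for Hoelder's inequality valid for every p > 0: each b k is
   bounded by m k times the p-th root of the weighted sum. *)
Lemma pow_sum p n (b m : nat -> R) (S : R) : 0 < p -> (forall k, 0 <= b k) ->
  (forall k, 0 < m k) -> \sum_(k < n) m k <= S ->
  (\sum_(k < n) b k) `^ p <= S `^ p * \sum_(k < n) (m k `^ (- p) * b k `^ p).
Proof.
move=> p0 b0 m0 mS; set B := \sum_(k < n) (_ * _).
have B0 : 0 <= B by apply: sumr_ge0 => k _; rewrite mulr_ge0 ?powR_ge0.
have S0 : 0 <= S by apply: le_trans mS; apply: sumr_ge0 => k _; exact: ltW.
have bk (k : 'I_n) : b k <= m k * B `^ p^-1.
  have e : m k `^ (- p) * b k `^ p <= B.
    by rewrite /B (bigD1 k)//= lerDl sumr_ge0// => j _; rewrite mulr_ge0 ?powR_ge0.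
  have e2 : m k `^ (- p) * b k `^ p = (b k / m k) `^ p.
    by rewrite powRM ?invr_ge0 ?(ltW (m0 k))// mulrC -powR_inv1 ?(ltW (m0 k))// -powRrM mulN1r.
  rewrite mulrC -ler_pdivrMr//.
  have -> : b k / m k = ((b k / m k) `^ p) `^ p^-1.
    by rewrite -powRrM divff ?gt_eqF// powRr1// divr_ge0// ltW.
  by apply: lepow; rewrite ?powR_ge0 ?invr_ge0 ?(ltW p0)// -e2.
apply: (@le_trans _ _ ((S * B `^ p^-1) `^ p)).
  apply: lepow; [exact: ltW|exact: sumr_ge0|].
  apply: (@le_trans _ _ (\sum_(k < n) m k * B `^ p^-1)); first exact: ler_sum.
  by rewrite -mulr_suml ler_wpM2r ?powR_ge0.
by rewrite powRM ?powR_ge0// -powRrM mulVf ?gt_eqF// powRr1.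
Qed.

Lemma powR_add_le p (x y : R) : 0 <= p -> 0 <= x -> 0 <= y ->
  (x + y) `^ p <= 2 `^ p * (x `^ p + y `^ p).
Proof.
move=> p0 x0 y0; apply: (@le_trans _ _ ((2 * Num.max x y) `^ p)).
  apply: lepow => //; first exact: addr_ge0.
  by rewrite mulr_natl mulr2n lerD// le_max lexx ?orbT.
rewrite powRM ?le_max ?x0// ler_wpM2l ?powR_ge0//.
by have [xy|xy] := leP x y; [rewrite lerDr|rewrite lerDl]; rewrite powR_ge0.
Qed.

End Kernel.

(** * Chaining along dyadic points of a radius *)

Section Chain.
Variable R : realType.
Local Notation C := (Cplx R).
Local Notation leb := (@lebesgue_measure R).
Local Notation leb2 := (leb \x leb)%E.
Implicit Types (F : C -> C) (z : C) (p q v : R).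

Definition dy (k : nat) : R := 2^-1 ^+ k.

Lemma dy_gt0 k : 0 < dy k. Proof. by rewrite exprn_gt0// invr_gt0. Qed.

Lemma dy_le1 k : dy k <= 1.
Proof. by apply: exprn_ile1; rewrite ?invr_ge0// invf_le1// ler1n. Qed.

Lemma dyS k : dy k = 2 * dy k.+1.
Proof. by rewrite /dy exprS mulrA divff ?mul1r// pnatr_eq0. Qed.

Lemma dy_scale (u : R) : 0 < u <= 1 -> exists k, dy k <= u <= 2 * dy k.
Proof.
move=> /andP[u0 u1].
have ex : exists k, dy k <= u.
  have [n] : exists n : nat, u^-1 < n%:R.
    by exists (Num.bound u^-1); rewrite archi_boundP// invr_ge0 ltW.
  move=> un; exists n; rewrite /dy exprVn -[u]invrK lef_pV2 ?posrE ?exprn_gt0 ?invr_gt0//.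
  apply: le_trans (ltW un) _; rewrite -natrX ler_nat; exact: ltnW (ltn_expl n _).
case: (ex_minnP ex) => -[|k] kP kmin; [exists 0%N|exists k.+1].
  by rewrite kP/= /dy expr0; lra.
rewrite kP/= -dyS leNgt; apply/negP => /ltW/kmin; by rewrite ltnn.
Qed.

(** The annulus where 1 - |w| is of order v, with room by a factor 4 on both sides for the squares
    around the points of a chain. *)
Definition band v : set (R * R) := [set w | v / 4 <= 1 - cmod (pt w) <= 4 * v].

Lemma measurable_band v : measurable (band v).
Proof.
have m : measurable_fun setT (fun w : R * R => 1 - cmod (pt w)).
  by apply: measurable_funB => //; exact: measurable_pt_cmod.
have := m measurableT _ (measurable_itv `[v / 4, 4 * v]); rewrite setTI; congr measurable.
Qed.

Lemma band_dset v : 0 < v -> band v `<=` @dset R.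
Proof. move=> v0 w /andP[h _]; rewrite /dset /disc/=; lra. Qed.

Lemma measurable_holo_pow F p (D : set (R * R)) : holo F -> measurable D -> D `<=` @dset R ->
  measurable_fun D (fun w => ((cmod (F (pt w))) `^ p)%:E).
Proof.
move=> hF mD sub; apply/measurable_EFinP.
apply: (@measurableT_comp _ _ _ _ _ _ (fun x : R => x `^ p)) => //.
exact: (measurable_funS (@measurable_dset R) sub (holo_measurable hF)).
Qed.

Definition bandint p F z v : \bar R :=
  (\int[leb2]_(w in sq z (4 * v) `&` band v) ((cmod (F (pt w))) `^ p)%:E)%E.

Lemma bandint_ge0 p F z v : (0 <= bandint p F z v)%E.
Proof. by apply: integral_ge0 => w _; rewrite lee_fin powR_ge0. Qed.

Lemma sq_band_sub z (u v : R) : cmod z < 1 -> 0 < v -> 0 <= 1 - u <= v ->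
  cmod ((u%:C)%C * z : C) = u * cmod z -> v / 2 <= 1 - u * cmod z <= 3 * v ->
  sq ((u%:C)%C * z) (v / 8) `<=` sq z (4 * v) `&` band v.
Proof.
move=> z1 v0 /andP[u1 uv] czz /andP[uz1 uz2] w /sqP[h1 h2]; pose zz : C := (u%:C)%C * z.
have d1 : cmod (pt w - zz) <= v / 4.
  by have := cmod_leReIm (pt w - zz); rewrite -/zz in h1 h2; lra.
have d2 : cmod (zz - z) <= v.
  have -> : zz - z = ((- (1 - u))%:C)%C * z by rewrite /zz rcN rcB; ring.
  rewrite cmodM cmod_rc normrN ger0_norm//.
  by apply: (@le_trans _ _ (1 - u)) => //; rewrite ler_piMr// ltW.
have d3 : cmod (pt w - z) <= 2 * v.
  have -> : pt w - z = (pt w - zz) + (zz - z) by ring.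
  by have := cmodD (pt w - zz) (zz - z); lra.
split; first by apply/sqP; split; [have := Re_le_cmod (pt w - z)|have := Im_le_cmod (pt w - z)]; lra.
rewrite /band /=; have h3 := ler_cmodB (pt w) zz; have h4 := ler_cmodB zz (pt w).
by rewrite cmodBC in h4; rewrite -/zz in czz; apply/andP; split; lra.
Qed.

(* v is the common scale: the segment from s z to s' z has length at most v and
   stays at distance between v / 2 and 3 v from the circle. *)
Lemma chain_step k0 p F z (s s' v : R) : 0 < k0 ->
  (forall F z r, holo F -> 0 < r -> cmod z + 2 * r < 1 ->
     ((r ^+ 2 * cmod (F z) `^ p)%:E <= k0%:E * sq_int p F z r)%E) ->
  holo F -> cmod z < 1 -> 0 < v -> s <= s' <= 1 -> s' - s <= v -> 1 - s <= v ->
  (forall u, s <= u <= s' -> cmod ((u%:C)%C * z : C) = u * cmod z /\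
     v / 2 <= 1 - u * cmod z <= 3 * v) ->
  exists b, [/\ 0 <= b, cmod (F ((s'%:C)%C * z) - F ((s%:C)%C * z)) <= 2 * b * v &
     ((v ^+ 2 * b `^ p)%:E <= (64 * k0)%:E * bandint p (derive1 F) z v)%E].
Proof.
move=> k00 sm hF z1 v0 /andP[ss s1] sv s1v H.
have hF' := holo_derive1 hF.
have u_le1 u : s <= u <= s' -> cmod ((u%:C)%C * z : C) < 1 by move=> /H[-> /andP[h _]]; lra.
have segE t : seg ((s%:C)%C * z : C) ((s'%:C)%C * z) t = ((s + t * (s' - s))%:C)%C * z.
  by rewrite /seg rcD rcM rcB; ring.
have inI t : 0 <= t <= 1 -> s <= s + t * (s' - s) <= s'.
  by move=> /andP[t0 t1]; apply/andP; split; nra.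
have es : s <= s <= s' by rewrite lexx.
have es' : s <= s' <= s' by rewrite lexx andbT.
have cs := segc_holo hF' (u_le1 _ es) (u_le1 _ es').
(* b is the maximum of |F'| on the segment; the sub-mean value property at a point where it is
   attained bounds it by an area integral. *)
have [c] := EVT_max (@ler01 R) (within01 (fun t => @pathc_cmod _ _ t (seg_pathc cs))).
rewrite in_itv/= => c01 cmax.
pose f t := cmod (derive1 F (seg ((s%:C)%C * z : C) ((s'%:C)%C * z) t)).
have b0 : 0 <= f c by exact: cmod_ge0.
exists (f c); split => //.
  apply: le_trans (mean_value_ineq (f' := derive1 F) (M := f c) _ _) _.
  - move=> t t01; rewrite segE; have := u_le1 _ (inI _ t01).
    by move=> /hF[l hl]; rewrite (has_deriv_derive1 hl).
  - by move=> t t01; apply: cmax; rewrite in_itv.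
  - rewrite -mulrBl -rcB cmodM cmod_rc ger0_norm ?subr_ge0//.
    rewrite ler_wpM2l ?mulr_ge0//.
    by apply: le_trans sv; rewrite ler_piMr ?subr_ge0// ltW.
set u := s + c * (s' - s); have uI : s <= u <= s' by exact: inI.
have u01 : 0 <= 1 - u <= v by move: uI => /andP[? ?]; apply/andP; split; lra.
have [uz uz12] := H _ uI; have sub := sq_band_sub z1 v0 u01 uz uz12.
move: uz12 => /andP[uz1 uz2].
pose zz : C := (u%:C)%C * z.
have czz : cmod zz = u * cmod z by [].
have r0 : 0 < v / 8 by rewrite divr_gt0.
have rin : cmod zz + 2 * (v / 8) < 1 by rewrite czz; lra.
have fE : f c = cmod (derive1 F zz) by rewrite /f segE.
have := sm _ _ _ hF' r0 rin; rewrite -fE => S.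
have -> : ((v ^+ 2 * f c `^ p)%:E = 64%:E * ((v / 8) ^+ 2 * f c `^ p)%:E :> \bar R)%E.
  by rewrite -EFinM; congr EFin; field.
rewrite (EFinM 64) -muleA lee_wpmul2l ?lee_fin//; apply: (le_trans S).
rewrite lee_wpmul2l ?lee_fin ?(ltW k00)//.
apply: ge0_subset_integral => //; first exact: measurable_sq.
- by apply: measurableI; [exact: measurable_sq|exact: measurable_band].
- apply: measurable_holo_pow => //; first by apply: measurableI; [exact: measurable_sq|exact: measurable_band].
  by move=> w [_]; exact: band_dset.
- by move=> w _; rewrite lee_fin powR_ge0.
Qed.

(** In dy^(p - 2), dy^p is the p-th power of the step length and dy^(-2) the area normalization of
    the sub-mean value property. The bracket is the price of [pow_sum] for the weights used in
    [chain], which are largest at the scale dy k = t. *)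
Definition chain_coef p (t : R) (k : nat) : R :=
  ((dy k / t) `^ (2^-1) + (dy k / t) `^ (- 2^-1)) * dy k `^ (p - 2).

Lemma chain_coef_ge0 p t k : 0 <= chain_coef p t k.
Proof. by rewrite mulr_ge0 ?addr_ge0 ?powR_ge0. Qed.

Lemma theta_pow p (y : R) : 0 < p -> 0 < y ->
  (y / (1 + y) ^+ 2) `^ (- p) <= 4 `^ p * (y `^ p + y `^ (- p)).
Proof.
move=> p0 y0; have y10 : 0 < 1 + y by rewrite addr_gt0.
have inv x : 0 < x -> x `^ (- p) = (x^-1) `^ p.
  by move=> x0; rewrite -powR_inv1 ?ltW// -powRrM mulN1r.
have m0 : 0 < y / (1 + y) ^+ 2 by rewrite divr_gt0// exprn_gt0.
rewrite !inv// invf_div.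
have h (x : R) : 0 < x -> (1 + y) ^+ 2 / y <= 4 * x ->
    ((1 + y) ^+ 2 / y) `^ p <= 4 `^ p * x `^ p.
  move=> x0 hx; rewrite -powRM ?(ltW x0)//; apply: lepow; [exact: ltW| |exact: hx].
  by rewrite ltW// divr_gt0// exprn_gt0.
have [y1|y1] := leP y 1.
  apply: (@le_trans _ _ (4 `^ p * y^-1 `^ p)); last first.
    by rewrite ler_wpM2l ?powR_ge0// lerDr powR_ge0.
  apply: h; first by rewrite invr_gt0.
  by rewrite ler_pM2r ?invr_gt0//; nra.
apply: (@le_trans _ _ (4 `^ p * y `^ p)); last first.
  by rewrite ler_wpM2l ?powR_ge0// lerDl powR_ge0.
by apply: h => //; rewrite ler_pdivrMr//; nra.
Qed.

(** The scale t is free here and is later set to [tau a z]. The weights are y_k / (1 + y_k)^2 with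
    y_k = (dy k / t)^e; they decay away from the scale t, and their sum is bounded independently of
    t. *)
Lemma chain p : 0 < p -> exists2 c : R, 0 < c & forall F z t, holo F -> cmod z < 1 -> 0 < t ->
  ((cmod (F z) `^ p)%:E <= c%:E * ((cmod (F 0) `^ p)%:E +
     \sum_(0 <= k <oo) ((chain_coef p t k)%:E * bandint p (derive1 F) z (dy k))))%E.
Proof.
move=> p0; have [k0 k00 sm] := sub_mean p0.
(* With e = 1 / (2 p) the p-th powers of the weights turn into powers 1/2 and -1/2 of dy k / t;
   after division by t the exponents of t are -3/2 and -1/2, within the range of [tau_int]. *)
pose e : R := (2 * p)^-1; have e0 : 0 < e by rewrite invr_gt0 mulr_gt0.
pose q : R := 2^-1 `^ e.
have q01 : 0 < q < 1.
  rewrite /q powR_gt0 ?invr_gt0//=.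
  have : (2^-1 : R) `^ e < 1 `^ e.
    by rewrite gt0_ltr_powR// ?nnegrE ?invr_ge0// invf_lt1// ltr1n.
  by rewrite powR1.
pose S := (1 - q)^-1; have S0 : 0 < S by move/andP: q01 => [_ h]; rewrite invr_gt0 subr_gt0.
pose c1 := S `^ p * (8 `^ p * (64 * k0)).
have c10 : 0 < c1 by rewrite mulr_gt0 ?powR_gt0// mulr_gt0 ?powR_gt0// mulr_gt0.
exists (2 `^ p * (1 + c1)); first by rewrite mulr_gt0 ?powR_gt0// addr_gt0.
move=> F z t hF z1 t0.
have za := cmod_ge0 z.
have [K /andP[K1 K2]] : exists K, dy K <= 1 - cmod z <= 2 * dy K by apply: dy_scale; lra.
(* The chain visits (1 - 2^(-k)) z for k <= K; the step from index K to K + 1 jumps to z itself,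
   which is legitimate because 1 - |z| is comparable to 2^(-K). *)
pose s k := if (k <= K)%N then 1 - dy k else 1.
have dyle j k : (j <= k)%N -> dy k <= dy j.
  by move=> jk; rewrite /dy ler_wiXn2l// ?invr_ge0// invf_le1// ler1n.
have st k : exists b, 0 <= b /\ ((k <= K)%N ->
    cmod (F (((s k.+1)%:C)%C * z) - F (((s k)%:C)%C * z)) <= 2 * b * dy k /\
    ((dy k ^+ 2 * b `^ p)%:E <= (64 * k0)%:E * bandint p (derive1 F) z (dy k))%E).
  have [kK|kK] := leqP k K; last by exists 0.
  have v0 := dy_gt0 k; have v1 := dy_le1 k; have vS := dyS k; have v2 := dy_gt0 k.+1.
  have vK := dyle _ _ kK.
  have [b [b0 h1 h2]] : exists b, [/\ 0 <= b,
     cmod (F (((s k.+1)%:C)%C * z) - F (((s k)%:C)%C * z)) <= 2 * b * dy k &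
     ((dy k ^+ 2 * b `^ p)%:E <= (64 * k0)%:E * bandint p (derive1 F) z (dy k))%E].
    have sE : s k = 1 - dy k by rewrite /s kK.
    apply: (chain_step k00) => //.
    - by rewrite sE /s; case: ifP => _; apply/andP; split; lra.
    - by rewrite sE /s; case: ifP => _; lra.
    - by rewrite sE; lra.
    - move=> u /andP[u1 u2]; rewrite sE in u1.
      have u0 : 0 <= u by lra.
      split; first by rewrite cmodM cmod_rc ger0_norm.
      have vb : dy k / 2 <= 1 - u * cmod z.
        move: u2; rewrite /s; case: ifP => [kK'|kK'] u2.
          have : u * cmod z <= u by rewrite ler_piMr// ltW.
          lra.
        have kE : k = K by apply/eqP; rewrite eqn_leq kK leqNgt kK'.
        have : u * cmod z <= cmod z by rewrite ler_piMl.
        by rewrite kE in v0 *; lra.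
      rewrite vb/=; have : (1 - dy k) * cmod z <= u * cmod z by rewrite ler_wpM2r.
      nra.
  by exists b.
have /choice[b bP] := st.
have b0 k : 0 <= b k by have [] := bP k.
have tel n : (n <= K.+1)%N ->
    cmod (F (((s n)%:C)%C * z)) <= cmod (F 0) + \sum_(k < n) 2 * b k * dy k.
  elim: n => [_|n ih nK].
    by rewrite big_ord0 addr0 /s /dy expr0 subrr (_ : (0%:C)%C = 0 :> C) ?mul0r.
  rewrite big_ord_recr/= addrA; have [_ /(_ nK)[h _]] := bP n.
  have -> : F (((s n.+1)%:C)%C * z) =
      F (((s n)%:C)%C * z) + (F (((s n.+1)%:C)%C * z) - F (((s n)%:C)%C * z)) by ring.
  by apply: le_trans (cmodD _ _) _; apply: lerD => //; apply: ih; exact: ltnW.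
have {tel} := tel _ (leqnn _).
have -> : ((s K.+1)%:C)%C * z = z by rewrite /s ltnn (_ : (1%:C)%C = 1 :> C) ?mul1r.
set B := \sum_(k < _) _ => FB.
have B0 : 0 <= B by apply: sumr_ge0 => k _; rewrite !mulr_ge0// ltW// dy_gt0.
have F00 := cmod_ge0 (F 0).
have FBp : cmod (F z) `^ p <= 2 `^ p * (cmod (F 0) `^ p + B `^ p).
  apply: le_trans (powR_add_le (ltW p0) F00 B0).
  by apply: lepow; rewrite ?(ltW p0) ?cmod_ge0.
pose y := t^-1 `^ e; have y0 : 0 < y by rewrite powR_gt0// invr_gt0.
have yq0 k : 0 < y * q ^+ k by move/andP: q01 => [h _]; rewrite mulr_gt0// exprn_gt0.
have yE k : y * q ^+ k = (dy k / t) `^ e.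
  rewrite powRM ?invr_ge0 ?(ltW t0) ?(ltW (dy_gt0 k))// mulrC; congr (_ * _).
  rewrite /q -powR_mulrn ?powR_ge0// -powRrM mulrC powRrM powR_mulrn ?invr_ge0//.
pose m k := (y * q ^+ k) / (1 + y * q ^+ k) ^+ 2.
have m0 k : 0 < m k by rewrite divr_gt0// exprn_gt0// addr_gt0.
have := pow_sum p0 (b := fun k => 2 * b k * dy k) _ m0 (theta_sum K.+1 y0 q01).
rewrite -/B -/S => PS.
have {PS} BS : B `^ p <= S `^ p * \sum_(k < K.+1) (m k `^ (- p) * (2 * b k * dy k) `^ p).
  by apply: PS => k; rewrite !mulr_ge0// ltW// dy_gt0.
have term k : m k `^ (- p) * (2 * b k * dy k) `^ p <=
    8 `^ p * (chain_coef p t k * (dy k ^+ 2 * b k `^ p)).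
  have d0 := dy_gt0 k.
  have ye : (y * q ^+ k) `^ p = (dy k / t) `^ 2^-1.
    by rewrite yE -powRrM; congr (_ `^ _); rewrite /e; field; rewrite gt_eqF.
  have ye' : (y * q ^+ k) `^ (- p) = (dy k / t) `^ (- 2^-1).
    by rewrite yE -powRrM; congr (_ `^ _); rewrite /e; field; rewrite gt_eqF.
  have := theta_pow p0 (yq0 k); rewrite ye ye' -/(m k) => h.
  have -> : (2 * b k * dy k) `^ p = 2 `^ p * (dy k `^ (p - 2) * dy k ^+ 2) * b k `^ p.
    rewrite -(powR_mulrn 2 (ltW d0)) -powRD ?subrK; last by rewrite (gt_eqF d0) implybT.
    by rewrite !powRM ?mulr_ge0 ?(ltW d0)//; ring.
  have -> : (8 : R) `^ p = 4 `^ p * 2 `^ p by rewrite -powRM//; congr (_ `^ _); ring.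
  apply: (le_trans (ler_wpM2r _ h)).
    by rewrite !mulr_ge0 ?powR_ge0 ?exprn_ge0// ltW.
  by rewrite /chain_coef le_eqVlt; apply/orP; left; apply/eqP; ring.
set Z := (X in (_ <= _ * (_ + X))%E).
have Z0 : (0 <= Z)%E.
  apply: nneseries_ge0 => k _ _; rewrite mule_ge0 ?bandint_ge0// lee_fin; exact: chain_coef_ge0.
have BZ : ((B `^ p)%:E <= c1%:E * Z)%E.
  apply: (@le_trans _ _ ((S `^ p * 8 `^ p)%:E *
      \sum_(0 <= k < K.+1) (chain_coef p t k * (dy k ^+ 2 * b k `^ p))%:E)%E).
    rewrite big_mkord sumEFin -EFinM lee_fin; apply: (le_trans BS).
    rewrite -mulrA ler_wpM2l ?powR_ge0// mulr_sumr; apply: ler_sum => k _; exact: term.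
  have -> : c1 = (S `^ p * 8 `^ p) * (64 * k0) by rewrite /c1; ring.
  rewrite (EFinM (_ * _)) -muleA lee_wpmul2l ?lee_fin ?mulr_ge0 ?powR_ge0//.
  apply: (@le_trans _ _ (\sum_(0 <= k < K.+1) ((64 * k0)%:E * ((chain_coef p t k)%:E *
      bandint p (derive1 F) z (dy k))))%E).
    rewrite !big_mkord; apply: lee_sum => k _.
    have [_ h] := bP k; have [_ {}h] := h (leq_ord k).
    rewrite (EFinM (chain_coef _ _ _)) muleCA lee_wpmul2l// lee_fin; exact: chain_coef_ge0.
  rewrite -ge0_sume_distrr; last first.
    by move=> k _; rewrite mule_ge0 ?bandint_ge0// lee_fin chain_coef_ge0.
  rewrite lee_wpmul2l ?lee_fin ?mulr_ge0 ?(ltW k00)//.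
  apply: nneseries_lim_ge => k _ _; rewrite mule_ge0 ?bandint_ge0// lee_fin; exact: chain_coef_ge0.
apply: (@le_trans _ _ ((2 `^ p)%:E * ((cmod (F 0) `^ p)%:E + (B `^ p)%:E))%E).
  by rewrite -EFinD -EFinM lee_fin.
rewrite (EFinM (2 `^ p)) -muleA lee_wpmul2l ?lee_fin ?powR_ge0//.
rewrite ge0_muleDr ?lee_fin ?powR_ge0//; apply: leeD.
  by rewrite -EFinM lee_fin ler_peMl ?powR_ge0// lerDl ltW.
apply: (le_trans BZ); rewrite lee_wpmul2r// lee_fin; lra.
Qed.

End Chain.

(** * Exchange of integrals and overlap of the bands *)

Section Carleson.
Variable R : realType.
Local Notation C := (Cplx R).
Local Notation leb := (@lebesgue_measure R).
Local Notation leb2 := (leb \x leb)%E.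
Implicit Types (F : C -> C) (a : C) (p q v : R).

Lemma leb2_sigma_finite : sigma_finite setT leb2.
Proof.
exists (fun n : nat => sq (0 : C) n.+1%:R).
  apply/esym/seteqP; split => // -[x y] _ /=.
  have [n hn] : exists n : nat, Num.max `|x| `|y| < n%:R.
    by exists (Num.bound (Num.max `|x| `|y|)); rewrite archi_boundP// le_max normr_ge0.
  exists n => //; apply/sqP; rewrite /sqin subr0 /=; have : n%:R <= n.+1%:R :> R by rewrite ler_nat.
  by move: hn; rewrite gt_max => /andP[h1 h2] h3; split; apply: ltW; [apply: lt_le_trans h1 h3|apply: lt_le_trans h2 h3].
move=> n; split; first exact: measurable_sq.
by rewrite leb2_sq ?ltr0n// ltry.
Qed.
(* The sigma-finite structure of leb \x leb is not found by canonical inference. *)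
Definition lebS2 : {sigma_finite_measure set (measurableTypeR R * measurableTypeR R)%type -> \bar R} :=
  HB.pack leb2 (Measure_isSigmaFinite.Build _ _ _ leb2 leb2_sigma_finite).

Lemma measurable_sublevel d (T : measurableType d) (f : T -> R) (c : R) :
  measurable_fun setT f -> measurable [set x | f x <= c].
Proof.
move=> m; have := m measurableT _ (measurable_itv `]-oo, c]); rewrite setTI; congr measurable.
Qed.

(** Tonelli on pairs (z, w): w lies in the square around z exactly when z lies in the square around
    w, so [ka] gets integrated over squares, where it is controlled. *)
Lemma band_swap p F v (ka : R * R -> \bar R) (k : R) : holo F -> 0 < v ->
  measurable_fun setT ka -> (forall w, (0 <= ka w)%E) ->
  (forall w : R * R, (\int[leb2]_(u in sq (pt w) (4 * v) `&` @dset R) ka u <= k%:E)%E) ->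
  measurable_fun (@dset R) (fun z : R * R => (ka z * bandint p F (pt z) v)%E) /\
  (\int[leb2]_(z in @dset R) (ka z * bandint p F (pt z) v) <=
   k%:E * \int[leb2]_(w in band v) ((cmod (F (pt w))) `^ p)%:E)%E.
Proof.
move=> hF v0 mka ka0 kaP.
have mD := @measurable_dset R; have mB := @measurable_band R v.
pose f (w : R * R) := ((cmod (F (pt w))) `^ p)%:E.
pose H := f \_ (band v); pose ka' := ka \_ (@dset R).
have mH : measurable_fun setT H.
  by apply: (measurable_restrictT _ mB).1; exact: measurable_holo_pow (@band_dset R v v0).
have mka' : measurable_fun setT ka'.
  by apply: (measurable_restrictT _ mD).1; exact: measurable_funS mka.
have H0 w : (0 <= H w)%E by rewrite /H /patch; case: ifP => // _; rewrite lee_fin powR_ge0.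
have ka'0 w : (0 <= ka' w)%E by rewrite /ka' /patch; case: ifP.
pose nr : set ((R * R) * (R * R)) :=
  [set u | `|u.2.1 - u.1.1| <= 4 * v] `&` [set u | `|u.2.2 - u.1.2| <= 4 * v].
have mnr : measurable nr.
  apply: measurableI.
    have m : measurable_fun setT (fun u : (R * R) * (R * R) => `|u.2.1 - u.1.1|).
      apply: measurableT_comp => //; apply: measurable_funB.
        by apply: (measurableT_comp measurable_fst); exact: measurable_snd.
      by apply: (measurableT_comp measurable_fst); exact: measurable_fst.
    exact: measurable_sublevel m.
  have m : measurable_fun setT (fun u : (R * R) * (R * R) => `|u.2.2 - u.1.2|).
    apply: measurableT_comp => //; apply: measurable_funB.
      by apply: (measurableT_comp measurable_snd); exact: measurable_snd.
    by apply: (measurableT_comp measurable_snd); exact: measurable_fst.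
  exact: measurable_sublevel m.
pose I (u : (R * R) * (R * R)) : \bar R := (\1_nr u)%:E.
have mI : measurable_fun setT I by apply/measurable_EFinP; exact: measurable_indic.
have I0 u : (0 <= I u)%E by rewrite lee_fin.
pose Phi (u : (R * R) * (R * R)) := (ka' u.1 * (I u * H u.2))%E.
have mIH : measurable_fun setT (fun u => (I u * H u.2)%E).
  by apply: emeasurable_funM => //; exact: measurableT_comp.
have mPhi : measurable_fun setT Phi.
  by apply: emeasurable_funM => //; exact: measurableT_comp.
have Phi0 u : (0 <= Phi u)%E by rewrite mule_ge0// mule_ge0.
have mpair1 (z : R * R) : measurable_fun setT (fun w => (I (z, w) * H w)%E).
  exact: (measurableT_comp mIH (measurable_pair1 z)).
have mpair2 (w : R * R) : measurable_fun setT (fun z => (ka' z * I (z, w))%E).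
  apply: emeasurable_funM => //; exact: (measurableT_comp mI (measurable_pair2 w)).
have bandE z : bandint p F (pt z) v = (\int[leb2]_w (I (z, w) * H w))%E.
  rewrite /bandint integral_mkcond; apply: eq_integral => w _.
  rewrite /H /I /patch in_setI indicE.
  have -> : ((z, w) \in nr) = (w \in sq (pt z) (4 * v)).
    apply/idP/idP; rewrite !inE.
      by move=> [h1 h2]; apply/sqP; split; rewrite ?ReB ?ImB.
    by move=> /sqP; rewrite /sqin ReB ImB => -[h1 h2]; split.
  by case: (_ \in _); case: (_ \in _); rewrite ?mul1e ?mul0e ?mule0.
have E z : ((fun z : R * R => (ka z * bandint p F (pt z) v)%E) \_ (@dset R)) z =
    (\int[leb2]_w Phi (z, w))%E.
  have -> : ((fun z : R * R => (ka z * bandint p F (pt z) v)%E) \_ (@dset R)) z =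
      (ka' z * bandint p F (pt z) v)%E.
    by rewrite /ka' /patch; case: ifP => _ //; rewrite mul0e.
  rewrite bandE -ge0_integralZl//; first exact: mpair1.
  by move=> w _; rewrite mule_ge0.
split.
  apply/(measurable_restrictT _ mD); rewrite (_ : _ \_ _ = fun z => (\int[leb2]_w Phi (z, w))%E).
    exact: (@measurable_fun_fubini_tonelli_F _ _ _ _ R lebS2 Phi mPhi Phi0).
  by apply/funext.
rewrite integral_mkcond; under eq_integral => z _ do rewrite E.
have -> : (\int[leb2]_z \int[leb2]_w Phi (z, w) = \int[leb2]_w \int[leb2]_z Phi (z, w))%E.
  exact: (@fubini_tonelli _ _ _ _ R lebS2 lebS2 Phi mPhi Phi0).
have kk : (0 <= k%:E)%E by apply: le_trans (kaP (0, 0)); exact: integral_ge0.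
rewrite [X in (_ <= _ * X)%E]integral_mkcond -/f -/H -ge0_integralZl//.
apply: ge0_le_integral => //.
- by move=> w _; exact: integral_ge0.
- exact: (@measurable_fun_fubini_tonelli_G _ _ _ _ R lebS2 Phi mPhi Phi0).
- by apply: emeasurable_funM.
move=> w _.
have -> : (\int[leb2]_z Phi (z, w) = H w * \int[leb2]_z (ka' z * I (z, w)))%E.
  rewrite -ge0_integralZl//; last 2 first.
  - exact: mpair2.
  - by move=> z _; rewrite mule_ge0.
  by apply: eq_integral => z _; rewrite /Phi /= muleA muleC.
rewrite muleC lee_wpmul2r//; apply: le_trans (kaP w).
rewrite le_eqVlt; apply/orP; left; apply/eqP.
rewrite [RHS]integral_mkcond; apply: eq_integral => z _.
rewrite /ka' /I /patch in_setI indicE.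
have -> : ((z, w) \in nr) = (z \in sq (pt w) (4 * v)).
  apply/idP/idP; rewrite !inE.
    by move=> [h1 h2]; apply/sqP; split; rewrite ?ReB ?ImB distrC.
  by move=> /sqP; rewrite /sqin ReB ImB => -[h1 h2]; split; rewrite /= distrC.
by case: (_ \in _); case: (_ \in _); rewrite ?mule1 ?mul0e ?mule0.
Qed.

(** For q < 0 the bound x <= c y takes over the part of y <= c x, whence the two-sided hypothesis
    and the absolute value in the constant. *)
Lemma ratio_pow (c x y q : R) : 1 <= c -> 0 < x -> 0 < y -> y <= c * x -> x <= c * y ->
  y `^ q <= c `^ `|q| * x `^ q.
Proof.
move=> c1 x0 y0 h1 h2; have c0 : 0 < c by lra.
have [q0|q0] := leP 0 q.
  by rewrite ger0_norm// -powRM ?(ltW c0) ?(ltW x0)//; apply: lepow => //; exact: ltW.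
rewrite (ltr0_norm q0); have E u : 0 < u -> u `^ q * u `^ (- q) = 1.
  by move=> u0; rewrite mulrC powR_cancel.
have h : x `^ (- q) <= c `^ (- q) * y `^ (- q).
  by rewrite -powRM ?(ltW c0) ?(ltW y0)//; apply: lepow => //; rewrite ?oppr_ge0 ltW.
have -> : y `^ q = y `^ q * x `^ q * x `^ (- q) by rewrite -mulrA E// mulr1.
apply: (@le_trans _ _ (y `^ q * x `^ q * (c `^ (- q) * y `^ (- q)))).
  by rewrite ler_wpM2l// mulr_ge0// powR_ge0.
rewrite [X in X <= _](_ : _ = (y `^ q * y `^ (- q)) * (c `^ (- q) * x `^ q)); last by ring.
by rewrite E// mul1r.
Qed.

(** For each k that counts, y = dy k / t lies in [1/4, 4], where y / (1 + y)^2 >= 4/25; [theta_sum]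
    with ratio 1/2 bounds the sum of all these terms by 2. *)
Lemma band_count (t : R) n : 0 < t ->
  \sum_(k < n) (if dy R k / 4 <= t <= 4 * dy R k then 1 else 0) <= 25 / 2 :> R.
Proof.
move=> t0.
have q01 : 0 < (2^-1 : R) < 1 by apply/andP; split; lra.
have ti0 : 0 < t^-1 by rewrite invr_gt0.
have := theta_sum n ti0 q01.
have -> : (1 - 2^-1)^-1 = 2 :> R by field.
move=> h; apply: (@le_trans _ _ (25 / 4 * 2)); last lra.
apply: le_trans (ler_wpM2l _ h); last by rewrite divr_ge0.
rewrite mulr_sumr; apply: ler_sum => k _.
set y := t^-1 * _; have y0 : 0 < y by rewrite mulr_gt0// dy_gt0.
have yE : y * t = dy R k by rewrite /y mulrAC mulVf ?gt_eqF// mul1r.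
case: ifP => [/andP[h1 h2]|_]; last by rewrite mulr_ge0// divr_ge0 ?exprn_ge0// ltW// addr_gt0.
rewrite -yE in h1 h2.
have y1 : y <= 4 by rewrite -(ler_pM2r t0); lra.
have y2 : 1 <= 4 * y by rewrite -(ler_pM2r t0); lra.
rewrite mulrA ler_pdivlMr ?exprn_gt0 ?addr_gt0//; nra.
Qed.

(** The factor 1 / t comes from [om_le]; 3/2 and 1/2 are the exponents for which [tau_int] is then
    applied. *)
Lemma chain_coef_tau p k (t : R) : 0 < t -> chain_coef p t k * t^-1 =
  dy R k `^ (p - 2) * (dy R k `^ 2^-1 * t `^ (- (3 / 2)) + dy R k `^ (- 2^-1) * t `^ (- (1 / 2))).
Proof.
move=> t0; have d0 := @dy_gt0 R k.
have ti : t^-1 = t `^ (- 1) by rewrite powR_inv1// ltW.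
have D u : (dy R k / t) `^ u = dy R k `^ u * t `^ (- u).
  by rewrite powRM ?invr_ge0 ?(ltW t0) ?(ltW d0)// ti -powRrM mulN1r.
have tD u w : t `^ u * t `^ w = t `^ (u + w) by rewrite powRD// (gt_eqF t0) implybT.
rewrite /chain_coef !D opprK mulrC mulrA mulrDr mulrC; congr (_ * _).
by congr (_ + _); rewrite mulrCA ti tD; congr (_ * _ `^ _); field.
Qed.

End Carleson.

(** * The embedding inequality *)

Section CarlesonEmbedding.
Variable R : realType.
Local Notation C := (Cplx R).
Local Notation leb := (@lebesgue_measure R).
Local Notation leb2 := (leb \x leb)%E.
Implicit Types (F : C -> C) (a : C) (p q v : R).

Lemma band_weight (c v q : R) : 0 <= c -> 0 < v -> v / 4 <= 1 - c <= 4 * v ->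
  v `^ q <= 8 `^ `|q| * (1 - c ^+ 2) `^ q.
Proof.
move=> c0 v0 /andP[h1 h2].
have x1 : 1 - c <= 1 - c ^+ 2 by nra.
have x2 : 1 - c ^+ 2 <= 2 * (1 - c) by nra.
by apply: ratio_pow; lra.
Qed.

Lemma carleson p : 0 < p -> exists2 c : R, 0 < c & forall F a, holo F -> cmod a < 1 ->
  (\int[leb2]_(w in @dset R) (cmod (F (pt w)) `^ p * om a (pt w))%:E <=
   c%:E * ((cmod (F 0) `^ p)%:E + \int[leb2]_(w in @dset R)
      (cmod (derive1 F (pt w)) `^ p * (1 - cmod (pt w) ^+ 2) `^ (p - 1))%:E))%E.
Proof.
move=> p0; have [c0 c00 ch] := @chain R p p0.
(* Exponent 1 handles the term with F(0); 3/2 and 1/2 come from [chain_coef_tau]. *)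
have [k1 k10 T1] : exists2 k, 0 < k & forall a (w : C) (r : R), cmod a < 1 -> 0 < r ->
  (\int[leb2]_(u in sq w r `&` @dset R) (tau a (pt u) `^ (- 1))%:E <= (k * r `^ (2 - 1))%:E)%E.
  by apply: tau_int; apply/andP; split; lra.
have [k2 k20 T2] : exists2 k, 0 < k & forall a (w : C) (r : R), cmod a < 1 -> 0 < r ->
  (\int[leb2]_(u in sq w r `&` @dset R) (tau a (pt u) `^ (- (3 / 2)))%:E <= (k * r `^ (2 - 3 / 2))%:E)%E.
  by apply: tau_int; apply/andP; split; lra.
have [k3 k30 T3] : exists2 k, 0 < k & forall a (w : C) (r : R), cmod a < 1 -> 0 < r ->
  (\int[leb2]_(u in sq w r `&` @dset R) (tau a (pt u) `^ (- (1 / 2)))%:E <= (k * r `^ (2 - 1 / 2))%:E)%E.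
  by apply: tau_int; apply/andP; split; lra.
pose M := k2 * 4 `^ (2 - 3 / 2) + k3 * 4 `^ (2 - 1 / 2).
have M0 : 0 < M by rewrite addr_gt0// mulr_gt0// powR_gt0.
pose A : R := 8 `^ `|p - 1|; have A0 : 0 < A by rewrite powR_gt0.
pose N : R := 25 / 2; have N0 : 0 < N by rewrite divr_gt0.
pose c1 := 2 * c0.
have c10 : 0 < c1 by rewrite mulr_gt0.
exists (c1 * (k1 + M * A * N)); first by rewrite !(mulr_gt0, addr_gt0).
move=> F a hF a1; have hF' := holo_derive1 hF.
have mD := @measurable_dset R.
pose f0 := cmod (F 0) `^ p; have f00 : 0 <= f0 by rewrite powR_ge0.
pose ka k (w : R * R) : \bar R := (dy R k `^ (p - 2) *
  (dy R k `^ 2^-1 * tau a (pt w) `^ (- (3 / 2)) + dy R k `^ (- 2^-1) * tau a (pt w) `^ (- (1 / 2))))%:E.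
have mt q : measurable_fun setT (fun w => tau a (pt w) `^ q).
  by apply/measurable_EFinP; exact: measurable_tau.
have mka k : measurable_fun setT (ka k).
  apply/measurable_EFinP; apply: measurable_funM => //; apply: measurable_funD;
  by apply: measurable_funM.
have ka0 k w : (0 <= ka k w)%E by rewrite lee_fin mulr_ge0 ?addr_ge0 ?mulr_ge0 ?powR_ge0.
pose B k w := bandint p (derive1 F) (pt w) (dy R k).
have B0 k w : (0 <= B k w)%E := bandint_ge0 _ _ _ _.
pose G w := (cmod (derive1 F (pt w)) `^ p * (1 - cmod (pt w) ^+ 2) `^ (p - 1))%:E.
have G0 w : (0 <= G w)%E by rewrite lee_fin mulr_ge0 ?powR_ge0.
have mG : measurable_fun (@dset R) G.
  apply/measurable_EFinP; apply: measurable_funM.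
    by apply/measurable_EFinP; exact: measurable_holo_pow.
  apply: (@measurableT_comp _ _ _ _ _ _ (fun x : R => x `^ (p - 1))) => //.
  apply: measurable_funB => //; apply: measurable_funX.
  exact: measurable_funS (@measurable_pt_cmod R).
(* The powers of dy balance: 1/2 + (2 - 3/2) = -1/2 + (2 - 1/2) = 1, so both terms give dy^(p - 1),
   comparable on the band to the weight of the Dirichlet type norm. *)
have swp k : measurable_fun (@dset R) (fun z : R * R => (ka k z * B k z)%E) /\
    (\int[leb2]_(z in @dset R) (ka k z * B k z) <=
     (dy R k `^ (p - 1) * M)%:E * \int[leb2]_(w in band (dy R k)) (cmod (derive1 F (pt w)) `^ p)%:E)%E.
  have d0 := @dy_gt0 R k; apply: band_swap => // w.
  have d40 : 0 < 4 * dy R k by rewrite mulr_gt0.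
  have mS : measurable (sq (pt w) (4 * dy R k) `&` @dset R).
    by apply: measurableI => //; exact: measurable_sq.
  pose b2 := dy R k `^ (p - 2) * dy R k `^ 2^-1; pose b3 := dy R k `^ (p - 2) * dy R k `^ (- 2^-1).
  have b20 : 0 <= b2 by rewrite mulr_ge0 ?powR_ge0.
  have b30 : 0 <= b3 by rewrite mulr_ge0 ?powR_ge0.
  have kaE u : ka k u = (b2%:E * (tau a (pt u) `^ (- (3 / 2)))%:E +
                         b3%:E * (tau a (pt u) `^ (- (1 / 2)))%:E)%E.
    by rewrite -!EFinM -EFinD /ka mulrDr !mulrA.
  under eq_integral => u _ do rewrite kaE.
  have mtE q : measurable_fun (sq (pt w) (4 * dy R k) `&` @dset R) (fun w => (tau a (pt w) `^ q)%:E).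
    exact: measurable_funS (measurable_tau a q).
  rewrite ge0_integralD//; last 4 first.
  - by move=> u _; rewrite -EFinM lee_fin mulr_ge0// powR_ge0.
  - by apply: measurable_funeM; exact: mtE.
  - by move=> u _; rewrite -EFinM lee_fin mulr_ge0// powR_ge0.
  - by apply: measurable_funeM; exact: mtE.
  rewrite !ge0_integralZl//; last 4 first.
  - exact: mtE.
  - by move=> u _; rewrite lee_fin powR_ge0.
  - exact: mtE.
  - by move=> u _; rewrite lee_fin powR_ge0.
  apply: (@le_trans _ _ (b2%:E * (k2 * (4 * dy R k) `^ (2 - 3 / 2))%:E +
                         b3%:E * (k3 * (4 * dy R k) `^ (2 - 1 / 2))%:E)%E).
    by apply: leeD; rewrite lee_wpmul2l ?lee_fin//; [exact: T2|exact: T3].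
  rewrite -!EFinM -EFinD lee_fin /M mulrDr !powRM ?(ltW d0)// le_eqVlt; apply/orP; left; apply/eqP.
  have X u v : dy R k `^ u * dy R k `^ v = dy R k `^ (u + v) by rewrite powRD// (gt_eqF d0) implybT.
  have -> : dy R k `^ (p - 1) = b2 * dy R k `^ (2 - 3 / 2).
    by rewrite /b2 !X; congr (_ `^ _); field.
  rewrite -mulrA; congr (_ + _); first by ring.
  have -> : b2 * dy R k `^ (2 - 3 / 2) = b3 * dy R k `^ (2 - 1 / 2).
    by rewrite /b2 /b3 !X; congr (_ `^ _); field.
  by ring.
have mkB k := (swp k).1.
pose g k (w : R * R) : R := if dy R k / 4 <= 1 - cmod (pt w) <= 4 * dy R k then 1 else 0.
have g0 k w : (0 <= (g k w)%:E)%E by rewrite lee_fin /g; case: ifP.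
have gE k w : g k w = (w \in band (dy R k))%:R.
  rewrite /g (_ : (w \in _) = (dy R k / 4 <= 1 - cmod (pt w) <= 4 * dy R k)); first by case: ifP.
  by apply/idP/idP; rewrite inE.
have mGD k : measurable_fun (@dset R) (fun w => ((g k w)%:E * G w)%E).
  apply: emeasurable_funM => //; apply/measurable_EFinP.
  rewrite (_ : g k = \1_(band (dy R k))); first exact: measurable_indic (measurable_band _).
  by apply/funext => w; rewrite gE indicE.
have sw2 k : (\int[leb2]_(z in @dset R) (ka k z * B k z) <=
    (M * A)%:E * \int[leb2]_(w in @dset R) ((g k w)%:E * G w))%E.
  have d0 := @dy_gt0 R k; apply: le_trans (swp k).2 _.
  have mb := @measurable_band R (dy R k); have bd := @band_dset R _ d0.
  rewrite mulrC EFinM -muleA (EFinM M) -muleA lee_wpmul2l ?lee_fin ?(ltW M0)//.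
  have -> : (\int[leb2]_(w in @dset R) ((g k w)%:E * G w) = \int[leb2]_(w in band (dy R k)) G w)%E.
    have -> : band (dy R k) = @dset R `&` band (dy R k) by rewrite setIidr.
    rewrite integral_mkcondr; apply: eq_integral => w _; rewrite /patch gE.
    by case: (w \in _); rewrite ?mul1e ?mul0e.
  rewrite -!ge0_integralZl//; last 5 first.
  - exact: measurable_funS mG.
  - by rewrite lee_fin ltW.
  - exact: measurable_holo_pow.
  - by move=> w _; rewrite lee_fin powR_ge0.
  - by rewrite lee_fin powR_ge0.
  apply: ge0_le_integral => //.
  - by move=> w _; rewrite -EFinM lee_fin mulr_ge0 ?powR_ge0.
  - by apply: measurable_funeM; exact: measurable_holo_pow.
  - by apply: measurable_funeM; exact: measurable_funS mG.
  move=> w /andP[h1 h2]; rewrite -!EFinM lee_fin mulrC mulrCA ler_wpM2l ?powR_ge0//.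
  by apply: band_weight => //; [exact: cmod_ge0|apply/andP].
(* By [band_count] the sum over k counts each point of the disc at most N times. *)
have sumG : (\sum_(0 <= k <oo) \int[leb2]_(w in @dset R) ((g k w)%:E * G w) <=
    N%:E * \int[leb2]_(w in @dset R) G w)%E.
  rewrite -integral_nneseries//; last by move=> k w _; rewrite mule_ge0.
  rewrite -ge0_integralZl//; last by rewrite lee_fin ltW.
  apply: ge0_le_integral => //.
  - by move=> w _; apply: nneseries_ge0 => k _ _; rewrite mule_ge0.
  - by apply: ge0_emeasurable_sum => [k w _ _|k _]; [rewrite mule_ge0|exact: mGD].
  - by apply: measurable_funeM; exact: mG.
  move=> w; rewrite /dset /disc /= => w1.
  apply: lime_le; first by apply: is_cvg_nneseries => k _ _; rewrite mule_ge0.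
  apply: nearW => n; rewrite -ge0_sume_distrl; last by move=> k _; exact: g0.
  rewrite lee_wpmul2r// sumEFin lee_fin big_mkord; apply: band_count; lra.
set IG := (\int[leb2]_(w in _) _)%E in sumG *.
have IG0 : (0 <= IG)%E by exact: integral_ge0.
have tot : (\sum_(0 <= k <oo) \int[leb2]_(z in @dset R) (ka k z * B k z) <=
    (M * A * N)%:E * IG)%E.
  apply: (@le_trans _ _ (\sum_(0 <= k <oo) ((M * A)%:E *
      \int[leb2]_(w in @dset R) ((g k w)%:E * G w)))%E).
    apply: lee_nneseries => // k _ _.
    by apply: integral_ge0 => w _; rewrite mule_ge0.
  rewrite nneseriesZl; last by move=> k _; apply: integral_ge0 => w _; rewrite mule_ge0.
  by rewrite (EFinM (M * A)) -muleA lee_wpmul2l// lee_fin mulr_ge0 ?ltW.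
have t1 : (\int[leb2]_(w in @dset R) (tau a (pt w) `^ (- 1))%:E <= k1%:E)%E.
  have DE : @dset R = sq (0 : C) 1 `&` @dset R.
    apply/esym/setIidr => w; rewrite /dset /disc /= => w1.
    apply/sqP; rewrite /sqin subr0; split; apply: le_trans (ltW w1); [exact: Re_le_cmod|exact: Im_le_cmod].
  rewrite DE.
  by apply: le_trans (T1 _ _ _ a1 ltr01) _; rewrite powR1 mulr1.
pose f1 (w : R * R) := (f0%:E * (tau a (pt w) `^ (- 1))%:E)%E.
have mf1 : measurable_fun (@dset R) f1.
  by apply: measurable_funeM; exact: measurable_funS (measurable_tau a (- 1)).
have f10 w : (0 <= f1 w)%E by rewrite /f1 -EFinM lee_fin mulr_ge0 ?powR_ge0.
pose f2 (w : R * R) := (\sum_(0 <= k <oo) (ka k w * B k w))%E.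
have f20 w : (0 <= f2 w)%E by apply: nneseries_ge0 => k _ _; rewrite mule_ge0.
have mf2 : measurable_fun (@dset R) f2.
  by apply: ge0_emeasurable_sum => [k w _ _|k _]; [rewrite mule_ge0|exact: mkB].
have tauP w : dset w -> 0 < tau a (pt w) by move=> w1; exact: tau_gt0.
apply: (@le_trans _ _ (\int[leb2]_(w in @dset R) (c1%:E * (f1 w + f2 w)))%E).
  apply: ge0_le_integral => //.
  - by move=> w _; rewrite lee_fin mulr_ge0 ?powR_ge0 ?om_ge0.
  - apply/measurable_EFinP; apply: measurable_funM.
      by apply/measurable_EFinP; exact: measurable_holo_pow.
    apply: (@eq_measurable_fun _ _ _ _ _
      (fun w => (1 - cmod a ^+ 2) * tau a (pt w) `^ (- 2))).
      move=> w /set_mem/tauP t0; rewrite /om powRN; congr (_ * _^-1).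
      by rewrite -powR_mulrn// ltW.
    by apply: measurable_funM => //; exact: measurable_funS (mt _).
  - by apply: measurable_funeM; exact: emeasurable_funD.
  move=> w w1; have t0 := tauP _ w1.
  (* [om_le] leaves a factor 2 / tau, and [chain] is used at the scale t = tau, separately for each
     point w. *)
  apply: (@le_trans _ _ ((2 * (tau a (pt w))^-1)%:E * (cmod (F (pt w)) `^ p)%:E)%E).
    by rewrite -EFinM lee_fin mulrC ler_wpM2r ?powR_ge0// om_le.
  apply: le_trans (lee_wpmul2l _ (ch F (pt w) _ hF w1 t0)) _.
    by rewrite lee_fin mulr_ge0// invr_ge0 ltW.
  rewrite muleA -EFinM (_ : 2 * _ * c0 = c1 * (tau a (pt w))^-1); last by rewrite /c1; ring.
  rewrite EFinM -muleA lee_wpmul2l ?lee_fin ?(ltW c10)//.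
  rewrite ge0_muleDr ?lee_fin//; last first.
    by apply: nneseries_ge0 => k _ _; rewrite mule_ge0 ?bandint_ge0// lee_fin chain_coef_ge0.
  apply: leeD; first by rewrite /f1 -!EFinM lee_fin powR_inv1 ?(ltW t0)// mulrC.
  rewrite -nneseriesZl; last first.
    by move=> k _; rewrite mule_ge0 ?bandint_ge0// lee_fin chain_coef_ge0.
  rewrite le_eqVlt; apply/orP; left; apply/eqP; apply: eq_eseriesr => k _.
  by rewrite muleA -EFinM mulrC chain_coef_tau.
rewrite ge0_integralZl//; last 3 first.
- exact: emeasurable_funD.
- by move=> w _; rewrite adde_ge0.
- by rewrite lee_fin ltW.
rewrite ge0_integralD// ge0_integralZl//; last 2 first.
- exact: measurable_funS (measurable_tau a (- 1)).
- by move=> w _; rewrite lee_fin powR_ge0.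
rewrite integral_nneseries//; last by move=> k w _; rewrite mule_ge0.
rewrite (EFinM c1) -muleA lee_wpmul2l ?lee_fin ?(ltW c10)//.
have k10' := ltW k10; have MAN : 0 <= M * A * N by rewrite !mulr_ge0 ?ltW.
rewrite [leRHS]ge0_muleDr ?lee_fin//.
apply: leeD.
  apply: (@le_trans _ _ (f0%:E * k1%:E)%E); first by rewrite lee_wpmul2l ?lee_fin.
  by rewrite -!EFinM lee_fin mulrC ler_wpM2r// lerDl.
by apply: (le_trans tot); rewrite lee_wpmul2r// lee_fin lerDr.
Qed.

End CarlesonEmbedding.

(** * Test functions *)

Section WeightedKernel.
Variable R : realType.
Local Notation C := (Cplx R).
Local Notation leb := (@lebesgue_measure R).
Local Notation leb2 := (leb \x leb)%E.
Implicit Types (q m s t x : R).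

(* phi bounds the restriction of tau^-(beta + q) W^(q - 1) to a slice of the disc,
   s being the distance to the endpoint of the slice and m the distance of the
   slice to the pole; s |-> (s / (s + m))^q / (q m) is a primitive. *)
Definition phi q m s : R :=
  \1_(`]0, 1]%classic : set R) s * (s `^ (q - 1) * (s + m) `^ (- (q + 1))).

Lemma phi_ge0 q m s : 0 <= phi q m s.
Proof. by rewrite /phi mulr_ge0// mulr_ge0 ?powR_ge0. Qed.

Lemma integral_scaleD d (T : measurableType d) (mu : {measure set T -> \bar R}) (f g : T -> R) (c : R) :
  0 <= c -> measurable_fun setT (fun w => (f w)%:E) -> measurable_fun setT (fun w => (g w)%:E) ->
  (forall w, 0 <= f w) -> (forall w, 0 <= g w) ->
  (\int[mu]_w (c%:E * ((f w)%:E + (g w)%:E)) = c%:E * (\int[mu]_w (f w)%:E + \int[mu]_w (g w)%:E))%E.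
Proof.
move=> c0 mf mg f0 g0; rewrite ge0_integralZl//; last 2 first.
- exact: emeasurable_funD.
- by move=> s _; rewrite -EFinD lee_fin addr_ge0.
by rewrite ge0_integralD// => s _; rewrite lee_fin.
Qed.

Lemma powR_pred u e : 0 < u -> u `^ e = u `^ (e - 1) * u :> R.
Proof.
by move=> u0; rewrite -[X in _ = _ * X](powRr1 (ltW u0)) -powRD ?subrK// (gt_eqF u0) implybT.
Qed.

(** For q < 1 the integrand is unbounded at 0: the fundamental theorem is applied on [1/(n+1), 1],
    and the increasing intervals exhaust ]0, 1]. *)
Lemma phi_int q m : 0 < q -> 0 < m -> (\int[leb]_s (phi q m s)%:E <= ((q * m)^-1)%:E)%E.
Proof.
move=> q0 m0; have qm0 : 0 < q * m by rewrite mulr_gt0.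
pose f s := (1 * s + 0) `^ (q - 1) * (1 * s + m) `^ (- (q + 1)).
have -> : (\int[leb]_s (phi q m s)%:E = \int[leb]_(s in `]0%R, 1%R]) (f s)%:E)%E.
  rewrite [RHS]integral_mkcond; apply: eq_integral => s _.
  by rewrite /patch /phi /f indicE !mul1r addr0; case: (s \in _); rewrite ?mul1r ?mul0r.
pose D (n : nat) : set R := `[n.+1%:R^-1, 1]%classic.
have mf : measurable_fun setT (fun s => (f s)%:E).
  apply/measurable_EFinP; apply: measurable_funM.
    apply: (@measurableT_comp _ _ _ _ _ _ (fun x : R => x `^ (q - 1))) => //.
    by apply: measurable_funD => //; apply: measurable_funM.
  apply: (@measurableT_comp _ _ _ _ _ _ (fun x : R => x `^ (- (q + 1)))) => //.
  by apply: measurable_funD => //; apply: measurable_funM.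
have f0 s : (0 <= (f s)%:E)%E by rewrite lee_fin mulr_ge0 ?powR_ge0.
have -> : `]0, 1]%classic = \bigcup_n D n.
  apply/seteqP; split => s /=.
    rewrite in_itv/= => /andP[s0 s1]; exists (Num.bound s^-1) => //.
    rewrite /D /= in_itv/= s1 andbT invf_ple ?posrE//.
    have : s^-1 < (Num.bound s^-1)%:R by rewrite archi_boundP// invr_ge0 ltW.
    by move=> h; apply: ltW; apply: lt_trans h _; rewrite ltr_nat.
  move=> [n _]; rewrite /D /= !in_itv/= => /andP[h1 ->]; rewrite andbT.
  by apply: lt_le_trans h1; rewrite invr_gt0.
have mD n : measurable (D n) by exact: measurable_itv.
have mfD n : measurable_fun (D n) (fun s => (f s)%:E) by exact: measurable_funS mf.
have ndD : {homo D : n k / (n <= k)%N >-> (n <= k)%O}.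
  move=> n k nk; apply/subsetPset => s; rewrite /D /= !in_itv/= => /andP[h1 ->].
  rewrite andbT; apply: le_trans h1; rewrite lef_pV2 ?posrE// ler_nat//.
have cv := @ge0_nondecreasing_set_cvg_integral _ (measurableTypeR R) R D _
  (leb : {measure set (measurableTypeR R) -> \bar R}) ndD mD mfD (fun _ s _ => f0 s).
rewrite -(cvg_lim _ cv)//; apply: lime_le; first exact: (cvgP _ cv).
apply: nearW => n.
have n0 : 0 < n.+1%:R^-1 :> R by rewrite invr_gt0.
have n1 : n.+1%:R^-1 <= 1 :> R by rewrite invf_le1// ler1n.
pose F s := (q * m)^-1 * ((1 * s + 0) `^ q * (1 * s + m) `^ (- q)).
have -> : (\int[leb]_(x in D n) (f x)%:E = (F 1 - F n.+1%:R^-1)%:E)%E.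
  apply: FTC_itv => //.
  - move=> s /andP[s1 _]; have s0 : 0 < s := lt_le_trans n0 s1.
    have p1 : 0 < 1 * s + 0 by rewrite mul1r addr0.
    have p2 : 0 < 1 * s + m by rewrite mul1r addr_gt0.
    have := is_deriveZ (q * m)^-1 (is_deriveM (is_derive_pow_affine q p1) (is_derive_pow_affine (- q) p2)).
    rewrite /GRing.scale/=.
    set l := (X in is_derive _ _ _ X) => h; rewrite (_ : f s = l)//.
    rewrite /l /f !mulr1.
    have e1 := powR_pred q p1; have e2 := powR_pred (- q) p2.
    rewrite (_ : - q - 1 = - (q + 1)) in e2 *; last by ring.
    set A := _ `^ (q - 1) in e1 *; set B := _ `^ (- (q + 1)) in e2 *.
    rewrite e1 e2 !mul1r addr0; field.
    by rewrite (gt_eqF q0) (gt_eqF m0).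
  - move=> s /andP[s1 _]; have s0 : 0 < s := lt_le_trans n0 s1.
    have p1 : 0 < 1 * s + 0 by rewrite mul1r addr0.
    have p2 : 0 < 1 * s + m by rewrite mul1r addr_gt0.
    exact: (is_derive_cont (is_deriveM (is_derive_pow_affine (q - 1) p1) (is_derive_pow_affine (- (q + 1)) p2))).
rewrite lee_fin; have Fn : 0 <= F (n.+1%:R^-1).
  by rewrite /F !mulr_ge0 ?powR_ge0// invr_ge0 ltW.
apply: (@le_trans _ _ (F 1)); first by rewrite lerBlDr lerDl.
rewrite /F -[leRHS]mulr1 ler_pM2l ?invr_gt0// mul1r addr0 powR1 mul1r powRN.
rewrite invf_le1 ?powR_gt0 ?addr_gt0//.
rewrite (_ : 1 = 1 `^ q); last by rewrite powR1.
by apply: lepow => //; [exact: ltW|rewrite powR1 lerDl ltW].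
Qed.

Definition halfchord t : R := Num.sqrt (1 - t ^+ 2).

Lemma measurable_halfchord : measurable_fun setT halfchord.
Proof.
apply: (@measurableT_comp _ _ _ _ _ _ (@Num.sqrt R)).
  by apply: continuous_measurable_fun; exact: sqrt_continuous.
by apply: measurable_funB => //; exact: measurable_funX.
Qed.

Section Slices.
Variables (q beta eta b : R).
Hypotheses (q0 : 0 < q) (b1 : 1 < beta) (eta0 : 0 < eta) (bb : `|b| <= 1).

(** Majorant of the kernel on horizontal slices: one [phi] for each endpoint of the chord, with m =
    [wt eta b t] at height t, and a cut-off to |t| <= 1. *)
Definition psi (w : R * R) : R :=
  wt eta b w.2 `^ (- (beta - 1)) *
  (phi q (wt eta b w.2) (halfchord w.2 - w.1) + phi q (wt eta b w.2) (halfchord w.2 + w.1)) *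
  \1_(`[-1, 1]%classic : set R) w.2.

Lemma psi_ge0 w : 0 <= psi w.
Proof. by rewrite /psi !mulr_ge0 ?powR_ge0 ?addr_ge0 ?phi_ge0. Qed.

Lemma measurable_phi d (T : measurableType d) (f g : T -> R) :
  measurable_fun setT f -> measurable_fun setT g ->
  measurable_fun setT (fun w => phi q (f w) (g w)).
Proof.
move=> mf mg; apply: measurable_funM.
  by apply: measurableT_comp => //; exact: measurable_indic.
apply: measurable_funM.
  by apply: (@measurableT_comp _ _ _ _ _ _ (fun x : R => x `^ (q - 1))).
apply: (@measurableT_comp _ _ _ _ _ _ (fun x : R => x `^ (- (q + 1)))) => //.
exact: measurable_funD.
Qed.

Lemma measurable_psi : measurable_fun setT (fun w => (psi w)%:E).
Proof.
have mw : measurable_fun setT (fun w : R * R => wt eta b w.2).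
  apply: measurable_funD => //; apply: measurableT_comp => //.
  by apply: measurable_funB => //; exact: measurable_snd.
have mh : measurable_fun setT (fun w : R * R => halfchord w.2).
  by apply: (measurableT_comp measurable_halfchord); exact: measurable_snd.
apply/measurable_EFinP; apply: measurable_funM; last first.
  by apply: measurableT_comp; [exact: measurable_indic|exact: measurable_snd].
apply: measurable_funM.
  by apply: (@measurableT_comp _ _ _ _ _ _ (fun x : R => x `^ (- (beta - 1)))).
apply: measurable_funD; apply: measurable_phi => //.
  by apply: measurable_funB => //; exact: measurable_fst.
by apply: measurable_funD => //; exact: measurable_fst.
Qed.

Lemma psi_slice t : (\int[leb]_s (psi (s, t))%:E <=
  (2 / q * (wt eta b t `^ (- beta) * \1_(`[-1, 1]%classic : set R) t))%:E)%E.
Proof.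
set m := wt eta b t; set i : R := \1__ t.
have m0 : 0 < m by apply: lt_le_trans (wt_ge _ _ _).
have i0 : 0 <= i by [].
pose c := m `^ (- (beta - 1)) * i.
have c0 : 0 <= c by rewrite mulr_ge0// powR_ge0.
have mphi : measurable_fun setT (fun s => (phi q m s)%:E).
  by apply/measurable_EFinP; apply: measurable_phi.
have ph0 s : (0 <= (phi q m s)%:E)%E by rewrite lee_fin phi_ge0.
pose f1 s := phi q m (halfchord t - s); pose f2 s := phi q m (halfchord t + s).
have r1 : (\int[leb]_s (f1 s)%:E = \int[leb]_s (phi q m s)%:E)%E := integral_refl (halfchord t) mphi ph0.
have r2 : (\int[leb]_s (f2 s)%:E = \int[leb]_s (phi q m s)%:E)%E := integral_shift (halfchord t) mphi ph0.
have m1 : measurable_fun setT (fun s => (f1 s)%:E).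
  by apply/measurable_EFinP; apply: measurable_phi; [exact: measurable_cst|apply: measurable_funB => //; exact: measurable_cst].
have m2 : measurable_fun setT (fun s => (f2 s)%:E).
  by apply/measurable_EFinP; apply: measurable_phi; [exact: measurable_cst|apply: measurable_funD => //; exact: measurable_cst].
have -> : (\int[leb]_s (psi (s, t))%:E = \int[leb]_s (c%:E *
   ((f1 s)%:E + (f2 s)%:E)))%E.
  by apply: eq_integral => s _; rewrite -EFinD -EFinM /psi /c /= -/m -/i mulrAC.
rewrite (integral_scaleD leb c0 m1 m2 (fun s => phi_ge0 _ _ _) (fun s => phi_ge0 _ _ _)).
rewrite r1 r2; have h := phi_int q0 m0.
apply: (@le_trans _ _ (c%:E * (((q * m)^-1)%:E + ((q * m)^-1)%:E))%E).
  by apply: lee_wpmul2l; [rewrite lee_fin|exact: leeD].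
rewrite -EFinD -EFinM lee_fin /c le_eqVlt; apply/orP; left; apply/eqP.
have -> : m `^ (- (beta - 1)) = m `^ (- beta) * m.
  rewrite (_ : - (beta - 1) = 1 - beta); last by ring.
  rewrite (powR_pred _ m0) (_ : 1 - beta - 1 = - beta); last by ring.
  reflexivity.
by field; rewrite (gt_eqF q0) (gt_eqF m0).
Qed.

Lemma psi_double : (\int[leb]_t \int[leb]_s (psi (s, t))%:E <=
  (2 / q * (2 / (beta - 1)) * eta `^ (1 - beta))%:E)%E.
Proof.
pose I := `[-1, 1]%classic : set R.
have mw : measurable_fun setT (fun t => (wt eta b t `^ (- beta))%:E) by exact: measurable_wt.
have mi : measurable_fun setT (fun t => (wt eta b t `^ (- beta) * \1_I t)%:E).
  apply/measurable_EFinP; apply: measurable_funM; first by apply/measurable_EFinP.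
  by apply: measurable_indic; exact: measurable_itv.
apply: (@le_trans _ _ (\int[leb]_t ((2 / q)%:E * (wt eta b t `^ (- beta) * \1_I t)%:E))%E).
  apply: ge0_le_integral => //.
  - by move=> t _; apply: integral_ge0 => s _; rewrite lee_fin psi_ge0.
  - have h := (@measurable_fun_fubini_tonelli_G _ _ _ _ R leb (fun w => (psi w)%:E) measurable_psi).
    by apply: h => w; rewrite lee_fin psi_ge0.
  - exact: measurable_funeM.
  - by move=> t _; rewrite -EFinM; exact: psi_slice.
rewrite ge0_integralZl//; last 2 first.
- by move=> t _; rewrite lee_fin mulr_ge0 ?powR_ge0.
- by rewrite lee_fin divr_ge0// ltW.
rewrite -mulrA (EFinM (2 / q)) lee_wpmul2l ?lee_fin ?divr_ge0 ?(ltW q0)//.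
have -> : (\int[leb]_t (wt eta b t `^ (- beta) * \1_I t)%:E = \int[leb]_(t in I) (wt eta b t `^ (- beta))%:E)%E.
  rewrite [RHS]integral_mkcond; apply: eq_integral => t _.
  by rewrite /patch indicE; case: (_ \in _); rewrite ?mulr1 ?mulr0.
have T0 : 0 <= 2 :> R by [].
apply: le_trans (int_wt_tail b eta0 T0 b1).
apply: ge0_subset_integral => //.
- exact: measurable_itv.
- exact: measurable_funS mw.
- by move=> t _; rewrite lee_fin powR_ge0.
- move=> t; rewrite /I /= !in_itv/= => /andP[h1 h2].
  by move: bb; rewrite ler_norml => /andP[h3 h4]; apply/andP; split; lra.
Qed.

(** The second bound, with the coordinates exchanged, serves the vertical slices; it is the same
    iterated integral, reached by Fubini in the other order. *)
Lemma psi_int : (\int[leb2]_w (psi w)%:E <= (2 / q * (2 / (beta - 1)) * eta `^ (1 - beta))%:E)%E /\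
  (\int[leb2]_w (psi (w.2, w.1))%:E <= (2 / q * (2 / (beta - 1)) * eta `^ (1 - beta))%:E)%E.
Proof.
have p0 w : (0 <= (psi w)%:E)%E by rewrite lee_fin psi_ge0.
split; last first.
  rewrite (@fubini_tonelli1 _ _ _ _ R leb leb (fun w => (psi (w.2, w.1))%:E)) //.
    exact: psi_double.
  by apply: (measurableT_comp measurable_psi); exact: measurable_swap.
rewrite (@fubini_tonelli2 _ _ _ _ R leb leb (fun w => (psi w)%:E)) //.
  exact: psi_double.
exact: measurable_psi.
Qed.

(** For |t| <= 4/5 the half-chord X is at least 3/5, so W = (X - |x|)(X + |x|) is at least 3/5 of u
    = X - |x|, the distance to the circle along the slice. Hence u + m <= 6 T, and q <= 1 turns the
    lower bound for W into an upper bound for W^(q - 1). *)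
Lemma psi_pt x t T W : x ^+ 2 + t ^+ 2 < 1 -> `|t| <= 4 / 5 -> q <= 1 ->
  W = 1 - x ^+ 2 - t ^+ 2 -> W <= 2 * T -> wt eta b t <= 2 * T ->
  T `^ (- (beta + q)) * W `^ (q - 1) <= 6 `^ (beta + q) * (3 / 5) `^ (q - 1) * psi (x, t).
Proof.
have q0' := q0; have b1' := b1; move=> xt t45 q1 WE WT; set m := wt eta b t => mT.
have m0 : 0 < m by apply: lt_le_trans (wt_ge _ _ _).
have x0 := normr_ge0 x; have xx : `|x| ^+ 2 = x ^+ 2 by rewrite real_normK// num_real.
have tt : `|t| ^+ 2 = t ^+ 2 by rewrite real_normK// num_real.
have t0 := normr_ge0 t.
set X := halfchord t; have X0 : 0 <= X by exact: sqrtr_ge0.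
have t16 : t ^+ 2 <= 16 / 25 by rewrite -tt; nra.
have XX : X ^+ 2 = 1 - t ^+ 2 by rewrite sqr_sqrtr//; lra.
have X35 : 3 / 5 <= X by rewrite -(ler_sqr (_ : _ \is Num.nneg)) ?nnegrE//; lra.
have X1 : X <= 1 by rewrite -(ler_sqr (_ : _ \is Num.nneg)) ?nnegrE//; have := sqr_ge0 t; lra.
have xX : `|x| < X by rewrite -(ltr_sqr (_ : _ \is Num.nneg)) ?nnegrE//; lra.
pose u := X - `|x|; have u0 : 0 < u by rewrite /u; lra.
have u1 : u <= 1 by rewrite /u; lra.
have Wu : 3 / 5 * u <= W.
  have e : u * (X + `|x|) = X ^+ 2 - `|x| ^+ 2 by rewrite /u; ring.
  have -> : W = u * (X + `|x|) by rewrite e WE XX xx; ring.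
  by rewrite mulrC ler_pM2l//; lra.
have T0 : 0 < T by lra.
have um : (u + m) <= 6 * T by lra.
have phiE : phi q m u = u `^ (q - 1) * (u + m) `^ (- (q + 1)).
  by rewrite /phi indicE mem_set ?mul1r//= in_itv/= u0 u1.
have ph : phi q m u <= phi q m (X - x) + phi q m (X + x).
  rewrite /u; have [xs|xs] := leP 0 x; first by rewrite (ger0_norm xs) lerDl phi_ge0.
  by rewrite (ltr0_norm xs) opprK lerDr phi_ge0.
have i1 : \1_(`[-1, 1]%classic : set R) t = 1 :> R.
  by rewrite indicE mem_set//= in_itv/= -ler_norml; lra.
rewrite /psi /= -/m -/X i1 mulr1.
have s1 : W `^ (q - 1) <= (3 / 5) `^ (q - 1) * u `^ (q - 1).
  rewrite -powRM ?(ltW u0)// -[q - 1]opprK; apply: powR_neg_le => //; first lra.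
  by rewrite mulr_gt0.
have m_le : m <= u + m by rewrite lerDr ltW.
have um0 : 0 < u + m by rewrite addr_gt0.
have s2 : T `^ (- (beta + q)) <= 6 `^ (beta + q) * (m `^ (- (beta - 1)) * (u + m) `^ (- (q + 1))).
  apply: (@le_trans _ _ (((u + m) / 6) `^ (- (beta + q)))).
    by apply: powR_neg_le; lra.
  have -> : ((u + m) / 6) `^ (- (beta + q)) = 6 `^ (beta + q) * (u + m) `^ (- (beta + q)).
    rewrite powRM ?(ltW um0) ?invr_ge0// mulrC -powR_inv1// -powRrM.
    by rewrite (_ : -1 * - (beta + q) = beta + q)//; ring.
  rewrite ler_wpM2l ?powR_ge0//.
  have -> : (u + m) `^ (- (beta + q)) = (u + m) `^ (- (beta - 1)) * (u + m) `^ (- (q + 1)).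
    by rewrite -powRD ?(gt_eqF um0) ?implybT//; congr (_ `^ _); ring.
  by rewrite ler_wpM2r ?powR_ge0//; apply: powR_neg_le => //; lra.
apply: le_trans (ler_pM _ _ s2 s1) _; rewrite ?powR_ge0//.
have -> : 6 `^ (beta + q) * (m `^ (- (beta - 1)) * (u + m) `^ (- (q + 1))) *
    ((3 / 5) `^ (q - 1) * u `^ (q - 1)) =
    6 `^ (beta + q) * (3 / 5) `^ (q - 1) * (m `^ (- (beta - 1)) * phi q m u).
  by rewrite phiE; ring.
apply: ler_wpM2l; first by rewrite mulr_ge0 ?powR_ge0.
by apply: ler_wpM2l; first exact: powR_ge0.
Qed.

End Slices.

(* Horizontal slices where |Im z| <= 4/5, vertical slices elsewhere. *)
Lemma tau_weight_int q beta : 0 < q <= 1 -> 1 < beta -> exists2 k : R, 0 < k & forall a : C, cmod a < 1 ->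
  (\int[leb2]_(w in @dset R) (tau a (pt w) `^ (- (beta + q)) * (1 - cmod (pt w) ^+ 2) `^ (q - 1))%:E <=
   (k * (1 - cmod a) `^ (1 - beta))%:E)%E.
Proof.
move=> /andP[q0 q1] b1; pose c := 6 `^ (beta + q) * (3 / 5) `^ (q - 1) : R.
have c0 : 0 < c by rewrite mulr_gt0 ?powR_gt0// divr_gt0.
pose K := 2 / q * (2 / (beta - 1)); have K0 : 0 < K.
  by rewrite mulr_gt0 ?divr_gt0// subr_gt0.
exists (c * (K + K)); first by rewrite mulr_gt0// addr_gt0.
move=> a a1; have e0 : 0 < 1 - cmod a by rewrite subr_gt0.
have ra : `|complex.Re a| <= 1 := le_trans (Re_le_cmod a) (ltW a1).
have ia : `|complex.Im a| <= 1 := le_trans (Im_le_cmod a) (ltW a1).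
pose P1 w := psi q beta (1 - cmod a) (complex.Im a) w.
pose P2 (w : R * R) := psi q beta (1 - cmod a) (complex.Re a) (w.2, w.1).
have mP1 : measurable_fun setT (fun w => (P1 w)%:E) by exact: measurable_psi.
have mP2 : measurable_fun setT (fun w => (P2 w)%:E).
  by apply: (measurableT_comp (measurable_psi _ _ _ _)); exact: measurable_swap.
have P10 w : 0 <= P1 w by exact: psi_ge0.
have P20 w : 0 <= P2 w by exact: psi_ge0.
have mD := @measurable_dset R.
apply: (@le_trans _ _ (\int[leb2]_w (c%:E * ((P1 w)%:E + (P2 w)%:E)))%E).
  apply: (@le_trans _ _ (\int[leb2]_(w in @dset R) (c%:E * ((P1 w)%:E + (P2 w)%:E)))%E).
    apply: ge0_le_integral => //.
    - by move=> w _; rewrite lee_fin mulr_ge0 ?powR_ge0.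
    - apply/measurable_EFinP; apply: measurable_funM.
        by apply/measurable_EFinP; exact: measurable_funS (measurable_tau _ _).
      apply: (@measurableT_comp _ _ _ _ _ _ (fun x : R => x `^ (q - 1))) => //.
      apply: measurable_funB => //; apply: measurable_funX.
      exact: measurable_funS (@measurable_pt_cmod R).
    - by apply: measurable_funeM; apply: emeasurable_funD; [exact: measurable_funS mP1|exact: measurable_funS mP2].
    move=> w w1; have w2 : cmod (pt w) < 1 by [].
    rewrite -EFinD -EFinM lee_fin.
    have cw : cmod (pt w) ^+ 2 = w.1 ^+ 2 + w.2 ^+ 2 by rewrite cmod_sqr.
    have c2 : w.1 ^+ 2 + w.2 ^+ 2 < 1 by rewrite -cw expr_lt1 ?cmod_ge0.
    have Wt : 1 - cmod (pt w) ^+ 2 <= 2 * tau a (pt w).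
      have h1 : 1 - cmod (pt w) <= tau a (pt w).
        have := ler_cmodB 1 (a^*%C * pt w); rewrite cmod1 cmodM cmod_conj -/(tau a (pt w)).
        by have := cmod_ge0 (pt w); nra.
      by have := cmod_ge0 (pt w); nra.
    have [t45|t45] := leP `|w.2| (4 / 5).
      have := psi_pt (b := complex.Im a) q0 b1 e0 c2 t45 q1 (W := 1 - cmod (pt w) ^+ 2) (T := tau a (pt w)).
      have E : 1 - cmod (pt w) ^+ 2 = 1 - w.1 ^+ 2 - w.2 ^+ 2 by rewrite cw; ring.
      move=> /(_ E Wt (tau_wt_Im a1 w2)); rewrite -surjective_pairing => h.
      by apply: le_trans (h) _; rewrite -/c ler_pM2l// lerDl.
    have t45' : `|w.1| <= 4 / 5.
      have h1 := normr_ge0 w.1; have h2 : `|w.1| ^+ 2 = w.1 ^+ 2 by rewrite real_normK// num_real.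
      have h3 : `|w.2| ^+ 2 = w.2 ^+ 2 by rewrite real_normK// num_real.
      have h4 : 0 <= 4 / 5 :> R by rewrite divr_ge0.
      rewrite -(ler_sqr (_ : _ \is Num.nneg)) ?nnegrE//.
      rewrite h2; rewrite -h3 in c2; nra.
    have c2' : w.2 ^+ 2 + w.1 ^+ 2 < 1 by rewrite addrC.
    have := psi_pt (b := complex.Re a) q0 b1 e0 c2' t45' q1 (W := 1 - cmod (pt w) ^+ 2) (T := tau a (pt w)).
    have E : 1 - cmod (pt w) ^+ 2 = 1 - w.2 ^+ 2 - w.1 ^+ 2 by rewrite cw; ring.
    move=> /(_ E Wt (tau_wt_Re a1 w2)) h.
    by apply: le_trans (h) _; rewrite -/c ler_pM2l// lerDr.
  apply: ge0_subset_integral => //.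
    by apply: measurable_funeM; apply: emeasurable_funD.
  by move=> w _; rewrite -EFinD -EFinM lee_fin mulr_ge0 ?addr_ge0 ?(ltW c0).
rewrite (integral_scaleD leb2 (ltW c0) mP1 mP2 P10 P20).
rewrite -mulrA (EFinM c) lee_wpmul2l ?lee_fin ?(ltW c0)//.
rewrite mulrDl EFinD; apply: leeD.
  exact: (psi_int q0 b1 e0 ia).1.
exact: (psi_int q0 b1 e0 ra).2.
Qed.

End WeightedKernel.

(** * Functions extended by zero and the Dirichlet type norm *)

Section DiscExtension.
Variable R : realType.
Local Notation C := (Cplx R).
Local Notation leb := (@lebesgue_measure R).
Local Notation leb2 := (leb \x leb)%E.
Implicit Types (F f : C -> C) (a z : C) (p q : R).

Lemma disc_near z : cmod z < 1 -> exists2 d, 0 < d & forall w, cmod (w - z) < d -> cmod w < 1.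
Proof.
move=> z1; exists (1 - cmod z); first by rewrite subr_gt0.
by move=> w; have := ler_cmodB w z; lra.
Qed.

Lemma has_deriv_disc F G z l : cmod z < 1 -> (forall w, cmod w < 1 -> F w = G w) ->
  has_deriv F z l -> has_deriv G z l.
Proof.
move=> z1 FG; have [d d0 dP] := disc_near z1.
by apply: (has_deriv_eq d0) => w /dP; exact: FG.
Qed.

Lemma holo_eq F G : (forall w, cmod w < 1 -> F w = G w) -> holo F -> holo G.
Proof. by move=> FG hF z z1; have [l hl] := hF z z1; exists l; exact: (has_deriv_disc z1 FG). Qed.

Lemma holo_has_deriv F z : holo F -> cmod z < 1 -> has_deriv F z (derive1 F z).
Proof. by move=> hF /hF[l hl]; rewrite (has_deriv_derive1 hl). Qed.

Lemma restr_disc F z : cmod z < 1 -> (F \_ (@disc R)) z = F z.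
Proof. by move=> z1; rewrite patchE mem_set. Qed.

Lemma hol_discE f : hol_disc f <-> holo f /\ (forall z, ~ disc z -> f z = 0).
Proof.
split=> -[h1 h2]; split=> // z z1.
  by exists (derive1 f z); apply: derivable_has_deriv; exact: h1.
by have [l hl] := h1 z z1; exact: has_deriv_derivable hl.
Qed.

Lemma holoB F G : holo F -> holo G -> holo (fun z => F z - G z).
Proof. by move=> hF hG z z1; eexists; apply: has_derivB; exact: holo_has_deriv. Qed.

Lemma holoM F G : holo F -> holo G -> holo (fun z => F z * G z).
Proof. by move=> hF hG z z1; eexists; apply: has_derivM; exact: holo_has_deriv. Qed.

Lemma holo_cst (c : C) : holo (fun=> c).
Proof. by move=> z _; exists 0; exact: has_deriv_cst. Qed.

(** Written for Lebesgue measure without the factor 1 / pi, to match the right side of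
    [carleson]. *)
Definition DI p F : \bar R := (\int[leb2]_(w in @dset R)
  (cmod (derive1 F (pt w)) `^ p * (1 - cmod (pt w) ^+ 2) `^ (p - 1))%:E)%E.

Lemma DI_ge0 p F : (0 <= DI p F)%E.
Proof. by apply: integral_ge0 => w _; rewrite lee_fin mulr_ge0 ?powR_ge0. Qed.

Lemma dirichlet_normE p f :
  dirichlet_norm p f = (((cmod (f 0) `^ p)%:E + (pi^-1)%:E * DI p f) `^ p^-1)%E.
Proof. by []. Qed.

Lemma poweR_inv_le p (x : \bar R) (M : R) : 0 < p -> (0 <= x)%E -> 0 <= M ->
  (x `^ p^-1 <= M%:E)%E = (x <= (M `^ p)%:E)%E.
Proof.
move=> p0 x0 M0; have pi0 : 0 <= p^-1 by rewrite invr_ge0 ltW.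
have mono (r : R) (u v : \bar R) : 0 <= r -> (0 <= u)%E -> (u <= v)%E -> (u `^ r <= v `^ r)%E.
  move=> r0 u0 uv; apply: gt0_ler_poweR => //; rewrite in_itv/= ?u0 ?leey//.
  by rewrite (le_trans u0 uv).
apply/idP/idP => h.
  have := mono p _ _ (ltW p0) (poweR_ge0 _ _) h; rewrite -poweRrM mulVf ?gt_eqF// poweRe1//.
have := mono p^-1 _ _ pi0 x0 h; rewrite poweR_EFin -powRrM divff ?gt_eqF// powRr1//.
Qed.

Lemma dirichlet_norm_le p f (M : R) : 0 < p -> 0 <= M ->
  (dirichlet_norm p f <= M%:E)%E = ((cmod (f 0) `^ p)%:E + (pi^-1)%:E * DI p f <= (M `^ p)%:E)%E.
Proof.
move=> p0 M0; rewrite dirichlet_normE poweR_inv_le// adde_ge0 ?lee_fin ?powR_ge0//.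
by rewrite mule_ge0 ?DI_ge0// lee_fin invr_ge0 pi_ge0.
Qed.

End DiscExtension.

(** * The functions f_a and their norms *)

Section TestFunctions.
Variable R : realType.
Local Notation C := (Cplx R).
Local Notation leb := (@lebesgue_measure R).
Local Notation leb2 := (leb \x leb)%E.
Implicit Types (a z : C) (p : R).

Lemma has_deriv_geom (c z : C) n : 1 - c * z != 0 ->
  has_deriv (fun w => (1 - c * w)^-1 ^+ n) z (n%:R * c * (1 - c * z)^-1 ^+ n.+1).
Proof.
move=> nz; have h1 : has_deriv (fun w => 1 - c * w) z (- c).
  have := has_derivB (has_deriv_cst 1 z) (has_derivM (has_deriv_cst c z) (has_deriv_id z)).
  by rewrite (_ : 0 - (0 * z + c * 1) = - c) //; ring.
have h2 : has_deriv (fun w => (1 - c * w)^-1) z (c / (1 - c * z) ^+ 2).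
  by have := has_derivV (F := fun w => 1 - c * w) nz h1; rewrite opprK.
elim: n => [|n ih].
  rewrite mul0r mul0r; exact: has_deriv_cst.
have := has_derivM h2 ih.
rewrite [X in has_deriv _ _ X](_ : _ = n.+1%:R * c * (1 - c * z)^-1 ^+ n.+2) => [h|].
  by move: h; under eq_fun do rewrite -exprS.
rewrite -exprVn -natr1 !exprS expr0; move: (1 - c * z)^-1 => x; move: (x ^+ n) => y; ring.
Qed.

(** b is a natural number, so that the kernel is raised to an ordinary complex power; only the
    positive real factor carries the exponent 1 / p. *)
Definition test_fun p (b : nat) a : C -> C :=
  ((fun z => (((1 - cmod a ^+ 2) `^ (b%:R - p^-1))%:C)%C * (1 - a^*%C * z)^-1 ^+ b) : C -> C)
  \_ (@disc R).

Lemma geom_neq0 a z : cmod a < 1 -> cmod z < 1 -> 1 - a^*%C * z != 0.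
Proof. by move=> a1 z1; rewrite -cmod_eq0 gt_eqF//; exact: tau_gt0. Qed.

Lemma test_fun_deriv p b a z : cmod a < 1 -> cmod z < 1 ->
  has_deriv (test_fun p b a) z ((((1 - cmod a ^+ 2) `^ (b%:R - p^-1))%:C)%C *
    (b%:R * a^*%C * (1 - a^*%C * z)^-1 ^+ b.+1)).
Proof.
move=> a1 z1; apply: (has_deriv_disc z1 (F := fun z =>
  (((1 - cmod a ^+ 2) `^ (b%:R - p^-1))%:C)%C * (1 - a^*%C * z)^-1 ^+ b)).
  by move=> w w1; rewrite /test_fun restr_disc.
have := has_derivM (has_deriv_cst (((1 - cmod a ^+ 2) `^ (b%:R - p^-1))%:C)%C z)
  (has_deriv_geom b (geom_neq0 a1 z1)).
by rewrite mul0r add0r.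
Qed.

Lemma test_fun_hol p b a : cmod a < 1 -> hol_disc (test_fun p b a).
Proof.
move=> a1; apply/hol_discE; split; first by move=> z z1; eexists; exact: test_fun_deriv.
by move=> z z1; rewrite /test_fun patchE memNset.
Qed.

Lemma cmod_test_fun p b a z : cmod a < 1 -> cmod z < 1 ->
  cmod (test_fun p b a z) = (1 - cmod a ^+ 2) `^ (b%:R - p^-1) / tau a z ^+ b.
Proof.
move=> a1 z1; rewrite /test_fun restr_disc// cmodM cmod_rc ger0_norm ?powR_ge0//.
by rewrite cmodX cmodV exprVn.
Qed.

Lemma test_fun_center p b a : 0 < p -> cmod a < 1 ->
  cmod (test_fun p b a a) * (1 - cmod a ^+ 2) `^ p^-1 = 1.
Proof.
move=> p0 a1; rewrite cmod_test_fun//.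
have e0 : 0 < 1 - cmod a ^+ 2 by rewrite subr_gt0 expr_lt1 ?cmod_ge0.
have -> : tau a a = 1 - cmod a ^+ 2.
  have := tau_sqr a a; rewrite subrr cmod0 expr0n subr0 -expr2 => /eqP.
  by rewrite eqrXn2 ?(ltW e0)// ?(ltW (tau_gt0 a1 a1))// => /eqP.
rewrite mulrAC -powRD; last by rewrite (gt_eqF e0) implybT.
by rewrite subrK powR_mulrn ?(ltW e0)// divff// expf_neq0// gt_eqF.
Qed.

(** M may depend on a: it is applied to one fixed test function, which thereby becomes negligible
    against the central values of test functions closer to the circle. *)
Lemma test_fun_bounded p b a : cmod a < 1 ->
  exists M, forall z, cmod z < 1 -> cmod (test_fun p b a z) <= M.
Proof.
move=> a1; exists ((1 - cmod a ^+ 2) `^ (b%:R - p^-1) / (1 - cmod a) ^+ b) => z z1.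
have e0 : 0 < 1 - cmod a by rewrite subr_gt0.
rewrite cmod_test_fun// ler_wpM2l ?powR_ge0// lef_pV2 ?posrE ?exprn_gt0 ?tau_gt0//.
by apply: lerXn2r; rewrite ?nnegrE ?(ltW e0) ?tau_eta// ltW// tau_gt0.
Qed.

(* With q = min(p, 1), the bound W <= 2 tau replaces the exponent p - 1 of W by q - 1. *)
Lemma test_fun_norm p (b : nat) : 0 < p -> 2 <= b%:R * p -> exists2 N : R, 0 < N &
  forall a, cmod a < 1 -> (dirichlet_norm p (test_fun p b a) <= N%:E)%E.
Proof.
move=> p0 bp; pose q := Num.min p 1.
have q01 : 0 < q <= 1 by rewrite /q lt_min p0 ltr01 ge_min lexx orbT.
have qp : q <= p by rewrite /q ge_min lexx.
have qE : q = p \/ q = 1 by rewrite /q /Num.min; case: ifP; [left|right].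
pose beta := b%:R * p; have b1 : 1 < beta by rewrite /beta; lra.
have b0 : 0 < b%:R :> R by move: bp; case: (b) => [|n _]; rewrite ?mul0r ?ltr0n//; lra.
have [k k0 kP] := tau_weight_int q01 b1.
pose c := b%:R `^ p * 2 `^ (p - q).
have c0 : 0 < c by rewrite mulr_gt0 ?powR_gt0.
pose N := 1 + pi^-1 * (c * 2 `^ (beta - 1) * k).
have N0 : 0 < N.
  by rewrite addr_gt0// mulr_gt0 ?invr_gt0 ?pi_gt0// !mulr_gt0// powR_gt0.
exists (N `^ p^-1); first by rewrite powR_gt0.
move=> a a1; rewrite dirichlet_norm_le ?powR_ge0//.
rewrite -powRrM mulVf ?gt_eqF// powRr1 ?(ltW N0)//.
have e0 : 0 < 1 - cmod a by rewrite subr_gt0.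
have A0 := cmod_ge0 a.
pose e2 := 1 - cmod a ^+ 2; have e20 : 0 < e2 by rewrite subr_gt0 expr_lt1.
have e21 : e2 <= 1 by rewrite lerBlDr lerDl sqr_ge0.
have e2e : e2 <= 2 * (1 - cmod a) by rewrite /e2; nra.
pose kap := e2 `^ (b%:R - p^-1).
rewrite EFinD; apply: leeD.
  rewrite lee_fin cmod_test_fun ?cmod0// /tau mulr0 subr0 cmod1 expr1n divr1 -/e2 -powRrM.
  have : e2 `^ ((b%:R - p^-1) * p) <= 1 `^ ((b%:R - p^-1) * p).
    apply: lepow; [|exact: ltW|exact: e21].
    by rewrite mulrBl mulVf ?gt_eqF// -/beta; lra.
  by rewrite powR1.
rewrite EFinM lee_wpmul2l ?lee_fin ?invr_ge0 ?pi_ge0//.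
have cb0 : 0 <= c * kap `^ p by rewrite mulr_ge0 ?powR_ge0// ltW.
apply: (@le_trans _ _ (\int[leb2]_(w in @dset R) ((c * kap `^ p)%:E *
   (tau a (pt w) `^ (- (beta + q)) * (1 - cmod (pt w) ^+ 2) `^ (q - 1))%:E))%E).
  have mW (r : R) : measurable_fun (@dset R) (fun w => (1 - cmod (pt w) ^+ 2) `^ r).
    apply: (@measurableT_comp _ _ _ _ _ _ (fun x : R => x `^ r)) => //.
    apply: measurable_funB => //; apply: measurable_funX.
    exact: measurable_funS (@measurable_pt_cmod R).
  have hF : holo (derive1 (test_fun p b a)).
    by apply: holo_derive1; case: (hol_discE (test_fun p b a)) => + _; case/(_ (test_fun_hol p b a1)).
  apply: ge0_le_integral => //; first exact: measurable_dset.
  - by move=> w _; rewrite lee_fin mulr_ge0 ?powR_ge0.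
  - apply/measurable_EFinP; apply: measurable_funM; last exact: mW.
    by apply/measurable_EFinP; apply: measurable_holo_pow => //; exact: measurable_dset.
  - apply: measurable_funeM; apply/measurable_EFinP; apply: measurable_funM; last exact: mW.
    by apply/measurable_EFinP; exact: measurable_funS (measurable_tau _ _).
  move=> w w1; have w2 : cmod (pt w) < 1 by [].
  rewrite -EFinM lee_fin.
  have t0 := tau_gt0 a1 w2; have w0 := cmod_ge0 (pt w).
  set t := tau a (pt w) in t0 *; set W := 1 - cmod (pt w) ^+ 2.
  have W0 : 0 < W by rewrite subr_gt0 expr_lt1.
  have Wt : W <= 2 * t.
    have h1 : 1 - cmod (pt w) <= t.
      have := ler_cmodB 1 (a^*%C * pt w); rewrite cmod1 cmodM cmod_conj -/(tau a (pt w)) -/t.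
      by nra.
    by rewrite /W; nra.
  rewrite (has_deriv_derive1 (test_fun_deriv p b a1 w2)) !cmodM cmod_rc ger0_norm ?powR_ge0//.
  rewrite -/e2 -/kap cmodX cmodV -/(tau a (pt w)) -/t cmod_conj.
  have -> : cmod (b%:R : C) = b%:R.
    by have := cmod_rc (b%:R : R); rewrite ger0_norm// rmorph_nat.
  have s1 : (kap * (b%:R * cmod a * t^-1 ^+ b.+1)) `^ p <= kap `^ p * (b%:R `^ p * t `^ (- (beta + p))).
    have ti : 0 <= t^-1 by rewrite invr_ge0 ltW.
    rewrite powRM ?powR_ge0 ?mulr_ge0 ?exprn_ge0// ler_wpM2l ?powR_ge0//.
    have -> : t `^ (- (beta + p)) = (t^-1 ^+ b.+1) `^ p.
      rewrite -powR_mulrn// -powR_inv1 ?(ltW t0)// -!powRrM; congr (_ `^ _).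
      by rewrite /beta -natr1; ring.
    rewrite -powRM ?exprn_ge0//; apply: lepow; rewrite ?(ltW p0) ?mulr_ge0 ?exprn_ge0//.
    by rewrite ler_wpM2r ?exprn_ge0// ler_piMr// ltW.
  have s2 : W `^ (p - 1) <= 2 `^ (p - q) * t `^ (p - q) * W `^ (q - 1).
    rewrite -powRM ?(ltW t0)// (_ : p - 1 = (p - q) + (q - 1)); last by ring.
    rewrite powRD ?(gt_eqF W0) ?implybT// ler_wpM2r ?powR_ge0//.
    by apply: lepow; [rewrite subr_ge0|exact: ltW|exact: Wt].
  apply: le_trans (ler_pM _ _ s1 s2) _; rewrite ?powR_ge0//.
  have -> : t `^ (- (beta + q)) = t `^ (- (beta + p)) * t `^ (p - q).
    by rewrite -powRD ?(gt_eqF t0) ?implybT//; congr (_ `^ _); ring.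
  by rewrite /c le_eqVlt; apply/orP; left; apply/eqP; ring.
rewrite ge0_integralZl//; last 3 first.
- exact: measurable_dset.
- apply/measurable_EFinP; apply: measurable_funM.
    by apply/measurable_EFinP; exact: measurable_funS (measurable_tau _ _).
  apply: (@measurableT_comp _ _ _ _ _ _ (fun x : R => x `^ (q - 1))) => //.
  apply: measurable_funB => //; apply: measurable_funX.
  exact: measurable_funS (@measurable_pt_cmod R).
- by move=> w _; rewrite lee_fin mulr_ge0 ?powR_ge0.
apply: (le_trans (lee_wpmul2l _ (kP a a1))) => //.
rewrite -EFinM lee_fin.
(* The normalization contributes e2^(beta - 1), which cancels the growth (1 - |a|)^(1 - beta) of the
   integral. *)
have -> : kap `^ p = e2 `^ (beta - 1).
  by rewrite -powRrM mulrBl mulVf ?gt_eqF.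
have h : e2 `^ (beta - 1) <= 2 `^ (beta - 1) * (1 - cmod a) `^ (beta - 1).
  rewrite -powRM ?(ltW e0)//; apply: lepow => //; last exact: ltW.
  by rewrite subr_ge0 ltW.
have h2 : (1 - cmod a) `^ (beta - 1) * (1 - cmod a) `^ (1 - beta) = 1.
  by rewrite (_ : beta - 1 = - (1 - beta)); [exact: powR_cancel|ring].
apply: (@le_trans _ _ (c * (2 `^ (beta - 1) * (1 - cmod a) `^ (beta - 1)) * (k * (1 - cmod a) `^ (1 - beta)))).
  by rewrite ler_wpM2r ?mulr_ge0 ?powR_ge0 ?(ltW k0)// ler_wpM2l ?(ltW c0).
rewrite le_eqVlt; apply/orP; left; apply/eqP; rewrite -[RHS]mulr1 -[X in _ = _ * X]h2; ring.
Qed.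

End TestFunctions.

(** * Volterra operators and compactness *)

Section Volterra.
Variable R : realType.
Local Notation C := (Cplx R).
Local Notation leb := (@lebesgue_measure R).
Local Notation leb2 := (leb \x leb)%E.
Implicit Types (f g h u : C -> C) (a z : C) (p : R).

Lemma segment_integralE f z : segment_integral f z = J f 0 z.
Proof.
rewrite /segment_integral /J subr0; congr (_ * _).
rewrite /cint; under [in RHS]eq_Rintegral do rewrite /seg add0r subr0.
by congr Complex; under [in RHS]eq_Rintegral do rewrite /seg add0r subr0.
Qed.

Lemma volterra_disc g f z : cmod z < 1 -> volterra g f z = J (fun w => f w * derive1 g w) 0 z.
Proof. by move=> z1; rewrite /volterra (restr_disc _ z1); exact: segment_integralE. Qed.

Lemma volterra_deriv g f z : holo g -> holo f -> cmod z < 1 ->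
  has_deriv (volterra g f) z (f z * derive1 g z).
Proof.
move=> hg hf z1; apply: (has_deriv_disc z1 (F := J (fun w => f w * derive1 g w) 0)).
  by move=> w w1; rewrite volterra_disc.
by apply: primitive => //; apply: holoM => //; exact: holo_derive1.
Qed.

Lemma volterra_hol g f : holo g -> holo f -> hol_disc (volterra g f).
Proof.
move=> hg hf; apply/hol_discE; split; first by move=> z z1; eexists; exact: volterra_deriv.
by move=> z z1; rewrite /volterra patchE memNset.
Qed.

Lemma volterra0 g f : volterra g f 0 = 0.
Proof. by rewrite volterra_disc ?cmod0// /J subrr mul0r. Qed.

Lemma volterra_linear g f h (c : C) : holo g -> holo f -> holo h ->
  volterra g (fun z => c * f z + h z) = (fun z => c * volterra g f z + volterra g h z).
Proof.
move=> hg hf hh; apply/funext => z; have [z1|z1] := pselect (disc z); last first.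
  rewrite /volterra !patchE memNset//.
  (* Off the disc the restriction returns the default value [point], which is 0 in [C]. *)
  by rewrite (_ : point = 0 :> C)// mulr0 addr0.
have o1 : cmod (0 : C) < 1 by rewrite cmod0.
have sc u : holo u -> segc (fun w => u w * derive1 g w) 0 z.
  by move=> hu; apply: segc_holo => //; apply: holoM => //; exact: holo_derive1.
have hcf : holo (fun w => c * f w) by apply: holoM => //; exact: holo_cst.
rewrite !volterra_disc// -JZ; last exact: sc.
rewrite -JD; last 2 first.
- by have := sc _ hcf; congr segc; apply/funext => w; rewrite mulrA.
- exact: sc.
by apply: eq_J => t _; ring.
Qed.

(* (1 / pi) WI p f' a is the area integral in the F(p, p - 1, 1) norm. *)
Definition WI p u a : \bar R := (\int[leb2]_(w in @dset R)
  (cmod (u (pt w)) `^ p * (1 - cmod (pt w) ^+ 2) `^ p * om a (pt w))%:E)%E.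

(** The left side of [carleson]; for a = 0 it is the plain integral of |u|^p. *)
Definition CI p u a : \bar R := (\int[leb2]_(w in @dset R)
  (cmod (u (pt w)) `^ p * om a (pt w))%:E)%E.

Lemma WI_ge0 p u a : cmod a < 1 -> (0 <= WI p u a)%E.
Proof. by move=> a1; apply: integral_ge0 => w _; rewrite lee_fin; apply: mulr_ge0; [rewrite mulr_ge0 ?powR_ge0|exact: om_ge0]. Qed.

Lemma W_gt0 z : cmod z < 1 -> 0 < 1 - cmod z ^+ 2.
Proof. by move=> z1; rewrite subr_gt0 expr_lt1 ?cmod_ge0. Qed.

Lemma F_area p f a : cmod a < 1 ->
  area_integral (fun z => cmod (derive1 f z) `^ p * (1 - cmod z ^+ 2) `^ (p - 1) *
     (1 - cmod (mobius a z) ^+ 2) `^ 1) = ((pi^-1)%:E * WI p (derive1 f) a)%E.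
Proof.
move=> a1; congr (_ * _)%E; apply: eq_integral => w /set_mem w1.
have w2 : cmod (pt w) < 1 := w1; have W0 := W_gt0 w2.
rewrite -/(pt w) mobius_om// powRr1; last by apply: mulr_ge0; [exact: ltW|exact: om_ge0].
by rewrite (powR_pred p W0); congr EFin; ring.
Qed.

Lemma F_norm_le p f (M : R) : 0 < p -> 0 <= M ->
  (F_norm p (p - 1) 1 f <= M%:E)%E <->
  forall a, cmod a < 1 -> ((cmod (f 0) `^ p)%:E + (pi^-1)%:E * WI p (derive1 f) a <= (M `^ p)%:E)%E.
Proof.
move=> p0 M0; rewrite /F_norm; set S := ereal_sup _.
have SP a : cmod a < 1 -> ((pi^-1)%:E * WI p (derive1 f) a <= S)%E.
  by move=> a1; apply: ereal_sup_ubound; exists a => //; rewrite F_area.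
have o1 : cmod (0 : C) < 1 by rewrite cmod0.
have pi0 : (0 <= (pi^-1)%:E :> \bar R)%E by rewrite lee_fin invr_ge0 pi_ge0.
have S0 : (0 <= S)%E by apply: le_trans (SP _ o1); rewrite mule_ge0 ?WI_ge0.
rewrite poweR_inv_le//; last by rewrite adde_ge0// lee_fin powR_ge0.
split=> [H a a1|H]; first by apply: le_trans H; rewrite leeD2l// SP.
rewrite addeC -leeBrDr//; apply: ge_ereal_sup => _ [a a1 <-].
by rewrite F_area// leeBrDr// addeC; exact: H.
Qed.

Lemma measurable_om a (D : set (R * R)) : cmod a < 1 -> measurable D -> D `<=` @dset R ->
  measurable_fun D (fun w => om a (pt w)).
Proof.
move=> a1 mD sD; apply: (eq_measurable_fun (fun w => (1 - cmod a ^+ 2) * tau a (pt w) `^ (- 2))).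
  move=> w /set_mem/sD w1; rewrite /om powRN; congr (_ * _^-1).
  by rewrite -powR_mulrn// ltW// tau_gt0.
apply: measurable_funM => //; apply/measurable_EFinP; exact: measurable_funS (measurable_tau _ _).
Qed.

Lemma measurable_W (q : R) (D : set (R * R)) : measurable_fun D (fun w => (1 - cmod (pt w) ^+ 2) `^ q).
Proof.
apply: (@measurableT_comp _ _ _ _ _ _ (fun x : R => x `^ q)) => //.
apply: measurable_funB => //; apply: measurable_funX.
exact: measurable_funS (@measurable_pt_cmod R).
Qed.

Lemma measurable_CI p u a : holo u -> cmod a < 1 ->
  measurable_fun (@dset R) (fun w => (cmod (u (pt w)) `^ p * om a (pt w))%:E).
Proof.
move=> hu a1; have mD := @measurable_dset R; apply/measurable_EFinP; apply: measurable_funM.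
  by apply/measurable_EFinP; exact: measurable_holo_pow.
exact: measurable_om.
Qed.

Lemma measurable_WI p u a : holo u -> cmod a < 1 -> measurable_fun (@dset R)
  (fun w => (cmod (u (pt w)) `^ p * (1 - cmod (pt w) ^+ 2) `^ p * om a (pt w))%:E).
Proof.
move=> hu a1; have mD := @measurable_dset R; apply/measurable_EFinP; apply: measurable_funM.
  apply: measurable_funM; last exact: measurable_W.
  by apply/measurable_EFinP; exact: measurable_holo_pow.
exact: measurable_om.
Qed.

Lemma eq_WI p u v a : (forall z, cmod z < 1 -> u z = v z) -> WI p u a = WI p v a.
Proof. by move=> uv; apply: eq_integral => w /set_mem w1; rewrite uv. Qed.

(** Pointwise, W |h| <= B removes the weight together with the factor h and leaves the Carleson
    integral of f. *)
Lemma WI_le p f h a (B : R) : 0 < p -> holo f -> holo h -> cmod a < 1 -> 0 <= B ->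
  (forall z, cmod z < 1 -> (1 - cmod z ^+ 2) * cmod (h z) <= B) ->
  (WI p (fun z => (f z * h z)%R) a <= (B `^ p)%:E * CI p f a)%E.
Proof.
move=> p0 hf hh a1 B0 hB; have mD := @measurable_dset R.
rewrite -ge0_integralZl//; last 3 first.
- exact: measurable_CI.
- by move=> w _; rewrite lee_fin; apply: mulr_ge0; [exact: powR_ge0|exact: om_ge0].
- by rewrite lee_fin powR_ge0.
apply: ge0_le_integral => //.
- by move=> w _; rewrite lee_fin; apply: mulr_ge0; [rewrite mulr_ge0 ?powR_ge0|exact: om_ge0].
- exact: (measurable_WI p (holoM hf hh) a1).
- by apply: measurable_funeM; exact: measurable_CI.
move=> w w1; have W0 := W_gt0 w1; rewrite -EFinM lee_fin [leRHS]mulrA ler_wpM2r ?om_ge0//.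
rewrite cmodM powRM ?cmod_ge0// -mulrA mulrC ler_wpM2r ?powR_ge0//.
rewrite -powRM ?cmod_ge0 ?(ltW W0)//; apply: lepow; rewrite ?(ltW p0) ?mulr_ge0 ?cmod_ge0 ?(ltW W0)//.
by rewrite mulrC; exact: hB.
Qed.

Lemma pi_ge1 : 1 <= pi :> R.
Proof. by have := pi_ge2 R; lra. Qed.

Lemma CI_bound p : 0 < p -> exists2 c : R, 0 < c & forall f (M : R), hol_disc f -> 0 <= M ->
  (dirichlet_norm p f <= M%:E)%E -> forall a, cmod a < 1 -> (CI p f a <= (c * M `^ p)%:E)%E.
Proof.
move=> p0; have [c c0 cP] := carleson p0.
exists (c * pi); first by rewrite mulr_gt0// pi_gt0.
move=> f M /hol_discE[hf _] M0; rewrite dirichlet_norm_le// => fM a a1.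
apply: (le_trans (cP f a hf a1)); rewrite -mulrA EFinM lee_wpmul2l ?lee_fin ?(ltW c0)//.
have pp : 0 < pi :> R := pi_gt0 R.
rewrite EFinM; apply: le_trans (lee_wpmul2l _ fM); last by rewrite lee_fin ltW.
rewrite ge0_muleDr ?lee_fin ?powR_ge0//; last first.
  by rewrite mule_ge0 ?DI_ge0// lee_fin invr_ge0 ltW.
apply: leeD.
  by rewrite -EFinM lee_fin ler_peMl ?powR_ge0// pi_ge1.
by rewrite muleA -EFinM divff ?gt_eqF// mul1e.
Qed.

(** The Carleson embedding for p = 1 and the constant function 1, whose derivative vanishes. *)
Lemma om_int : exists2 c : R, 0 < c & forall a, cmod a < 1 ->
  (\int[leb2]_(w in @dset R) (om a (pt w))%:E <= c%:E)%E.
Proof.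
have [c c0 cP] := carleson (@ltr01 R); exists c => // a a1.
have h1 := @holo_cst R (1 : C).
have := cP _ a h1 a1; rewrite cmod1 powR1.
have -> : (\int[leb2]_(w in @dset R) (cmod (derive1 (fun=> 1 : C) (pt w)) `^ 1 *
    (1 - cmod (pt w) ^+ 2) `^ (1 - 1))%:E = 0)%E.
  apply: integral0_eq => w w1; rewrite (has_deriv_derive1 (has_deriv_cst 1 (pt w))).
  by rewrite cmod0 powR0 ?oner_eq0// mul0r.
rewrite adde0 mule1; congr (_ <= _)%E; apply: eq_integral => w _.
by rewrite mul1r.
Qed.

End Volterra.

(** * Normal families along an ultrafilter *)

Section Montel.
Variable R : realType.
Local Notation C := (Cplx R).
Local Notation leb := (@lebesgue_measure R).
Local Notation leb2 := (leb \x leb)%E.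
Implicit Types (F G : C -> C) (a z : C) (p : R) (U : set_system nat).

(** Along an ultrafilter every bounded sequence converges, so limits at all points z are obtained at
    once, without diagonal subsequences. *)
Lemma ultra_lim U (x : nat -> R) (M : R) : UltraFilter U -> (forall n, `|x n| <= M) ->
  exists l, forall e, 0 < e -> U [set n | `|x n - l| < e].
Proof.
move=> UU xM; have PU := @ultra_proper _ _ UU.
have PF : ProperFilter (x @ U) by exact: fmap_proper_filter.
have UM : (x @ U) `[- M, M]%classic.
  change (U (x @^-1` `[- M, M]%classic)); apply: filterE => n.
  by have := xM n; rewrite ler_norml /= in_itv.
have [l [_ cl]] := @segment_compact R (- M) M (x @ U) PF UM.
exists l => e e0; have [//|H] := in_ultra_setVsetC [set n | `|x n - l| < e] UU.
have [y [h1 h2]] := cl [set y | ~ (`|y - l| < e)] (ball l e) H (nbhsx_ballx l e e0).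
by exfalso; apply: h1; rewrite distrC.
Qed.

Lemma ultra_limC U (x : nat -> C) (M : R) : UltraFilter U -> (forall n, cmod (x n) <= M) ->
  exists l, forall e, 0 < e -> U [set n | cmod (x n - l) < e].
Proof.
move=> UU xM; have PU := @ultra_proper _ _ UU.
have [l1 h1] := @ultra_lim U (fun n => complex.Re (x n)) M UU (fun n => le_trans (Re_le_cmod _) (xM n)).
have [l2 h2] := @ultra_lim U (fun n => complex.Im (x n)) M UU (fun n => le_trans (Im_le_cmod _) (xM n)).
exists (Complex l1 l2) => e e0; have e2 : 0 < e / 2 by rewrite divr_gt0.
apply: filterS2 (h1 _ e2) (h2 _ e2) => n /= g1 g2.
apply: le_lt_trans (cmod_leReIm _) _; rewrite ReB ImB /=; lra.
Qed.

Lemma CI0 p F : CI p F 0 = (\int[leb2]_(w in @dset R) (cmod (F (pt w)) `^ p)%:E)%E.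
Proof.
apply: eq_integral => w _; rewrite /om /tau cmod0 conjc0 mul0r subr0 cmod1.
by rewrite expr0n subr0 expr1n divr1 mulr1.
Qed.

Lemma growth p : 0 < p -> exists2 k : R, 0 < k & forall F (B r : R) z, holo F -> 0 < r ->
  cmod z + 2 * r < 1 -> (CI p F 0%R <= B%:E)%E -> r ^+ 2 * cmod (F z) `^ p <= k * B.
Proof.
move=> p0; have [k k0 kP] := sub_mean p0; exists k => // F B r z hF r0 zr; rewrite CI0 => FB.
rewrite -lee_fin; apply: (le_trans (kP F z r hF r0 zr)).
rewrite EFinM lee_wpmul2l ?lee_fin ?(ltW k0)//; apply: le_trans FB.
have mD := @measurable_dset R.
apply: ge0_subset_integral => //.
- exact: measurable_sq.
- exact: measurable_holo_pow.
- by move=> w _; rewrite lee_fin powR_ge0.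
- exact: sq_dset.
Qed.

(** On the square 2 r <= W <= 1, so W^(p - 1) is at least (2 r)^|p - 1| for either sign of p - 1. *)
Lemma deriv_growth p : 0 < p -> exists2 k : R, 0 < k & forall F (B r : R) z, holo F -> 0 < r ->
  cmod z + 4 * r < 1 -> (DI p F <= B%:E)%E ->
  r ^+ 2 * cmod (derive1 F z) `^ p <= k * ((2 * r)^-1 `^ `|p - 1| * B).
Proof.
move=> p0; have [k k0 kP] := sub_mean p0; exists k => // F B r z hF r0 zr FB.
have z0 := cmod_ge0 z; have hF' := holo_derive1 hF; have zr2 : cmod z + 2 * r < 1 by lra.
rewrite -lee_fin; apply: (le_trans (kP _ z r hF' r0 zr2)).
rewrite EFinM lee_wpmul2l ?lee_fin ?(ltW k0)//.
have c0 : 0 <= (2 * r)^-1 `^ `|p - 1| by rewrite powR_ge0.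
rewrite EFinM; apply: le_trans (lee_wpmul2l _ FB); last by rewrite lee_fin.
have mD := @measurable_dset R; have mS := @measurable_sq R z r; have sD := sq_dset zr2.
have mDI : measurable_fun (@dset R) (fun w => (cmod (derive1 F (pt w)) `^ p *
    (1 - cmod (pt w) ^+ 2) `^ (p - 1))%:E).
  apply/measurable_EFinP; apply: measurable_funM; last exact: measurable_W.
  by apply/measurable_EFinP; exact: measurable_holo_pow.
rewrite -ge0_integralZl//; last by move=> w _; rewrite lee_fin mulr_ge0 ?powR_ge0.
apply: (@le_trans _ _ (\int[leb2]_(w in sq z r) (((2 * r)^-1 `^ `|p - 1|)%:E *
   (cmod (derive1 F (pt w)) `^ p * (1 - cmod (pt w) ^+ 2) `^ (p - 1))%:E))%E); last first.
  apply: ge0_subset_integral => //; first exact: measurable_funeM.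
  by move=> w _; rewrite -EFinM lee_fin !mulr_ge0 ?powR_ge0.
apply: ge0_le_integral => //.
- by move=> w _; rewrite lee_fin powR_ge0.
- exact: measurable_sq_pow.
- by apply: measurable_funeM; exact: measurable_funS mDI.
move=> w /sqP[w1 w2]; rewrite -EFinM lee_fin.
have wz : cmod (pt w) <= cmod z + 2 * r.
  have := cmod_leReIm (pt w - z); have := ler_cmodB (pt w) z; lra.
have w0 := cmod_ge0 (pt w).
have W2 : 2 * r <= 1 - cmod (pt w) ^+ 2 by nra.
have W1 : 1 - cmod (pt w) ^+ 2 <= 1 by rewrite lerBlDr lerDl sqr_ge0.
have i0 : 0 < (2 * r)^-1 by rewrite invr_gt0; lra.
have i1 : 1 <= (2 * r)^-1 by rewrite invf_ge1; lra.
have ii : (2 * r)^-1 * (2 * r) = 1 by rewrite mulVf// gt_eqF//; lra.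
have h : 1 `^ (p - 1) <= (2 * r)^-1 `^ `|p - 1| * (1 - cmod (pt w) ^+ 2) `^ (p - 1).
  apply: ratio_pow => //; first by lra.
    by apply: (@le_trans _ _ ((2 * r)^-1 * (2 * r))); [rewrite ii|rewrite ler_pM2l].
  by rewrite mulr1; lra.
rewrite powR1 in h; rewrite mulrCA; rewrite -[leLHS]mulr1.
by rewrite ler_wpM2l ?powR_ge0.
Qed.

Lemma powR_le_root p (x y : R) : 0 < p -> 0 <= x -> x `^ p <= y -> x <= y `^ p^-1.
Proof.
move=> p0 x0 h; have -> : x = (x `^ p) `^ p^-1.
  by rewrite -powRrM divff ?gt_eqF// powRr1.
by apply: lepow => //; rewrite ?powR_ge0// invr_ge0 ltW.
Qed.

(** d and L depend on B and z only and are fixed before F: this is the equicontinuity behind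
    [montel]. *)
Lemma unif_lipschitz p (B : R) z : 0 < p -> cmod z < 1 -> exists d, 0 < d /\
  exists L, 0 <= L /\ forall F (w w' : C), holo F -> (DI p F <= B%:E)%E ->
    cmod (w - z) < d -> cmod (w' - z) < d -> cmod (F w' - F w) <= L * cmod (w' - w).
Proof.
move=> p0 z1; have [k k0 kP] := deriv_growth p0.
pose r := (1 - cmod z) / 8; have r0 : 0 < r by rewrite divr_gt0// subr_gt0.
have zr : cmod z + 5 * r < 1 by rewrite /r; lra.
pose M := (k * ((2 * r)^-1 `^ `|p - 1| * B) / r ^+ 2) `^ p^-1.
have M0 : 0 <= M by rewrite powR_ge0.
exists r; split=> //; exists (2 * M); split; first by rewrite mulr_ge0.
move=> F w w' hF FB wz wz'.
have segin t : 0 <= t <= 1 -> cmod (seg w w' t) + 4 * r < 1.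
  move=> t01; have E : seg w w' t - z = seg (w - z) (w' - z) t by rewrite /seg; ring.
  have h : cmod (seg w w' t - z) < r by rewrite E; apply: le_lt_trans (cmod_seg _ _ t01) _; exact: conv_lt.
  by have := ler_cmodB (seg w w' t) z; lra.
apply: (mean_value_ineq (f' := derive1 F)) => t t01; have st := segin t t01.
  by apply: holo_has_deriv => //; lra.
apply: powR_le_root; rewrite ?cmod_ge0// ler_pdivlMr ?exprn_gt0// mulrC.
exact: kP.
Qed.

Lemma eps0_eq0 (z : C) (s : R) : (forall e, 0 < e -> cmod z <= e * s) -> z = 0.
Proof.
move=> H; apply/eqP; rewrite -cmod_eq0 eq_le cmod_ge0 andbT; apply/ler_addgt0Pr => e e0.
rewrite add0r; have s0 : 0 < `|s| + 1 by rewrite ltr_wpDl.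
apply: (le_trans (H (e / (`|s| + 1)) _)); first by rewrite divr_gt0.
rewrite mulrAC ler_pdivrMr// ler_pM2l//; have := ler_norm s; lra.
Qed.

Lemma contcB F G z : contc F z -> contc G z -> contc (fun w => F w - G w) z.
Proof.
move=> cF cG e e0; have e2 : 0 < e / 2 by rewrite divr_gt0.
have [d d0 dP] := cF _ e2; have [d' d'0 d'P] := cG _ e2.
exists (Num.min d d'); first by rewrite lt_min d0.
move=> w; rewrite lt_min => /andP[/dP h1 /d'P h2].
have -> : F w - G w - (F z - G z) = (F w - F z) - (G w - G z) by ring.
by apply: le_lt_trans (cmodB _ _) _; lra.
Qed.

(** Pointwise limits exist along U; equicontinuity and compactness make the convergence uniform on
    |z| <= rho. Triangle integrals then pass to the limit, so v is the derivative of the holomorphic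
    function [J v 0]. *)
Lemma montel p (B : R) (u : nat -> C -> C) U : 0 < p -> UltraFilter U ->
  (forall n, holo (u n)) -> (forall n, (CI p (u n) 0%R <= B%:E)%E) ->
  (forall n, (DI p (u n) <= B%:E)%E) ->
  exists v, holo v /\ forall (rho e : R), rho < 1 -> 0 < e ->
    U [set n | forall z, cmod z <= rho -> cmod (u n z - v z) < e].
Proof.
move=> p0 UU hu uC uD; have PU := @ultra_proper _ _ UU.
have [k k0 kP] := growth p0.
have /choice[v vP] : forall z : C, exists l : C, cmod z < 1 ->
    forall e : R, 0 < e -> U [set n | cmod (u n z - l) < e].
  move=> z; have [z1|z1] := pselect (cmod z < 1); last by exists 0.
  pose r := (1 - cmod z) / 4; have r0 : 0 < r by rewrite divr_gt0// subr_gt0.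
  have zr : cmod z + 2 * r < 1 by rewrite /r; lra.
  have [|l lP] := @ultra_limC U (fun n => u n z) ((k * B / r ^+ 2) `^ p^-1) UU.
    move=> n; apply: powR_le_root; rewrite ?cmod_ge0// ler_pdivlMr ?exprn_gt0// mulrC.
    exact: kP.
  by exists l.
have lip z : cmod z < 1 -> exists d, 0 < d /\ exists L, 0 <= L /\ forall w, cmod (w - z) < d ->
    (forall n, cmod (u n w - u n z) <= L * cmod (w - z)) /\
    (cmod w < 1 -> cmod (v w - v z) <= L * cmod (w - z)).
  move=> z1; have [d [d0 [L [L0 LP]]]] := unif_lipschitz B p0 z1.
  exists d; split=> //; exists L; split=> // w wz.
  have ul n : cmod (u n w - u n z) <= L * cmod (w - z) by apply: LP => //; rewrite subrr cmod0.
  split=> // w1; apply/ler_addgt0Pr => e e0; have e2 : 0 < e / 2 by rewrite divr_gt0.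
  have [n [/= h1 h2]] := filter_ex (filterI (vP w w1 _ e2) (vP z z1 _ e2)).
  have -> : v w - v z = (u n w - u n z) + (u n z - v z) - (u n w - v w) by ring.
  apply: le_trans (cmodB _ _) _; have := cmodD (u n w - u n z) (u n z - v z).
  by have := ul n; lra.
have cv z : cmod z < 1 -> contc v z.
  move=> z1 e e0; have [d [d0 [L [L0 LP]]]] := lip z z1; have [d' d'0 d'P] := disc_near z1.
  have L1 : 0 < L + 1 by lra.
  exists (Num.min (Num.min d d') (e / (L + 1))); first by rewrite !lt_min d0 d'0 divr_gt0.
  move=> w; rewrite !lt_min ltr_pdivlMr// => /andP[/andP[wd wd'] we].
  have [_ /(_ (d'P _ wd')) h] := LP w wd; apply: le_lt_trans h _.
  by have := cmod_ge0 (w - z); lra.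
have unif (rho e : R) : rho < 1 -> 0 < e ->
    U [set n | forall z, cmod z <= rho -> cmod (u n z - v z) < e].
  move=> r1 e0.
  (* Compactness is applied to a square that contains the disc; near points with |z| > rho the
     implication holds vacuously. *)
  have : U [set n | forall z, sqin 0 1 z -> cmod z <= rho -> cmod (u n z - v z) < e].
    apply: sq_near => z _; have [zr|zr] := ltP rho (cmod z).
      exists (cmod z - rho); first by rewrite subr_gt0.
      apply: filterE => n w wz wr; have := ler_cmodB z w; rewrite cmodBC; lra.
    have z1 : cmod z < 1 by lra.
    have [d [d0 [L [L0 LP]]]] := lip z z1.
    have L1 : 0 < 3 * (L + 1) by lra.
    exists (Num.min d (e / (3 * (L + 1)))); first by rewrite lt_min d0 divr_gt0.
    have e3 : 0 < e / 3 by rewrite divr_gt0.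
    apply: filterS (vP z z1 _ e3) => n /= h w; rewrite lt_min ltr_pdivlMr// => /andP[wd we] wr.
    have [h1 h2] := LP w wd; have := h2 (le_lt_trans wr r1); have := h1 n.
    have -> : u n w - v w = (u n w - u n z) + (u n z - v z) - (v w - v z) by ring.
    move=> g1 g2; apply: le_lt_trans (cmodB _ _) _; have := cmodD (u n w - u n z) (u n z - v z).
    have := cmod_ge0 (w - z); nra.
  apply: filterS => n H z zr; apply: H => //; rewrite /sqin subr0.
  by split; apply: le_trans (ltW (le_lt_trans zr r1)); [exact: Re_le_cmod|exact: Im_le_cmod].
exists v; split=> //.
have tri0 a b c : cmod a < 1 -> cmod b < 1 -> cmod c < 1 -> tri v a b c = 0.
  move=> a1 b1 c1; apply: (@eps0_eq0 _ (2 * (cmod (b - a) + cmod (c - b) + cmod (a - c)))) => e e0.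
  pose rho := Num.max (cmod a) (Num.max (cmod b) (cmod c)).
  have r1 : rho < 1 by rewrite /rho !gt_max a1 b1.
  have ra : cmod a <= rho by rewrite /rho le_max lexx.
  have rb : cmod b <= rho by rewrite /rho !le_max lexx orbT.
  have rc : cmod c <= rho by rewrite /rho !le_max lexx !orbT.
  have [n /= nP] := filter_ex (unif rho e r1 e0).
  have Jd x y : cmod x <= rho -> cmod y <= rho -> cmod (J (u n) x y - J v x y) <= 2 * e * cmod (y - x).
    move=> xr yr; have x1 := le_lt_trans xr r1; have y1 := le_lt_trans yr r1.
    have s1 := segc_holo (hu n) x1 y1; have s2 := segc_cont cv x1 y1.
    rewrite -JB//; apply: J_bound.
      by move=> t t01; exact: contcB (s1 t t01) (s2 t t01).
    move=> t t01; apply/ltW/nP; apply: le_trans (cmod_seg _ _ t01) _; exact: conv_le.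
  have T0 := holo_tri (hu n) a1 b1 c1.
  have -> : tri v a b c = - ((J (u n) a b - J v a b) + (J (u n) b c - J v b c) + (J (u n) c a - J v c a)).
    by rewrite -[LHS]subr0 -T0 /tri; ring.
  rewrite cmodN; apply: le_trans (cmodD _ _) _; have := cmodD (J (u n) a b - J v a b) (J (u n) b c - J v b c).
  have := Jd _ _ ra rb; have := Jd _ _ rb rc; have := Jd _ _ rc ra; lra.
have hJ : holo (J v 0) by move=> z z1; exists (v z); exact: primitive_tri.
apply: holo_eq (holo_derive1 hJ) => w w1.
by apply: has_deriv_derive1; exact: primitive_tri.
Qed.

End Montel.

(** * Compactness of Volterra operators with little Bloch symbols *)

Section Compactness.
Variable R : realType.
Local Notation C := (Cplx R).
Local Notation leb := (@lebesgue_measure R).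
Local Notation leb2 := (leb \x leb)%E.
Implicit Types (f g h : C -> C) (a z : C) (p : R).

Lemma to_circleP (A : set C) :
  to_circle A <-> exists2 d : R, 0 < d & forall z, 1 - d < cmod z -> cmod z < 1 -> A z.
Proof.
split=> [[d /= d0 dP]|[d d0 dP]].
  exists d => // z z1 z2; apply: (dP (cmod z)) => //=.
  by rewrite gtr0_norm ?subr_gt0//; lra.
exists d => //= r /= rd r1 z zr; apply: dP; rewrite zr//.
by move: rd; rewrite gtr0_norm ?subr_gt0//; lra.
Qed.

(** Fatou's lemma asks only for a lower bound: it is trivial at y = 0, and at y > 0 the power is
    continuous. *)
Lemma lower_semi_pow p (x : nat -> R) (y c : R) : 0 < p -> 0 <= y -> 0 <= c ->
  (forall j, 0 <= x j) -> x @ \oo --> y ->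
  ((y `^ p * c)%:E <= limn_einf (fun j => (x j `^ p * c)%:E))%E.
Proof.
move=> p0; rewrite le_eqVlt => /orP[/eqP <-|y0] c0 x0 xy.
  rewrite powR0 ?gt_eqF// mul0r limn_einf_lim; apply: lime_ge; first exact: is_cvg_einfs.
  apply: nearW => n; apply: le_ereal_inf_tmp => _ [m _ <-].
  by rewrite lee_fin mulr_ge0 ?powR_ge0.
have cv : (x j `^ p * c)%:E @[j --> \oo] --> (y `^ p * c)%:E.
  apply: cvg_EFin; first exact: nearW.
  apply: cvgM; last exact: cvg_cst.
  have := is_derive_cont (is_derive1_powR p y0).
  by move=> /(continuous_cvg _)/(_ xy).
by rewrite (cvg_limn_einf_sup cv).1.
Qed.

(** For the limit v of a bounded sequence, a bound on its Carleson integrals suffices: it puts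
    [volterra h v] into F(p, p - 1, 1) without an estimate of a Dirichlet type norm of v. *)
Lemma fatou_CI p (B : R) (u : nat -> C -> C) v a : 0 < p -> (forall n, holo (u n)) -> holo v ->
  cmod a < 1 -> (forall z, cmod z < 1 -> cmod (u n z) @[n --> \oo] --> cmod (v z)) ->
  (forall n, (CI p (u n) a <= B%:E)%E) -> (CI p v a <= B%:E)%E.
Proof.
move=> p0 hu hv a1 uv uB; have mD := @measurable_dset R.
have om0 z := om_ge0 z a1.
pose F n w := (cmod (u n (pt w)) `^ p * om a (pt w))%:E.
have mF n : measurable_fun (@dset R) (F n) by exact: measurable_CI.
have F0 n w : (0 <= F n w)%E by rewrite lee_fin mulr_ge0 ?powR_ge0.
apply: (@le_trans _ _ (\int[leb2]_(w in @dset R) limn_einf (F^~ w))%E).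
  apply: ge0_le_integral => //.
  - by move=> w _; rewrite lee_fin mulr_ge0 ?powR_ge0.
  - exact: measurable_CI.
  - rewrite (_ : (fun _ => _) = fun w => (- limn_esup (fun n => - F n w))%E); last first.
      by apply/funext => w; rewrite -limn_einfN; congr limn_einf; apply/funext => n; rewrite [RHS]/comp [RHS]oppeK.
    apply: measurableT_comp => //; apply: measurable_fun_limn_esup => n.
    by apply: measurableT_comp => //; exact: mF.
  - by move=> w w1; apply: lower_semi_pow => //; [exact: cmod_ge0|move=> j; exact: cmod_ge0|exact: uv].
apply: le_trans (fatou leb2 mD mF (fun n w _ => F0 n w)) _.
rewrite limn_einf_lim; apply: lime_le; first exact: is_cvg_einfs.
apply: nearW => n; apply: le_trans (uB n).
by apply: ereal_inf_lbound; exists n => //=.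
Qed.

Lemma CI_sub p u v a : 0 < p -> holo u -> holo v -> cmod a < 1 ->
  (CI p (fun z => (u z - v z)%R) a <= (2 `^ p)%:E * (CI p u a + CI p v a))%E.
Proof.
move=> p0 hu hv a1; have mD := @measurable_dset R; have om0 z := om_ge0 z a1.
have mu := measurable_CI p hu a1; have mv := measurable_CI p hv a1.
have g0 (x : C -> C) w : (0 <= (cmod (x (pt w)) `^ p * om a (pt w))%:E)%E.
  by rewrite lee_fin mulr_ge0 ?powR_ge0.
rewrite -ge0_integralD// -ge0_integralZl//; last 2 first.
- exact: emeasurable_funD.
- by move=> w _; rewrite adde_ge0.
apply: ge0_le_integral => //.
- by move=> w _; rewrite lee_fin mulr_ge0 ?powR_ge0.
- exact: (measurable_CI p (holoB hu hv) a1).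
- by apply: measurable_funeM; exact: emeasurable_funD.
move=> w _; rewrite -EFinD -EFinM lee_fin -mulrDl mulrA ler_wpM2r//.
apply: le_trans (powR_add_le (ltW p0) (cmod_ge0 _) (cmod_ge0 _)).
by apply: lepow; rewrite ?(ltW p0) ?cmod_ge0// cmodB.
Qed.

Lemma F_norm_WI p f (K : R) : 0 < p -> 0 <= K -> f 0 = 0 ->
  (forall a, cmod a < 1 -> (WI p (derive1 f) a <= K%:E)%E) ->
  (F_norm p (p - 1) 1 f <= ((pi^-1 * K) `^ p^-1)%:E)%E.
Proof.
move=> p0 K0 f0 H; have pi0 : 0 <= pi^-1 :> R by rewrite invr_ge0 pi_ge0.
apply/F_norm_le => //; first exact: powR_ge0.
move=> a a1; rewrite f0 cmod0 powR0 ?gt_eqF// add0e -powRrM mulVf ?gt_eqF//.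
by rewrite powRr1 ?mulr_ge0// EFinM lee_wpmul2l ?lee_fin// H.
Qed.

Lemma cvg_to_zero (x : nat -> \bar R) : (forall n, (0 <= x n)%E) ->
  (forall e : R, 0 < e -> \forall n \near \oo, (x n <= e%:E)%E) -> x @ \oo --> 0%E.
Proof.
move=> x0 H; apply/fine_cvgP; split.
  apply: filterS (H 1 ltr01) => n xn; rewrite ge0_fin_numE//.
  exact: le_lt_trans xn (ltry _).
apply/cvgrPdist_le => e e0; apply: filterS (H e e0) => n xn /=.
rewrite sub0r normrN ger0_norm ?fine_ge0// -lee_fin fineK// ge0_fin_numE//.
exact: le_lt_trans xn (ltry _).
Qed.

Lemma zero_cvg_to (x : nat -> \bar R) (e : R) : x @ \oo --> 0%E -> 0 < e ->
  \forall n \near \oo, (x n < e%:E)%E.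
Proof.
move=> /fine_cvgP[fx /cvgrPdist_lt/(_ e) xc] e0; have := xc e0.
apply: filterS2 fx => n fn /=; rewrite sub0r normrN => h.
by rewrite -(fineK fn) lte_fin; apply: le_lt_trans h; exact: ler_norm.
Qed.

Lemma invS_small (m : R) n : 0 < m -> (Num.bound m^-1 <= n)%N -> n.+1%:R^-1 <= m.
Proof.
move=> m0 mn; rewrite invf_ple ?posrE//; have i0 : 0 <= m^-1 by rewrite invr_ge0 ltW.
by apply: ltW; apply: lt_le_trans (archi_boundP i0) _; rewrite ler_nat; exact: leq_trans mn _.
Qed.

(** An ultrafilter finer than [\oo] contains all tails, so indices of any prescribed accuracy occur
    beyond every bound. The number 1 / (j + 1) sets both the compact part of the disc and the
    precision there. *)
Lemma montel_subseq p (B : R) (u : nat -> C -> C) : 0 < p ->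
  (forall n, holo (u n)) -> (forall n, (CI p (u n) 0%R <= B%:E)%E) ->
  (forall n, (DI p (u n) <= B%:E)%E) ->
  exists (k : nat -> nat) v, [/\ {homo k : m n / (m < n)%N}, holo v &
    forall j z, cmod z <= 1 - j.+1%:R^-1 -> cmod (u (k j) z - v z) < j.+1%:R^-1].
Proof.
move=> p0 hu uC uD; have [U [UU sU]] := @ultraFilterLemma nat \oo _.
have PU := @ultra_proper _ _ UU.
have [v [hv vP]] := montel p0 UU hu uC uD.
have ex (q : nat * nat) : exists n, (q.2 < n)%N /\
    forall z, cmod z <= 1 - q.1.+1%:R^-1 -> cmod (u n z - v z) < q.1.+1%:R^-1.
  have q0 : 0 < q.1.+1%:R^-1 :> R by rewrite invr_gt0.
  have U1 : U [set n | (q.2 < n)%N] by apply: sU; exists q.2.+1.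
  have q1 : 1 - q.1.+1%:R^-1 < 1 :> R by rewrite ltrBlDr ltrDl.
  have [n [n1 n2]] := filter_ex (filterI U1 (vP _ _ q1 q0)).
  by exists n.
have /choice[c cP] := ex.
pose k := fix k j := if j is j'.+1 then c (j, k j') else c (0%N, 0%N).
exists k, v; split=> //.
  apply: homo_ltn => [x y z|i]; first exact: ltn_trans.
  exact: (cP (i.+1, k i)).1.
by move=> [|j] z; [exact: (cP (0%N, 0%N)).2|exact: (cP (j.+1, k j)).2].
Qed.

Section VolterraCompact.
Variables (p : R) (h : C -> C).
Hypotheses (p0 : 0 < p).
Local Notation X := (@dirichlet_space R p).
Local Notation Y := (@F_space R p (p - 1) 1).
Local Notation NX := (@dirichlet_norm R p).
Local Notation NY := (@F_norm R p (p - 1) 1).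

Lemma bloch_bound : bloch h -> exists2 B : R, 0 <= B & forall z, cmod z < 1 -> bloch_weight h z <= B.
Proof.
move=> [hh hB].
have H z : cmod z < 1 -> ((bloch_weight h z)%:E <= bloch_norm h)%E.
  by move=> z1; apply: ereal_sup_ubound; exists z.
have o1 : cmod (0 : C) < 1 by rewrite cmod0.
have w0 : 0 <= bloch_weight h 0 by rewrite mulr_ge0 ?cmod_ge0// ltW// W_gt0.
have fn : bloch_norm h \is a fin_num.
  rewrite fin_numElt hB andbT; apply: lt_le_trans (H _ o1); exact: ltNyr.
exists (fine (bloch_norm h)); first by apply: le_trans w0 _; rewrite -lee_fin fineK// H.
by move=> z z1; rewrite -lee_fin fineK// H.
Qed.

Lemma norm_bound f : X f -> exists2 M : R, 0 <= M & (NX f <= M%:E)%E.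
Proof.
move=> [_ hf]; have N0 : (0 <= NX f)%E by exact: poweR_ge0.
by exists (fine (NX f)); rewrite ?fine_ge0// fineK// ge0_fin_numE.
Qed.

Lemma volterra_linear_op : bloch h -> linear_op X Y (volterra h).
Proof.
move=> bh; have [hh _] := (hol_discE h).1 bh.1; have [B B0 hB] := bloch_bound bh.
have [c c0 cP] := CI_bound p0.
split; last first.
  move=> a f g [/hol_discE[hf _] _] [/hol_discE[hg _] _]; exact: volterra_linear.
move=> f Xf; have [M M0 fM] := norm_bound Xf; have [hf _] := (hol_discE f).1 Xf.1.
split; first exact: volterra_hol.
have K0 : 0 <= B `^ p * (c * M `^ p) by rewrite !mulr_ge0 ?powR_ge0// ltW.
apply: le_lt_trans (F_norm_WI p0 K0 (volterra0 h f) _) (ltry _).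
move=> a a1; rewrite (eq_WI _ _ (v := fun z => f z * derive1 h z)); last first.
  by move=> z z1; exact: has_deriv_derive1 (volterra_deriv hh hf z1).
apply: le_trans (WI_le p0 hf (holo_derive1 hh) a1 B0 hB) _.
by rewrite EFinM lee_wpmul2l ?lee_fin ?powR_ge0//; exact: cP Xf.1 M0 fM a a1.
Qed.

(** Let D be the difference of the n-th function of the subsequence and v. On |z| <= 1 - 1/(n+1) the
    factor |D| is small and W |h'| is bounded; beyond it W |h'| is small and |D|^p om_a has bounded
    integral. Both estimates are uniform in a. *)
Lemma volterra_compact : little_bloch h -> compact_op X Y NX NY (volterra h).
Proof.
move=> [bh hl]; split; first exact: volterra_linear_op.
have [hh _] := (hol_discE h).1 bh.1; have [B0 B00 hB] := bloch_bound bh.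
have hh' := holo_derive1 hh.
have [c c0 cP] := CI_bound p0; have [co co0 coP] := om_int R.
move=> M u uM.
have M0 : 0 <= M.
  by rewrite -lee_fin; apply: le_trans (uM 0%N).2; exact: poweR_ge0.
have hu n : holo (u n) by case: ((hol_discE (u n)).1 (uM n).1.1).
have pp : 0 < pi :> R := pi_gt0 R.
pose B := c * M `^ p + pi * M `^ p.
have B1 : c * M `^ p <= B by rewrite lerDl mulr_ge0 ?powR_ge0// ltW.
have B2 : pi * M `^ p <= B by rewrite lerDr mulr_ge0 ?powR_ge0// ltW.
have BB0 : 0 <= B by apply: le_trans B2; rewrite mulr_ge0 ?powR_ge0// ltW.
have uC n a : cmod a < 1 -> (CI p (u n) a <= B%:E)%E.
  by move=> a1; apply: le_trans (cP _ _ (uM n).1.1 M0 (uM n).2 a a1) _; rewrite lee_fin.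
have uD n : (DI p (u n) <= B%:E)%E.
  have := (uM n).2; rewrite dirichlet_norm_le// => H.
  apply: (@le_trans _ _ (pi * M `^ p)%:E); last by rewrite lee_fin.
  have -> : DI p (u n) = (pi%:E * ((pi^-1)%:E * DI p (u n)))%E.
    by rewrite muleA -EFinM divff ?gt_eqF// mul1e.
  rewrite EFinM lee_wpmul2l ?lee_fin ?(ltW pp)//; apply: le_trans H.
  by rewrite leeDr// lee_fin powR_ge0.
have o1 : cmod (0 : C) < 1 by rewrite cmod0.
have [k [v [kh hv kP]]] := montel_subseq p0 hu (fun n => uC n 0 o1) uD.
have vC a : cmod a < 1 -> (CI p v a <= B%:E)%E.
  move=> a1; apply: (fatou_CI p0 (fun n => hu (k n)) hv a1) => // [z z1|n]; last exact: uC.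
  apply/cvgrPdist_lt => e e0.
  have z0 : 0 < 1 - cmod z by rewrite subr_gt0.
  pose d := Num.min e (1 - cmod z); have d0 : 0 < d by rewrite lt_min e0.
  exists (Num.bound d^-1) => // n /= dn.
  have nd : n.+1%:R^-1 <= d by exact: invS_small.
  have [de dz] : d <= e /\ d <= 1 - cmod z by rewrite /d !ge_min !lexx orbT.
  have kz : cmod (u (k n) z - v z) < n.+1%:R^-1 by apply: kP; have := le_trans nd dz; rewrite lerBrDr -lerBrDl.
  apply: le_lt_trans (lt_le_trans kz (le_trans nd de)).
  have h1 := ler_cmodB (u (k n) z) (v z); have h2 := ler_cmodB (v z) (u (k n) z).
  by rewrite cmodBC in h2; rewrite distrC ler_norml h1 andbT lerNl opprB.
exists k, (volterra h v); split=> //.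
  split; first exact: volterra_hol.
  have K0 : 0 <= B0 `^ p * B by rewrite mulr_ge0 ?powR_ge0.
  apply: le_lt_trans (F_norm_WI p0 K0 (volterra0 h v) _) (ltry _).
  move=> a a1; rewrite (eq_WI _ _ (v := fun z => v z * derive1 h z)); last first.
    by move=> z z1; exact: has_deriv_derive1 (volterra_deriv hh hv z1).
  apply: le_trans (WI_le p0 hv hh' a1 B00 hB) _.
  by rewrite EFinM lee_wpmul2l ?lee_fin ?powR_ge0// vC.
apply: cvg_to_zero => [n|e e0]; first exact: poweR_ge0.
(* The two summands stem from the inner part, through [om_int], and from the outer part, through
   [CI_sub]. *)
pose K2 := B0 `^ p * co + 2 `^ p * (B + B).
have K20 : 0 <= K2.
  apply: addr_ge0; first by apply: mulr_ge0; [exact: powR_ge0|exact: ltW].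
  by apply: mulr_ge0; [exact: powR_ge0|exact: addr_ge0].
pose s := (pi^-1 * K2) `^ p^-1; have s0 : 0 <= s by exact: powR_ge0.
pose e' := e / (s + 1); have e'0 : 0 < e' by rewrite divr_gt0// ltr_wpDl.
have [d d0 dP] := (to_circleP _).1 (hl _ (nbhsx_ballx 0 e' e'0)).
pose m := Num.min e' d; have m0 : 0 < m by rewrite lt_min e'0.
exists (Num.bound m^-1) => // n /= mn.
have nm : n.+1%:R^-1 <= m by exact: invS_small.
have [me md] : m <= e' /\ m <= d by rewrite /m !ge_min !lexx orbT.
pose D z := u (k n) z - v z; have hD : holo D by exact: holoB.
have K0 : 0 <= e' `^ p * K2 by rewrite mulr_ge0 ?powR_ge0.
have WD a : cmod a < 1 -> (WI p (fun z => (D z * derive1 h z)%R) a <= (e' `^ p * K2)%:E)%E.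
  move=> a1; have mD := @measurable_dset R; have om0 z := om_ge0 z a1.
  have mom : measurable_fun (@dset R) (fun w => (om a (pt w))%:E).
    by apply/measurable_EFinP; exact: measurable_om.
  have mCD := measurable_CI p hD a1.
  apply: (@le_trans _ _ (\int[leb2]_(w in @dset R) ((e' `^ p)%:E * ((B0 `^ p)%:E * (om a (pt w))%:E +
      (cmod (D (pt w)) `^ p * om a (pt w))%:E)))%E).
    apply: ge0_le_integral => //.
    - by move=> w _; rewrite lee_fin; apply: mulr_ge0; [rewrite mulr_ge0 ?powR_ge0|exact: om0].
    - exact: (measurable_WI p (holoM hD hh') a1).
    - by apply: measurable_funeM; apply: emeasurable_funD => //; exact: measurable_funeM.
    move=> w w1; have w2 : cmod (pt w) < 1 by [].
    have W0 := W_gt0 w2; rewrite -(EFinM (B0 `^ p)) -EFinD -EFinM lee_fin -mulrDl [leRHS]mulrA ler_wpM2r//.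
    have D0 := cmod_ge0 (D (pt w)); have h0 := cmod_ge0 (derive1 h (pt w)).
    have bw : bloch_weight h (pt w) = (1 - cmod (pt w) ^+ 2) * cmod (derive1 h (pt w)) by [].
    have b0 : 0 <= bloch_weight h (pt w) by rewrite bw mulr_ge0// ltW.
    have -> : cmod (D (pt w) * derive1 h (pt w)) `^ p * (1 - cmod (pt w) ^+ 2) `^ p =
        cmod (D (pt w)) `^ p * bloch_weight h (pt w) `^ p.
      by rewrite cmodM powRM// bw [in RHS]powRM ?(ltW W0)//; ring.
    have [wn|wn] := leP (cmod (pt w)) (1 - n.+1%:R^-1).
      apply: (@le_trans _ _ (e' `^ p * B0 `^ p)); last by rewrite mulrDr lerDl mulr_ge0 ?powR_ge0.
      apply: ler_pM; rewrite ?powR_ge0//; apply: lepow; rewrite ?(ltW p0)//; last exact: hB.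
      by apply: ltW; apply: lt_le_trans (kP _ _ wn) _; exact: le_trans nm me.
    apply: (@le_trans _ _ (e' `^ p * cmod (D (pt w)) `^ p)); last first.
      by rewrite mulrDr lerDr mulr_ge0 ?powR_ge0.
    rewrite mulrC; apply: ler_pM; rewrite ?powR_ge0//; apply: lepow; rewrite ?(ltW p0)//.
    have wd : 1 - d < cmod (pt w) by apply: le_lt_trans wn; rewrite lerD2l lerN2; exact: le_trans nm md.
    by have := dP _ wd w2; rewrite /ball /= sub0r normrN ger0_norm// => /ltW.
  rewrite ge0_integralZl//; last 3 first.
  - by apply: emeasurable_funD => //; exact: measurable_funeM.
  - by move=> w _; rewrite -EFinM -EFinD lee_fin; apply: addr_ge0; (apply: mulr_ge0; [exact: powR_ge0|exact: om0]).
  - by rewrite lee_fin powR_ge0.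
  rewrite EFinM lee_wpmul2l ?lee_fin ?powR_ge0//.
  rewrite ge0_integralD//; last 3 first.
  - by move=> w _; rewrite -EFinM lee_fin mulr_ge0 ?powR_ge0.
  - exact: measurable_funeM.
  - by move=> w _; rewrite lee_fin mulr_ge0 ?powR_ge0.
  rewrite /K2 EFinD; apply: leeD.
    rewrite ge0_integralZl//; last 2 first.
    - by move=> w _; rewrite lee_fin.
    - by rewrite lee_fin powR_ge0.
    by rewrite EFinM lee_wpmul2l ?lee_fin ?powR_ge0// coP.
  apply: le_trans (CI_sub p0 (hu (k n)) hv a1) _.
  rewrite EFinM lee_wpmul2l ?lee_fin ?powR_ge0// EFinD; apply: leeD; [exact: uC|exact: vC].
apply: (@le_trans _ _ ((pi^-1 * (e' `^ p * K2)) `^ p^-1)%:E).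
  apply: F_norm_WI; [exact: p0|exact: K0|by rewrite /= !volterra0 subrr|].
  move=> a a1; rewrite (eq_WI _ _ (v := fun z => D z * derive1 h z)); first exact: WD.
  move=> z z1; apply: has_deriv_derive1.
  have := has_derivB (volterra_deriv hh (hu (k n)) z1) (volterra_deriv hh hv z1).
  by rewrite -mulrBl.
have -> : (pi^-1 * (e' `^ p * K2)) `^ p^-1 = e' * s.
  rewrite mulrCA powRM ?powR_ge0// ?mulr_ge0 ?invr_ge0 ?(ltW pp)// -powRrM divff ?gt_eqF//.
  by rewrite powRr1 ?(ltW e'0).
by rewrite lee_fin /e' -mulrAC ler_pdivrMr ?ltr_wpDl// ler_wpM2l ?(ltW e0)// lerDl.
Qed.

End VolterraCompact.
End Compactness.

(** * Distance to the little Bloch space *)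

Section BlochDistance.
Variable R : realType.
Local Notation C := (Cplx R).
Implicit Types (F f g h : C -> C) (a z : C) (x d e : R).

Lemma bloch_weight_ge0 g z : cmod z < 1 -> 0 <= bloch_weight g z.
Proof. by move=> z1; apply: mulr_ge0; rewrite ?cmod_ge0// ltW// W_gt0. Qed.

Lemma bloch_limsup_le g x d : 0 < d ->
  (forall z, 1 - d < cmod z -> cmod z < 1 -> bloch_weight g z <= x) ->
  (bloch_limsup g <= x%:E)%E.
Proof.
move=> d0 H; pose A : set C := [set z | 1 - d < cmod z /\ cmod z < 1].
apply: (@le_trans _ _ (ereal_sup [set (bloch_weight g z)%:E | z in A])).
  apply: ereal_inf_lbound; exists A => //.
  by apply/to_circleP; exists d => // z z1 z2; split.
by apply: ge_ereal_sup => _ [z [z1 z2] <-]; rewrite lee_fin H.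
Qed.

Lemma bloch_limsup_lt g x : (bloch_limsup g < x%:E)%E -> exists2 d, 0 < d &
  forall z, 1 - d < cmod z -> cmod z < 1 -> bloch_weight g z <= x.
Proof.
move=> /ereal_inf_lt[_ [A /to_circleP[d d0 dA] <-] Ax].
exists d => // z z1 z2; rewrite -lee_fin; apply: le_trans (ltW Ax).
by apply: ereal_sup_ubound; exists z => //; exact: dA.
Qed.

Lemma bloch_limsup_gt g x d : (x%:E < bloch_limsup g)%E -> 0 < d ->
  exists z, [/\ 1 - d < cmod z, cmod z < 1 & x < bloch_weight g z].
Proof.
move=> xg d0; apply: contrapT => nex; move: xg; apply/negP; rewrite -leNgt.
apply: (bloch_limsup_le d0) => z z1 z2; rewrite leNgt; apply/negP => xz.
by apply: nex; exists z.
Qed.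

Lemma near_circle d : 0 < d -> exists z : C, 1 - d < cmod z /\ cmod z < 1.
Proof.
move=> d0; pose r := 1 - Num.min d 1 / 2.
have m0 : 0 < Num.min d 1 by rewrite lt_min d0 ltr01.
have [m1 m2] : Num.min d 1 <= d /\ Num.min d 1 <= 1 by rewrite !ge_min !lexx orbT.
have r0 : 0 <= r by rewrite /r; lra.
exists (r%:C)%C; rewrite cmod_rc ger0_norm//; split; rewrite /r; lra.
Qed.

Lemma bloch_limsup_ge0 g : (0 <= bloch_limsup g)%E.
Proof.
apply: le_ereal_inf_tmp => _ [A /to_circleP[d d0 dA] <-].
have [z [z1 z2]] := near_circle d0.
apply: (@le_trans _ _ (bloch_weight g z)%:E); first by rewrite lee_fin bloch_weight_ge0.
by apply: ereal_sup_ubound; exists z => //; exact: dA.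
Qed.

Lemma derive1B_disc f g z : holo f -> holo g -> cmod z < 1 ->
  derive1 (f \- g) z = derive1 f z - derive1 g z.
Proof.
by move=> hf hg z1; apply: has_deriv_derive1; apply: has_derivB; exact: holo_has_deriv.
Qed.

Lemma bloch_weightB g h z : holo g -> holo h -> cmod z < 1 ->
  bloch_weight g z <= bloch_weight (g \- h) z + bloch_weight h z.
Proof.
move=> hg hh z1; rewrite /bloch_weight derive1B_disc// -mulrDr.
apply: ler_wpM2l; first by rewrite ltW// W_gt0.
by have := cmodD (derive1 g z - derive1 h z) (derive1 h z); rewrite subrK.
Qed.

(** The Bloch weight of h vanishes at the circle, so near it the weight of g is at most the norm of
    g - h plus e. *)
Lemma limsup_le_dist g : holo g -> (bloch_limsup g <= dist_little_bloch g)%E.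
Proof.
move=> hg; apply: le_ereal_inf_tmp => _ [h [bh hl] <-].
have [hh _] := (hol_discE h).1 bh.1.
have H z : cmod z < 1 -> ((bloch_weight (g \- h) z)%R%:E <= bloch_norm (g \- h)%R)%E.
  by move=> z1; apply: ereal_sup_ubound; exists z.
have o1 : cmod (0 : C) < 1 by rewrite cmod0.
have N0 : (0 <= bloch_norm (g \- h)%R)%E.
  by apply: le_trans (H _ o1); rewrite lee_fin bloch_weight_ge0.
have [Ny|Ny] := eqVneq (bloch_norm (g \- h)) +oo%E; first by rewrite Ny leey.
have Nf : bloch_norm (g \- h) \is a fin_num by rewrite ge0_fin_numE// ltey.
apply/lee_addgt0Pr => e e0; rewrite -(fineK Nf) -EFinD.
have [d d0 dP] := (to_circleP _).1 (hl _ (nbhsx_ballx 0 e e0)).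
apply: (bloch_limsup_le d0) => z z1 z2.
have h1 : bloch_weight (g \- h) z <= fine (bloch_norm (g \- h)).
  by rewrite -lee_fin fineK// H.
have h2 : bloch_weight h z <= e.
  have := dP z z1 z2; rewrite /ball /= sub0r normrN => /ltW h2.
  by apply: le_trans h2; exact: ler_norm.
by apply: le_trans (bloch_weightB hg hh z2) _; exact: lerD.
Qed.

Lemma holo_bounded F (rho : R) : holo F -> rho < 1 ->
  exists2 M, 0 <= M & forall z, cmod z <= rho -> cmod (F z) <= M.
Proof.
move=> hF r1.
have H : \forall n \near \oo, forall z, sqin 0 1 z -> cmod z <= rho -> cmod (F z) <= n%:R.
  apply: sq_near => z _; have [zr|zr] := ltP rho (cmod z).
    exists (cmod z - rho); first by rewrite subr_gt0.
    by apply: filterE => n w wz wr; have := ler_cmodB z w; rewrite cmodBC; lra.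
  have z1 : cmod z < 1 by lra.
  have [d d0 dP] := holo_contc hF z1 ltr01; exists d => //.
  exists (Num.bound (cmod (F z) + 1)) => // n /= nb w wz _.
  have := dP w wz; have := ler_cmodB (F w) (F z).
  have c0 : 0 <= cmod (F z) + 1 by rewrite addr_ge0 ?cmod_ge0.
  have := archi_boundP c0.
  have : (Num.bound (cmod (F z) + 1))%:R <= n%:R :> R by rewrite ler_nat.
  lra.
have [n nP] := filter_ex H; exists n%:R => // z zr; apply: nP => //; rewrite /sqin subr0.
by split; apply: le_trans (ltW (le_lt_trans zr r1)); [exact: Re_le_cmod|exact: Im_le_cmod].
Qed.

(** Restricted to the disc because [hol_disc] demands the value 0 outside, where g(r z) need not
    vanish. *)
Definition dilate (r : R) g : C -> C := (fun z : C => g ((r%:C)%C * z)) \_ (@disc R).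

Section Dilation.
Variables (g : C -> C) (r : R).
Hypotheses (hg : holo g) (r0 : 0 < r) (r1 : r < 1).

Lemma cmod_dilate z : cmod ((r%:C)%C * z : C) = r * cmod z.
Proof. by rewrite cmodM cmod_rc ger0_norm// ltW. Qed.

Lemma dilate_in z : cmod z < 1 -> cmod ((r%:C)%C * z : C) < 1.
Proof. by have := r0; have := r1; rewrite cmod_dilate; have := cmod_ge0 z; nra. Qed.

Lemma dilate_deriv z : cmod z < 1 ->
  has_deriv (dilate r g) z ((r%:C)%C * derive1 g ((r%:C)%C * z)).
Proof.
move=> z1; apply: (has_deriv_disc z1 (F := fun z : C => g ((r%:C)%C * z))).
  by move=> w w1; rewrite /dilate restr_disc.
by apply: has_deriv_chain_scale; apply: holo_has_deriv => //; exact: dilate_in.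
Qed.

Lemma dilate_hol : hol_disc (dilate r g).
Proof.
apply/hol_discE; split; first by move=> z z1; eexists; exact: dilate_deriv.
by move=> z z1; rewrite /dilate patchE memNset.
Qed.

Lemma dilate_weight z : cmod z < 1 -> bloch_weight (dilate r g) z =
  (1 - cmod z ^+ 2) * (r * cmod (derive1 g ((r%:C)%C * z))).
Proof.
move=> z1; rewrite /bloch_weight (has_deriv_derive1 (dilate_deriv z1)).
by rewrite cmodM cmod_rc ger0_norm// ltW.
Qed.

(** g' is bounded by some M on |z| <= r, so the weight of the dilation is at most M W, which tends
    to 0 at the circle. *)
Lemma dilate_little_bloch : little_bloch (dilate r g).
Proof.
have r0' := r0; have r1' := r1.
have [M M0 MP] := holo_bounded (holo_derive1 hg) r1.
have wM z : cmod z < 1 -> bloch_weight (dilate r g) z <= (1 - cmod z ^+ 2) * M.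
  move=> z1; rewrite dilate_weight//; apply: ler_wpM2l; first by rewrite ltW// W_gt0.
  have h : cmod (derive1 g ((r%:C)%C * z)) <= M.
    by apply: MP; rewrite cmod_dilate; have := cmod_ge0 z; nra.
  by have := cmod_ge0 (derive1 g ((r%:C)%C * z)); nra.
split; first split.
- exact: dilate_hol.
- apply: le_lt_trans (ltry M); apply: ge_ereal_sup => _ [z z1 <-].
  rewrite lee_fin; apply: le_trans (wM z z1) _.
  by rewrite ler_piMl// lerBlDr lerDl sqr_ge0.
- move=> A [e /= e0 eA].
  have M1 : 0 < 2 * (M + 1) by lra.
  have d0 : 0 < e / (2 * (M + 1)) by rewrite divr_gt0.
  apply/to_circleP; exists (e / (2 * (M + 1))) => // z z1 z2; apply: eA => /=.
  rewrite sub0r normrN ger0_norm ?bloch_weight_ge0//.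
  apply: le_lt_trans (wM z z2) _.
  have h : (1 - cmod z) * (2 * (M + 1)) < e by rewrite -ltr_pdivlMr//; lra.
  by have := cmod_ge0 z; nra.
Qed.

End Dilation.

Lemma rc_compl (r : R) z : z - (r%:C)%C * z = ((1 - r)%:C)%C * z.
Proof. by rewrite rcB (_ : (1%:C)%C = 1 :> C)// mulrBl mul1r. Qed.

Lemma dilation_split (A B : C) (r : R) :
  A - (r%:C)%C * B = (A - B) + ((1 - r)%:C)%C * B.
Proof. by rewrite -rc_compl addrA subrK. Qed.

(** The factor 2 arises near the circle, where g and its dilation are estimated separately by x = L
    + e / 2; on the compact part |z| <= rho the difference of their derivatives tends to 0 as r ->
    1. *)
Lemma dist_le_limsup g : holo g -> (dist_little_bloch g <= 2%:E * bloch_limsup g)%E.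
Proof.
move=> hg; have L0 := bloch_limsup_ge0 g.
have [Ly|Ly] := eqVneq (bloch_limsup g) +oo%E.
  by rewrite Ly gt0_muley ?leey// lte_fin.
have Lf : bloch_limsup g \is a fin_num by rewrite ge0_fin_numE// ltey.
apply/lee_addgt0Pr => e e0; have e2 : 0 < e / 2 by rewrite divr_gt0.
pose L := fine (bloch_limsup g); pose x := L + e / 2.
have L0' : 0 <= L by rewrite fine_ge0.
have Lx : (bloch_limsup g < x%:E)%E by rewrite -(fineK Lf) lte_fin ltrDl.
have [d' d'0 d'P] := bloch_limsup_lt Lx.
pose d := Num.min d' 1; have d0 : 0 < d by rewrite lt_min d'0 ltr01.
have [dd d1] : d <= d' /\ d <= 1 by rewrite /d !ge_min !lexx orbT.
have dP z : 1 - d < cmod z -> cmod z < 1 -> bloch_weight g z <= x by move=> h; apply: d'P; lra.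
pose rho := 1 - d / 2; have rho1 : rho < 1 by rewrite /rho; lra.
have hg' := holo_derive1 hg; have hg'' := holo_derive1 hg'.
have [M1 M10 M1P] := holo_bounded hg' rho1.
have [M2 M20 M2P] := holo_bounded hg'' rho1.
(* For |z| <= rho, |g'(z) - r g'(r z)| <= s (2 M2 + M1), by the mean value inequality for g' and 1 -
   r = s. The other constraint s <= d / 2 keeps |r z| > 1 - d when |z| > rho. *)
pose K := 2 * M2 + M1 + 1; have K0 : 0 < K by rewrite /K; lra.
pose s := Num.min (d / 2) (e / K).
have s0 : 0 < s by rewrite lt_min !divr_gt0.
have [sd se] : s <= d / 2 /\ s <= e / K by rewrite /s !ge_min !lexx orbT.
have seK : s * K <= e by rewrite -ler_pdivlMr.
pose r := 1 - s; have r0 : 0 < r by rewrite /r; lra.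
have r1 : r < 1 by rewrite /r; lra.
have rs : 1 - r = s by rewrite /r; ring.
apply: (@le_trans _ _ (bloch_norm (g \- dilate r g))).
  by apply: ereal_inf_lbound; exists (dilate r g) => //; exact: dilate_little_bloch.
apply: ge_ereal_sup => _ [z z1 <-].
rewrite -(fineK Lf) -EFinM -EFinD lee_fin -/L.
have zz : cmod z < 1 := z1; have z0 := cmod_ge0 z; have W0 := W_gt0 zz.
have hd : holo (dilate r g) by case: ((hol_discE _).1 (dilate_hol hg r0 r1)).
rewrite /bloch_weight derive1B_disc// (has_deriv_derive1 (dilate_deriv hg r0 r1 zz)).
have rz : cmod ((r%:C)%C * z : C) = r * cmod z by exact: cmod_dilate.
have rz1 : cmod ((r%:C)%C * z : C) < 1 by exact: dilate_in.
set A : C := derive1 g z; set B : C := derive1 g ((r%:C)%C * z).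
have [zr|zr] := leP (cmod z) rho.
  have AB : cmod (A - B) <= 2 * M2 * s.
    have h : cmod (A - B) <= 2 * M2 * cmod (z - (r%:C)%C * z).
      apply: (mean_value_ineq (f' := derive1 (derive1 g))) => t t01.
        apply: holo_has_deriv => //; apply: le_lt_trans (cmod_seg _ _ t01) _; exact: conv_lt.
      apply: M2P; apply: le_trans (cmod_seg _ _ t01) _; apply: conv_le => //.
      by rewrite rz; apply: le_trans zr; rewrite ler_piMl// ltW.
    apply: le_trans h _; apply: ler_wpM2l; first by rewrite mulr_ge0.
    have -> : z - (r%:C)%C * z = (s%:C)%C * z by rewrite rc_compl rs.
    by rewrite cmodM cmod_rc ger0_norm ?(ltW s0)// ler_piMr// ltW.
  have BM : cmod B <= M1.
    by apply: M1P; rewrite rz; apply: le_trans zr; rewrite ler_piMl// ltW.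
  have ABr : cmod (A - (r%:C)%C * B) <= e.
    rewrite (dilation_split A B r) rs.
    apply: le_trans (cmodD _ _) _; rewrite cmodM cmod_rc ger0_norm ?(ltW s0)//.
    have h1 : s * cmod B <= s * M1 by rewrite ler_wpM2l// ltW.
    by apply: le_trans seK; rewrite /K; lra.
  have W1 : 1 - cmod z ^+ 2 <= 1 by rewrite lerBlDr lerDl sqr_ge0.
  apply: (@le_trans _ _ (1 * cmod (A - (r%:C)%C * B))); first by rewrite ler_wpM2r ?cmod_ge0.
  by rewrite mul1r; lra.
have zd : 1 - d < cmod z by apply: le_lt_trans zr; rewrite /rho; lra.
have rzd : 1 - d < cmod ((r%:C)%C * z : C).
  rewrite rz /r; have : s * cmod z <= s by rewrite ler_piMr// ltW.
  by rewrite /rho in zr; lra.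
have gA := dP z zd zz; have gB := dP _ rzd rz1.
(* Passing from z to r z increases W, and r <= 1, so the weight of the dilation at z is at most that
   of g at r z. *)
have h1 : (1 - cmod z ^+ 2) * cmod ((r%:C)%C * B) <= x.
  apply: le_trans gB; rewrite /bloch_weight -/B rz cmodM cmod_rc ger0_norm ?(ltW r0)//.
  apply: ler_pM; rewrite ?mulr_ge0 ?cmod_ge0 ?(ltW W0) ?(ltW r0)//.
    rewrite lerD2l lerN2 exprMn ler_piMl ?sqr_ge0//.
    by apply: exprn_ile1; exact: ltW.
  by rewrite ler_piMl ?cmod_ge0// ltW.
have h2 : (1 - cmod z ^+ 2) * cmod A <= x := gA.
have : (1 - cmod z ^+ 2) * cmod (A - (r%:C)%C * B) <=
    (1 - cmod z ^+ 2) * (cmod A + cmod ((r%:C)%C * B)).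
  by rewrite ler_wpM2l ?(ltW W0)//; exact: cmodB.
move=> h3; apply: (le_trans h3); rewrite mulrDr; apply: (le_trans (lerD h2 h1)).
by rewrite (_ : x + x = 2 * L + e)// /x; field.
Qed.

End BlochDistance.

(** * Essential norm *)

Section EssentialNorm.
Variable R : realType.
Local Notation C := (Cplx R).
Local Notation leb := (@lebesgue_measure R).
Local Notation leb2 := (leb \x leb)%E.
Implicit Types (f g h u v : C -> C) (a z : C).

(** Quasi-triangle inequality, valid for every p > 0; f is only dominated by u and v, so sums and
    differences are covered alike. *)
Lemma WI_add (p : R) u v f a : 0 < p -> holo u -> holo v -> holo f -> cmod a < 1 ->
  (forall z, cmod z < 1 -> cmod (f z) <= cmod (u z) + cmod (v z)) ->
  (WI p f a <= (2 `^ p)%:E * (WI p u a + WI p v a))%E.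
Proof.
move=> p0 hu hv hf a1 fuv; have mD := @measurable_dset R; have om0 z := om_ge0 z a1.
have mu := measurable_WI p hu a1; have mv := measurable_WI p hv a1.
have g0 (x : C -> C) w : (0 <= (cmod (x (pt w)) `^ p * (1 - cmod (pt w) ^+ 2) `^ p * om a (pt w))%:E)%E.
  by rewrite lee_fin; apply: mulr_ge0; [rewrite mulr_ge0 ?powR_ge0|exact: om0].
rewrite -ge0_integralD// -ge0_integralZl//; last 2 first.
- exact: emeasurable_funD.
- by move=> w _; rewrite adde_ge0.
apply: ge0_le_integral => //.
- exact: measurable_WI.
- by apply: measurable_funeM; exact: emeasurable_funD.
move=> w w1; rewrite -EFinD -EFinM lee_fin -mulrDl [leRHS]mulrA ler_wpM2r//.
rewrite -mulrDl mulrA ler_wpM2r ?powR_ge0//.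
apply: le_trans (powR_add_le (ltW p0) (cmod_ge0 _) (cmod_ge0 _)).
by apply: lepow; rewrite ?(ltW p0) ?cmod_ge0// fuv.
Qed.

Lemma addr_cancel_common (x y w x' y' : C) : x + y + w - (x' + y' + w) = (x - x') + (y - y').
Proof. by ring. Qed.

Lemma tau_diag a : cmod a < 1 -> tau a a = 1 - cmod a ^+ 2.
Proof.
move=> a1; have e0 := W_gt0 a1.
have := tau_sqr a a; rewrite subrr cmod0 expr0n subr0 -expr2 => /eqP.
by rewrite eqrXn2 ?(ltW e0)// ?(ltW (tau_gt0 a1 a1))// => /eqP.
Qed.

Lemma tau_near a z : cmod a < 1 -> tau a z <= 1 - cmod a ^+ 2 + cmod (z - a).
Proof.
move=> a1; rewrite -tau_diag// /tau.
have -> : 1 - a^*%C * z = (1 - a^*%C * a) - a^*%C * (z - a) by ring.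
apply: le_trans (cmodB _ _) _; rewrite lerD2l cmodM cmod_conj ler_piMl ?cmod_ge0//.
exact: ltW.
Qed.

(** On the square of half-side (1 - |a|) / 4 around a one has W >= E / 4 and om_a >= 1 / (4 E), with
    E = 1 - |a|^2; the sub-mean value property contributes an area of order E^2. *)
Lemma WI_lower (p : R) : 0 < p -> exists2 c : R, 0 < c & forall u a, holo u -> cmod a < 1 ->
  ((c * ((1 - cmod a ^+ 2) `^ p * (1 - cmod a ^+ 2) * cmod (u a) `^ p))%:E <= WI p u a)%E.
Proof.
move=> p0; have [k k0 kP] := sub_mean p0.
pose c : R := (4 `^ p * 4 * (8 * 8) * k)^-1.
have p4 : 0 < 4 `^ p :> R by rewrite powR_gt0.
have c0 : 0 < c by rewrite invr_gt0 !mulr_gt0.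
exists c => // u a hu a1; have E0 := W_gt0 a1; set E := 1 - cmod a ^+ 2 in E0 *.
have a0 := cmod_ge0 a.
have EA : E <= 2 * (1 - cmod a) by rewrite /E; nra.
pose r := (1 - cmod a) / 4; have r0 : 0 < r by rewrite divr_gt0// subr_gt0.
have rE : E / 8 <= r by rewrite /r; lra.
have ar : cmod a + 2 * r < 1 by rewrite /r; lra.
have mD := @measurable_dset R; have mS := @measurable_sq R a r; have sD := sq_dset ar.
pose q : R := (E / 4) `^ p / (4 * E).
have q0 : 0 < q by rewrite divr_gt0 ?powR_gt0 ?mulr_gt0// divr_gt0.
apply: (@le_trans _ _ (q%:E * sq_int p u a r)%E); last first.
  rewrite -ge0_integralZl//; last 3 first.
  - exact: measurable_sq_pow.
  - by move=> w _; rewrite lee_fin powR_ge0.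
  - by rewrite lee_fin ltW.
  apply: (@le_trans _ _ (\int[leb2]_(w in sq a r)
      (cmod (u (pt w)) `^ p * (1 - cmod (pt w) ^+ 2) `^ p * om a (pt w))%:E)%E); last first.
    apply: ge0_subset_integral => //; first exact: measurable_WI.
    move=> w _; rewrite lee_fin; apply: mulr_ge0; [by rewrite mulr_ge0 ?powR_ge0|exact: om_ge0].
  apply: ge0_le_integral => //.
  - by move=> w _; rewrite -EFinM lee_fin mulr_ge0 ?powR_ge0// ltW.
  - by apply: measurable_funeM; exact: measurable_sq_pow.
  - exact: measurable_funS (measurable_WI p hu a1).
  move=> w wS; have w1 : cmod (pt w) < 1 := sD w wS.
  have wa : cmod (pt w - a) <= 2 * r.
    by move/sqP: wS => [h1 h2]; have := cmod_leReIm (pt w - a); lra.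
  have w0 := cmod_ge0 (pt w); have wz := ler_cmodB (pt w) a.
  have W4 : E / 4 <= 1 - cmod (pt w) ^+ 2.
    have : (1 - cmod a) / 2 <= 1 - cmod (pt w) by rewrite /r in wa; lra.
    by nra.
  have t0 := tau_gt0 a1 w1.
  have t2 : tau a (pt w) <= 2 * E.
    have := tau_near (pt w) a1; rewrite -/E /r in wa *.
    have : 1 - cmod a <= E by rewrite /E; nra.
    lra.
  have o4 : (4 * E)^-1 <= om a (pt w).
    rewrite /om -/E ler_pdivlMr ?exprn_gt0// mulrC ler_pdivrMr ?mulr_gt0//.
    have : tau a (pt w) ^+ 2 <= (2 * E) ^+ 2 by rewrite lerXn2r ?nnegrE ?(ltW t0) ?mulr_ge0 ?(ltW E0).
    by rewrite [in X in X -> _]expr2; nra.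
  rewrite -EFinM lee_fin mulrC -mulrA ler_wpM2l ?powR_ge0//.
  apply: ler_pM; rewrite ?powR_ge0 ?invr_ge0 ?mulr_ge0 ?(ltW E0)//.
  by apply: lepow; [exact: ltW|rewrite divr_ge0// ltW|exact: W4].
have := kP u a r hu r0 ar; move=> h.
have h2 : ((k^-1 * (r ^+ 2 * cmod (u a) `^ p))%:E <= sq_int p u a r)%E.
  by rewrite EFinM lee_pdivrMl.
apply: le_trans (lee_wpmul2l _ h2); last by rewrite lee_fin ltW.
rewrite -EFinM lee_fin.
have E8 : 0 <= E / 8 by rewrite divr_ge0// ltW.
have rr : (E / 8) ^+ 2 <= r ^+ 2 by rewrite ler_sqr ?nnegrE ?(ltW r0).
have ki0 : 0 <= k^-1 by rewrite invr_ge0 ltW.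
apply: (@le_trans _ _ (q * (k^-1 * ((E / 8) ^+ 2 * cmod (u a) `^ p)))); last first.
  by rewrite ler_wpM2l ?(ltW q0)// ler_wpM2l// ler_wpM2r ?powR_ge0.
rewrite /q powRM ?(ltW E0) ?invr_ge0//.
have -> : (4^-1 : R) `^ p = (4 `^ p)^-1 by rewrite -powR_inv1// -!powRrM mulN1r powRN.
rewrite le_eqVlt; apply/orP; left; apply/eqP; rewrite /c.
by field; rewrite !gt_eqF.
Qed.

Lemma scaled_hol (c : R) f : hol_disc f -> hol_disc (fun z => (c%:C)%C * f z).
Proof.
move=> /hol_discE[hf f0]; apply/hol_discE; split; last by move=> z /f0 ->; rewrite mulr0.
by apply: holoM => //; exact: holo_cst.
Qed.

Lemma scaled_norm (p N : R) f : 0 < p -> 0 < N -> hol_disc f ->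
  (dirichlet_norm p f <= N%:E)%E ->
  (dirichlet_norm p (fun z => ((N^-1)%:C)%C * f z)%R <= 1)%E.
Proof.
move=> p0 N0 hf; have [hf' _] := (hol_discE f).1 hf.
have Ni : 0 <= N^-1 by rewrite invr_ge0 ltW.
have cp0 : 0 <= N^-1 `^ p by exact: powR_ge0.
move=> H; rewrite (dirichlet_norm_le f p0 (ltW N0)) in H.
rewrite (dirichlet_norm_le _ p0 ler01) powR1.
have -> : DI p (fun z => ((N^-1)%:C)%C * f z) = ((N^-1 `^ p)%:E * DI p f)%E.
  have mD := @measurable_dset R.
  rewrite -ge0_integralZl//; last 2 first.
  - apply/measurable_EFinP; apply: measurable_funM; last exact: measurable_W.
    apply/measurable_EFinP; apply: measurable_holo_pow => //; exact: holo_derive1.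
  - by move=> w _; rewrite lee_fin mulr_ge0 ?powR_ge0.
  apply: eq_integral => w /set_mem w1.
  have -> : derive1 ((fun z => ((N^-1)%:C)%C * f z) : C -> C) (pt w) = ((N^-1)%:C)%C * derive1 f (pt w).
    apply: has_deriv_derive1.
    have := has_derivM (has_deriv_cst ((N^-1)%:C)%C (pt w)) (holo_has_deriv hf' w1).
    by rewrite mul0r add0r.
  by rewrite -EFinM cmodM cmod_rc ger0_norm// powRM ?cmod_ge0// mulrA.
rewrite cmodM cmod_rc ger0_norm// powRM ?cmod_ge0// EFinM muleCA -ge0_muleDr; last 2 first.
- by rewrite lee_fin powR_ge0.
- by rewrite mule_ge0 ?DI_ge0// lee_fin invr_ge0 pi_ge0.
apply: (le_trans (lee_wpmul2l _ H)); first by rewrite lee_fin.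
by rewrite -EFinM lee_fin -powRM ?(ltW N0)// mulVf ?gt_eqF// powR1.
Qed.

Section Bounds.
Variable p : R.
Hypothesis p0 : 0 < p.
Local Notation X := (@dirichlet_space R p).
Local Notation Y := (@F_space R p (p - 1) 1).
Local Notation NX := (@dirichlet_norm R p).
Local Notation NY := (@F_norm R p (p - 1) 1).

(** For each h the operator [volterra h] is a competitor, and T_g - T_h has the derivative f (g -
    h)'. The constant is the p-th root of the Carleson constant over pi. *)
Lemma ess_norm_upper : exists2 c : R, 0 < c & forall g, hol_disc g ->
  (ess_norm X Y NX NY (volterra g) <= c%:E * dist_little_bloch g)%E.
Proof.
have [c c0 cP] := CI_bound p0; have pp : 0 < pi :> R := pi_gt0 R.
have pc0 : 0 < pi^-1 * c by rewrite mulr_gt0 ?invr_gt0.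
pose k := (pi^-1 * c) `^ p^-1; have k0 : 0 < k by rewrite powR_gt0.
exists k => // g /hol_discE[hg _].
rewrite -lee_pdivrMl//; apply: le_ereal_inf_tmp => _ [h hl <-]; rewrite lee_pdivrMl//.
have [hh _] := (hol_discE h).1 hl.1.1.
apply: (@le_trans _ _ (op_norm X NX NY (fun f => volterra g f \- volterra h f))).
  by apply: ereal_inf_lbound; exists (volterra h) => //; exact: volterra_compact.
have H z : cmod z < 1 -> ((bloch_weight (g \- h) z)%R%:E <= bloch_norm (g \- h)%R)%E.
  by move=> z1; apply: ereal_sup_ubound; exists z.
have o1 : cmod (0 : C) < 1 by rewrite cmod0.
have N0 : (0 <= bloch_norm (g \- h)%R)%E.
  by apply: le_trans (H _ o1); rewrite lee_fin bloch_weight_ge0.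
have [Ny|Ny] := eqVneq (bloch_norm (g \- h)) +oo%E.
  by rewrite Ny gt0_muley ?leey// lte_fin.
have Nf : bloch_norm (g \- h) \is a fin_num by rewrite ge0_fin_numE// ltey.
set n := fine (bloch_norm (g \- h)).
have n0 : 0 <= n by rewrite fine_ge0.
have hn z : cmod z < 1 -> (1 - cmod z ^+ 2) * cmod (derive1 (g \- h) z) <= n.
  by move=> z1; rewrite -lee_fin fineK//; exact: H.
rewrite -(fineK Nf) -/n; apply: ge_ereal_sup => _ [f [Xf f1] <-].
have [hf _] := (hol_discE f).1 Xf.1.
have K0 : 0 <= n `^ p * (c * 1 `^ p) by rewrite !mulr_ge0 ?powR_ge0// ltW.
have hgh : holo (g \- h) by exact: holoB.
apply: (@le_trans _ _ ((pi^-1 * (n `^ p * (c * 1 `^ p))) `^ p^-1)%:E).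
  apply: F_norm_WI; [exact: p0|exact: K0|by rewrite /= !volterra0 subrr|move=> a a1].
  rewrite (eq_WI _ _ (v := fun z => f z * derive1 (g \- h) z)); last first.
    move=> z z1; apply: has_deriv_derive1; rewrite derive1B_disc// mulrBr.
    by apply: has_derivB; exact: volterra_deriv.
  apply: le_trans (WI_le p0 hf (holo_derive1 hgh) a1 n0 hn) _.
  by rewrite EFinM lee_wpmul2l ?lee_fin ?powR_ge0//; exact: cP Xf.1 ler01 f1 a a1.
rewrite powR1 mulr1 mulrCA powRM ?powR_ge0 ?(ltW pc0)// -powRrM divff ?gt_eqF//.
by rewrite powRr1// -EFinM lee_fin mulrC.
Qed.

Lemma WI_of_norm f (M : R) a : 0 <= M -> (NY f <= M%:E)%E -> cmod a < 1 ->
  (WI p (derive1 f) a <= (pi * M `^ p)%:E)%E.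
Proof.
move=> M0 /(F_norm_le f p0 M0) H a1.
have := le_trans (leeDr _ _) (H a a1); rewrite EFinM -lee_pdivrMl ?pi_gt0//.
by apply; rewrite lee_fin powR_ge0.
Qed.

(** By contradiction: if the norm o of T_g - K is below o' = c x for some x below the limsup, then
    T_g - K and the error of the convergent subsequence are both controlled by o', while the Bloch
    weight at the points a_n exceeds x. *)
Lemma ess_norm_lower : exists2 c : R, 0 < c & forall g, hol_disc g ->
  (c%:E * bloch_limsup g <= ess_norm X Y NX NY (volterra g))%E.
Proof.
have [b bp] : exists b : nat, 2 <= b%:R * p.
  exists (Num.bound (2 / p)); rewrite -ler_pdivrMr//; apply: ltW; apply: archi_boundP.
  by rewrite divr_ge0// ltW.
have [N N0 NP] := test_fun_norm p0 bp.
have [c2 c20 c2P] := WI_lower p0.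
have pp : 0 < pi :> R := pi_gt0 R.
(* Two applications of the quasi-triangle inequality give 2^p 2^p, and four terms bounded by pi o'^p
   give 4 pi. *)
pose Q : R := 2 `^ p * (2 `^ p * (4 * pi)).
have Q0 : 0 < Q by rewrite !mulr_gt0 ?powR_gt0.
(* Division by N normalizes the test functions, and the factor 1/2 pays for subtracting the fixed
   one. The root of c2 / Q makes Q o'^p equal to the lower bound supplied by [WI_lower]. *)
pose c := (c2 / Q) `^ p^-1 * (2 * N)^-1.
have N20 : 0 < (2 * N)^-1 by rewrite invr_gt0 mulr_gt0.
have c0 : 0 < c by rewrite mulr_gt0// powR_gt0// divr_gt0.
exists c => // g /hol_discE[hg _]; have hg' := holo_derive1 hg.
apply: le_ereal_inf_tmp => _ [K [[KY _] Kc] <-].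
set T := volterra g; set O := op_norm _ _ _ _.
have OP f : X f -> (NX f <= 1)%E -> (NY (T f \- K f)%R <= O)%E.
  by move=> Xf f1; apply: ereal_sup_ubound; exists f.
have L0 := bloch_limsup_ge0 g.
pose e a z : C := ((N^-1)%:C)%C * test_fun p b a z.
have eh a : cmod a < 1 -> hol_disc (e a).
  by move=> a1; apply: scaled_hol; exact: test_fun_hol.
have e1 a : cmod a < 1 -> (NX (e a) <= 1)%E.
  by move=> a1; apply: scaled_norm => //; [exact: test_fun_hol|exact: NP].
have eX a : cmod a < 1 -> X (e a).
  by move=> a1; split; [exact: eh|apply: le_lt_trans (e1 a a1) (ltry 1)].
have o1 : cmod (0 : C) < 1 by rewrite cmod0.
have O0 : (0 <= O)%E by apply: le_trans (OP _ (eX 0 o1) (e1 0 o1)); exact: poweR_ge0.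
rewrite leNgt; apply/negP => OL.
have Of : O \is a fin_num by rewrite ge0_fin_numE//; exact: lt_le_trans OL (leey _).
pose o := fine O; have oE : O = o%:E by rewrite fineK.
have o0 : 0 <= o by rewrite fine_ge0.
(* A real x placed strictly inside the gap also covers an infinite limsup. *)
have [x ox xL] : exists2 x, o < c * x & (x%:E < bloch_limsup g)%E.
  move: OL; rewrite oE; have [->|Ly] := eqVneq (bloch_limsup g) +oo%E.
    by move=> _; exists ((o + 1) / c); rewrite ?ltry// mulrC divfK ?gt_eqF// ltrDl.
  have Lf : bloch_limsup g \is a fin_num by rewrite ge0_fin_numE// ltey.
  rewrite -(fineK Lf) -EFinM lte_fin; set l := fine _ => ol.
  have oc : o / c < l by rewrite ltr_pdivrMr// mulrC.
  have cc : c * (o / c) = o by rewrite mulrC divfK ?gt_eqF.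
  exists ((o / c + l) / 2); last by rewrite lte_fin; lra.
  by rewrite -[X in X < _]cc ltr_pM2l//; lra.
pose o' := c * x; have o'0 : 0 < o' := le_lt_trans o0 ox.
have x0 : 0 < x by rewrite -(pmulr_rgt0 _ c0).
have /choice[a aP] : forall n : nat, exists a : C,
    [/\ 1 - n.+1%:R^-1 < cmod a, cmod a < 1 & x < bloch_weight g a].
  by move=> n; apply: bloch_limsup_gt => //; rewrite invr_gt0.
have a1 n : cmod (a n) < 1 by case: (aP n).
have eM n : X (e (a n)) /\ (NX (e (a n)) <= 1%:E)%E by split; [exact: eX|exact: e1].
have [k [H [kh [hH _] Hc]]] := Kc 1 (fun n => e (a n)) eM.
have [n0 _ n0P] := zero_cvg_to Hc o'0.
have kn n : (n <= k n)%N.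
  by elim: n => // n ih; apply: leq_ltn_trans ih (kh _ _ (ltnSn n)).
(* m is fixed first, with a bound M for its test function; n is chosen afterwards, so large that M
   E^(1/p) <= 1 / (2 N) at the point [al]. *)
pose m := k n0.
have [M MP] : exists M, forall z, cmod z < 1 -> cmod (e (a m) z) <= M.
  have [M MP] := test_fun_bounded p b (a1 m); exists (N^-1 * M) => z z1.
  rewrite /e cmodM cmod_rc ger0_norm ?invr_ge0 ?(ltW N0)//.
  by rewrite ler_wpM2l ?invr_ge0 ?(ltW N0)// MP.
have M0 : 0 <= M by apply: le_trans (MP 0 o1); exact: cmod_ge0.
have M10 : 0 < 2 * N * (M + 1) by rewrite !mulr_gt0//; lra.
pose y := (2 * N * (M + 1))^-1 `^ p; have y0 : 0 < y by rewrite powR_gt0// invr_gt0.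
have y20 : 0 < y / 2 by rewrite divr_gt0.
pose n := maxn n0 (Num.bound (y / 2)^-1).
have nn0 : (n0 <= n)%N by exact: leq_maxl.
have ny : n.+1%:R^-1 <= y / 2 by apply: invS_small => //; exact: leq_maxr.
pose al := a (k n); have al1 : cmod al < 1 := a1 _.
have [al2 _ alx] := aP (k n); rewrite -/al in al2 alx.
have al0 := cmod_ge0 al.
set E := 1 - cmod al ^+ 2; have E0 : 0 < E := W_gt0 al1.
have Ey : E <= y.
  have h : (k n).+1%:R^-1 <= n.+1%:R^-1 :> R by rewrite lef_pV2 ?posrE// ler_nat ltnS.
  have h2 : E <= 2 * (1 - cmod al) by rewrite /E; nra.
  have h3 : 1 - cmod al < y / 2.
    by apply: lt_le_trans ny; apply: lt_le_trans h; rewrite ltrBlDl -ltrBlDr.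
  apply: (le_trans h2); rewrite -ler_pdivlMl// mulrC; exact: ltW.
have Eyp : E `^ p^-1 <= (2 * N * (M + 1))^-1.
  have -> : (2 * N * (M + 1))^-1 = y `^ p^-1.
    by rewrite /y -powRrM divff ?gt_eqF// powRr1// invr_ge0 ltW.
  by apply: lepow => //; rewrite ?invr_ge0 ltW.
pose f z := e al z - e (a m) z.
have hol_e j : holo (e (a j)) by case: ((hol_discE _).1 (eh _ (a1 j))).
have hf : holo f by exact: (holoB (hol_e (k n)) (hol_e m)).
have fal : (2 * N)^-1 <= cmod (f al) * E `^ p^-1.
  have h1 : cmod (e al al) * E `^ p^-1 = N^-1.
    rewrite /e cmodM cmod_rc ger0_norm ?invr_ge0 ?(ltW N0)// -mulrA.
    by rewrite test_fun_center// mulr1.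
  have h2 : cmod (e (a m) al) * E `^ p^-1 <= (2 * N)^-1.
    apply: (@le_trans _ _ ((M + 1) * (2 * N * (M + 1))^-1)).
      by apply: ler_pM; [exact: cmod_ge0|exact: powR_ge0|apply: le_trans (MP al al1) _; rewrite lerDl|exact: Eyp].
    by rewrite invfM mulrCA divff ?mulr1// gt_eqF//; lra.
  have h3 : (cmod (e al al) - cmod (e (a m) al)) * E `^ p^-1 <= cmod (f al) * E `^ p^-1.
    by rewrite ler_wpM2r ?powR_ge0// ler_cmodB.
  apply: le_trans h3; rewrite mulrBl h1.
  have -> : N^-1 = (2 * N)^-1 + (2 * N)^-1 by field; rewrite gt_eqF.
  by rewrite lerBrDr lerD2l.
have Tdisc j : holo (T (e (a j))) by case: ((hol_discE _).1 (volterra_hol hg (hol_e j))).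
have Kdisc j : holo (K (e (a j))) by case: ((hol_discE _).1 (KY _ (eX _ (a1 j))).1).
have hHo : holo H by case: ((hol_discE _).1 hH).
pose A j : C -> C := derive1 (T (e (a j)) \- K (e (a j))).
pose B j : C -> C := derive1 (K (e (a j)) \- H).
have hA j : holo (A j) by apply: holo_derive1; exact: holoB.
have hB j : holo (B j) by apply: holo_derive1; exact: holoB.
(* The splitting of T e_j - H into (T - K) e_j and K e_j - H, differentiated; in the difference of
   two indices the derivative of H cancels. *)
have AB j z : cmod z < 1 -> e (a j) z * derive1 g z = A j z + B j z + derive1 H z.
  move=> z1; rewrite /A /B !derive1B_disc// (has_deriv_derive1 (volterra_deriv hg (hol_e j) z1)).
  by rewrite addrA subrK subrK.
have WA j : (WI p (A j) al <= (pi * o `^ p)%:E)%E.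
  by apply: WI_of_norm => //; rewrite -oE; apply: OP; [exact: eX|exact: e1].
have WB j : (n0 <= j)%N -> (WI p (B (k j)) al <= (pi * o' `^ p)%:E)%E.
  by move=> nj; apply: WI_of_norm; [exact: ltW|exact: ltW (n0P j nj)|].
have WAB (u v : C -> C) (s : R) : holo u -> holo v -> (WI p u al <= (pi * s)%:E)%E ->
    (WI p v al <= (pi * s)%:E)%E ->
    (WI p (fun z => (u z - v z)%R) al <= (2 `^ p * (2 * pi * s))%:E)%E.
  move=> hu hv us vs; apply: le_trans (WI_add p0 hu hv (holoB hu hv) al1 (fun z _ => cmodB _ _)) _.
  rewrite EFinM lee_wpmul2l ?lee_fin ?powR_ge0//; apply: (le_trans (leeD us vs)).
  by rewrite -EFinD lee_fin; lra.
have WAd := WAB _ _ _ (hA (k n)) (hA m) (WA _) (WA _).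
have WBd := WAB _ _ _ (hB (k n)) (hB m) (WB _ nn0) (WB _ (leqnn n0)).
have Wf : (WI p (fun z => (f z * derive1 g z)%R) al <=
    (2 `^ p * (2 `^ p * (2 * pi * o `^ p) + 2 `^ p * (2 * pi * o' `^ p)))%:E)%E.
  apply: le_trans (WI_add p0 (holoB (hA (k n)) (hA m)) (holoB (hB (k n)) (hB m))
    (holoM hf hg') al1 _) _.
    move=> z z1; apply: le_trans (cmodD _ _); rewrite /f mulrBl /al !AB//.
    by rewrite addr_cancel_common.
  by rewrite EFinM lee_wpmul2l ?lee_fin ?powR_ge0// EFinD; exact: leeD.
have := le_trans (c2P _ _ (holoM hf hg') al1) Wf; rewrite -/E lee_fin => fin.
(* In the factor E^p E of [WI_lower], E^p joins |g'|^p to form the Bloch weight, and E = (E^(1/p))^p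
   joins |f|^p. *)
have low : x `^ p * (2 * N)^-1 `^ p <= E `^ p * E * cmod (f al * derive1 g al) `^ p.
  have -> : E `^ p * E * cmod (f al * derive1 g al) `^ p =
      (bloch_weight g al) `^ p * (cmod (f al) * E `^ p^-1) `^ p.
    have EE : (E `^ p^-1) `^ p = E by rewrite -powRrM mulVf ?gt_eqF// powRr1// ltW.
    rewrite /bloch_weight -/E cmodM !powRM ?cmod_ge0 ?powR_ge0 ?(ltW E0)// EE; ring.
  by apply: ler_pM; rewrite ?powR_ge0//; apply: lepow; rewrite ?(ltW p0) ?(ltW x0) ?(ltW N20) ?(ltW alx).
have oo' : o `^ p < o' `^ p by rewrite gt0_ltr_powR ?nnegrE// ltW.
have o'E : o' `^ p = c2 / Q * ((2 * N)^-1 `^ p * x `^ p).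
  have e2 : ((c2 / Q) `^ p^-1) `^ p = c2 / Q.
    by rewrite -powRrM mulVf ?gt_eqF// powRr1// divr_ge0// ltW.
  have s0 : 0 <= (c2 / Q) `^ p^-1 by exact: powR_ge0.
  have s1 : 0 <= (c2 / Q) `^ p^-1 * (2 * N)^-1 by rewrite mulr_ge0// ltW.
  by rewrite /o' /c [LHS]powRM ?(ltW x0)// [X in X * _]powRM ?(ltW N20)// e2 -mulrA.
have QQ : Q * o' `^ p = c2 * (x `^ p * (2 * N)^-1 `^ p).
  by rewrite o'E; field; rewrite gt_eqF.
(* The contradiction: o < o' makes the upper bound of [WI] strictly smaller than its lower bound. *)
have : 2 `^ p * (2 `^ p * (2 * pi * o `^ p) + 2 `^ p * (2 * pi * o' `^ p)) < Q * o' `^ p.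
  rewrite /Q -!mulrA ltr_pM2l ?powR_gt0// -mulrDr ltr_pM2l ?powR_gt0//.
  have : pi * o `^ p < pi * o' `^ p by rewrite ltr_pM2l.
  lra.
rewrite ltNge; move/negP; apply; rewrite QQ; apply: le_trans fin.
by rewrite ler_wpM2l// ltW.
Qed.

End Bounds.
End EssentialNorm.

Theorem theorem6 (R : realType) (p : R) (hp : 0 < p) :
  exists c : R, 0 < c /\
    forall g : Cplx R -> Cplx R,
      hol_disc g ->
      bounded_op (dirichlet_space p) (F_space p (p - 1) 1)
                 (dirichlet_norm p) (F_norm p (p - 1) 1) (volterra g) ->
      comparable_up_to c
        (ess_norm (dirichlet_space p) (F_space p (p - 1) 1)
                  (dirichlet_norm p) (F_norm p (p - 1) 1) (volterra g))
        (bloch_limsup g) /\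
      comparable_up_to c (bloch_limsup g) (dist_little_bloch g).
Proof.
have [k k0 kP] := ess_norm_upper hp; have [c c0 cP] := ess_norm_lower hp.
have ci0 : 0 < c^-1 by rewrite invr_gt0.
(* c^-1 serves the lower bound of the essential norm, 2 k its upper bound through dist <= 2 limsup,
   and 2 the comparison of limsup and distance. *)
pose M := c^-1 + (2 * k + 2); have M0 : 0 < M by rewrite /M; lra.
exists M; split=> // g gh _; have [hg _] := (hol_discE g).1 gh.
have L0 := bloch_limsup_ge0 g; have LD := limsup_le_dist hg; have DL := dist_le_limsup hg.
split; split.
- apply: le_trans (cP g gh); rewrite lee_wpmul2r// lee_fin invf_ple ?posrE//.
  by rewrite /M; lra.
- apply: le_trans (kP g gh) _.
  apply: (@le_trans _ _ (k%:E * (2%:E * bloch_limsup g))%E).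
    by rewrite lee_wpmul2l// lee_fin ltW.
  by rewrite muleA -EFinM lee_wpmul2r// lee_fin /M; lra.
- rewrite lee_pdivrMl//; apply: (le_trans DL).
  by rewrite lee_wpmul2r// lee_fin /M; lra.
- apply: (le_trans LD); rewrite -[leLHS]mul1e lee_wpmul2r ?(le_trans L0 LD)//.
  by rewrite lee_fin /M; lra.
Qed.
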